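(* Let $\mu,\nu$ be probability measures on $\mathbb{R}^d$ with finite Coulomb energy, and let $\mu-\nu=\mu_+-\nu_-$ be the Hahn–Jordan decomposition of $\mu-\nu$. Assume there exists a set $A$ such that $\mu_+(A)>0$ and such that $\mu_{+|A}$ has Minkowski dimension less than $d-\delta$ for some $0<\delta\le1$. Then $\mu$ is not a Wasserstein critical point of $E_\nu$.
   Context: The Coulomb kernel on $\mathbb{R}^d$ is $G(x,y)=\frac{1}{(d-2)\|x-y\|^{d-2}}$ (for $d=2$, $-\log\|x-y\|$). A probability measure $\rho$ has finite Coulomb energy if $\iint G\,d\rho\otimes d\rho$ is finite. $E_\nu(\mu)=\frac12\iint G(x,y)\,d(\mu-\nu)(x)\,d(\mu-\nu)(y)$. In the Hahn–Jordan decomposition, $\mu_+$ and $\nu_-$ are mutually singular positive measures. The local Minkowski dimension of a measure $\rho$ at $x$ is $\dim^x_{\mathcal M}(\rho)=\lim_{r\to0}\frac{\log\rho(B(x,r))}{\log r}$ when the limit exists; ''$\mu_{+|A}$ has Minkowski dimension less than $d-\delta$'' means that for all $x\in A$ the local dimension $\dim^x_{\mathcal M}(\mu_{+|A})$ exists and is less than $d-\delta$. A probability measure $\mu$ with $\mathcal F(\mu)<+\infty$ is a Wasserstein critical point of a functional $\mathcal F$ if there exists $\tau_0>0$ such that for all $0<\tau\le\tau_0$, $\mu\in\arg\min_{\rho\in\mathcal P(\mathbb{R}^d)}\ \mathcal F(\rho)+\frac1{2\tau}W_2^2(\mu,\rho)$, where $W_2$ is the 2-Wasserstein distance. *)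

(* Defs.v *)
From HB Require Import structures.
From mathcomp Require Import all_boot all_order all_algebra.
From mathcomp Require Import all_classical all_reals all_analysis.

Set Implicit Arguments.
Unset Strict Implicit.
Unset Printing Implicit Defensive.

Import Order.TTheory GRing.Theory Num.Theory.
Import numFieldNormedType.Exports.

Local Open Scope classical_set_scope.
Local Open Scope ring_scope.
Local Open Scope ereal_scope.

(* R^n as n-tuples: the library's sigma-algebra on tuples is the product of the
   Borel sigma-algebras of the coordinates, i.e. the Borel sigma-algebra. *)
Notation Euclid R n := (n.-tuple (measurableTypeR R)).

Definition eucl_dist (R : realType) (n : nat) (x y : Euclid R n) : R :=
  Num.sqrt (\sum_(i < n) (tnth x i - tnth y i) ^+ 2)%R.

Definition eucl_ball (R : realType) (n : nat) (x : Euclid R n) (r : R) :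
  set (Euclid R n) := [set y | (eucl_dist x y < r)%R].

(* The kernel is extended-real valued: for n >= 2 it is +oo on the diagonal
   (lne 0 = -oo and 0^-1 = +oo in \bar R), so that atoms have infinite energy.
   For n = 1 the general formula 1 / ((n - 2) r ^ (n - 2)) reads - r; it is
   written separately because of the negative exponent at r = 0. The branch
   n = 0 is junk. *)
Definition coulomb (R : realType) (n : nat) (z : Euclid R n * Euclid R n) :
    \bar R :=
  let r := eucl_dist z.1 z.2 in
  match n with
  | 1%N => (- r)%:E
  | 2%N => - lne r%:E
  | _ => ((n - 2)%N%:R * r ^+ (n - 2))%R%:E^-1
  end.

Definition finite_coulomb_energy (R : realType) (n : nat)
    (rho : probability (Euclid R n) R) : Prop :=
  (rho \x rho).-integrable [set: Euclid R n * Euclid R n] (@coulomb R n).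

Definition charge_sub (disp : measure_display) (T : measurableType disp)
    (R : realType) (mu nu : {finite_measure set T -> \bar R}) :
    {charge set T -> \bar R} :=
  cadd (charge_of_finite_measure mu) (copp (charge_of_finite_measure nu)).

Section jordan_parts.
Context (disp : measure_display) (T : measurableType disp) (R : realType).
Variable sigma : {charge set T -> \bar R}.

Let hahn : { PN : set T * set T | hahn_decomposition sigma PN.1 PN.2 }.
Proof.
apply: cid; have [P [N PN]] := Hahn_decomposition sigma.
by exists (P, N).
Qed.

Definition charge_pos : {finite_measure set T -> \bar R} :=
  jordan_pos (svalP hahn).

Definition charge_neg : {finite_measure set T -> \bar R} :=
  jordan_neg (svalP hahn).

End jordan_parts.

(* Integrability of f with respect to |sigma| (x) |sigma|. *)
Definition charge_integrable2 (disp : measure_display) (T : measurableType disp)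
    (R : realType) (sigma : {charge set T -> \bar R}) (f : T * T -> \bar R) :
    Prop :=
  [/\ (charge_pos sigma \x charge_pos sigma).-integrable [set: T * T] f,
      (charge_pos sigma \x charge_neg sigma).-integrable [set: T * T] f,
      (charge_neg sigma \x charge_pos sigma).-integrable [set: T * T] f &
      (charge_neg sigma \x charge_neg sigma).-integrable [set: T * T] f].

(* Integral of f with respect to the signed measure sigma (x) sigma. *)
Definition charge_integral2 (disp : measure_display) (T : measurableType disp)
    (R : realType) (sigma : {charge set T -> \bar R}) (f : T * T -> \bar R) :
    \bar R :=
  \int[charge_pos sigma \x charge_pos sigma]_z f z
  - \int[charge_pos sigma \x charge_neg sigma]_z f z
  - \int[charge_neg sigma \x charge_pos sigma]_z f z
  + \int[charge_neg sigma \x charge_neg sigma]_z f z.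

(* The value is +oo when the double integral is not defined as a Lebesgue
   integral; in particular no oo - oo is ever evaluated. *)
Definition coulomb_discrepancy (R : realType) (n : nat)
    (nu mu : probability (Euclid R n) R) : \bar R :=
  let sigma := charge_sub mu nu in
  if `[< charge_integrable2 sigma (@coulomb R n) >]
  then (2^-1)%R%:E * charge_integral2 sigma (@coulomb R n)
  else +oo.

(* The quotient is taken in \bar R, so that a point with
   rho (eucl_ball x r) = 0 for small r has local dimension +oo. *)
Definition local_minkowski_dim (R : realType) (n : nat)
    (rho : set (Euclid R n) -> \bar R) (x : Euclid R n) (l : \bar R) : Prop :=
  lne (rho (eucl_ball x r)) / (ln r)%:E @[r --> 0^'+] --> l.

Definition minkowski_dim_lt (R : realType) (n : nat)
    (rho : set (Euclid R n) -> \bar R) (A : set (Euclid R n)) (s : R) : Prop :=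
  forall x, A x -> exists2 l : \bar R, local_minkowski_dim rho x l & l < s%:E.

Definition couplings (disp : measure_display) (T : measurableType disp)
    (R : realType) (mu rho : probability T R) : set (probability (T * T)%type R) :=
  [set pi | forall B : set T, measurable B ->
     pi (B `*` [set: T]) = mu B /\ pi ([set: T] `*` B) = rho B].

Definition wasserstein2 (R : realType) (n : nat)
    (mu rho : probability (Euclid R n) R) : \bar R :=
  (ereal_inf [set \int[pi]_z ((eucl_dist z.1 z.2) ^+ 2)%R%:E
             | pi in couplings mu rho]) `^ (2^-1)%R.

Definition wasserstein_critical_point (R : realType) (n : nat)
    (F : probability (Euclid R n) R -> \bar R)
    (mu : probability (Euclid R n) R) : Prop :=
  F mu < +oo /\
  exists2 tau0 : R, (0 < tau0)%R &
    forall tau : R, (0 < tau <= tau0)%R ->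
    forall rho : probability (Euclid R n) R,
      F mu + ((2 * tau)^-1)%R%:E * wasserstein2 mu mu ^+ 2 <=
      F rho + ((2 * tau)^-1)%R%:E * wasserstein2 mu rho ^+ 2.

(* Main.v *)
(* Spread the part of mu carried by a set S of points of A by Gaussian noise of
   variance t, and move a fraction e of mu to the result. The transport cost is
   O(e t mu(S)), while the Coulomb kernel is a constant times the superposition
   over v > 0 of the heat kernels of variance v, so that the smoothing removes
   from it exactly the range 0 < v <= t, a positive kernel k_t, up to an additive
   constant. Letting e tend to 0 with the time step fixed, criticality gives
     int_S int k_t d(mu - nu) d(mu) <= C t mu(S).
   Since mu_+ and nu_- are mutually singular, a Besicovitch covering argument
   gives S with mu_+(S) > 0 such that on S both nu_-(B(x, r)) is at most
   half of mu_+(B(x, r)) and mu_+(B(x, r)) >= r^(d - delta) for all small r.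
   The left-hand side is then at least c t^(1 - delta/2) mu(S), which is absurd
   for t small. *)
From HB Require Import structures.
Require Import Defs.
From mathcomp Require Import all_boot all_order all_algebra.
From mathcomp Require Import all_classical all_reals all_analysis.
From mathcomp Require Import measurable_realfun.
From mathcomp Require Import ring lra.

Set Implicit Arguments.
Unset Strict Implicit.
Unset Printing Implicit Defensive.

Import Order.TTheory GRing.Theory Num.Theory.
Import numFieldNormedType.Exports.

Local Open Scope classical_set_scope.
Local Open Scope ring_scope.
Local Open Scope ereal_scope.

(** * Layer cake and Gaussian integrals *)

(** Mixing with weight [e] linearizes the problem: the energy is quadratic in [e] and the cost of
    moving a fraction [e] is at most linear in [e], so dividing by [e] leaves a first-order
    inequality. The constant produced by smoothing enters the interactions with mu and with nu
    through the same multiple of mu(S), both having mass 1, and cancels. So does the common part of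
    mu and nu, which leaves only mu_+ and nu_-. The obstacle is the range of dimensions: for d = 1,
    2 the Coulomb kernel is unbounded below and the time integral of the heat kernel diverges. Hence
    every identity concerns differences with the value at distance 1, split into two nonnegative
    halves. For the same reason the integrability of the cross term is extracted from the finiteness
    of the discrepancy at a critical point. Balls are compared only up to a fixed radius r0; what
    lies beyond costs O(t) mu(S), the order of the transport cost. With t = r^2, the growth of mu_+
    gives a potential of order r^(-d) r^2 r^(d - delta), which exceeds that order by r^(-delta). The
    factor one half in the comparison of balls lets the potential of nu_- be absorbed in that of
    mu_+. *)

Lemma measurable_set_bool d (T : measurableType d) (b : T -> bool) :
  measurable_fun setT b -> measurable [set x | b x].
Proof.
move=> mb; rewrite (_ : [set x | b x] = setT `&` b @^-1` [set true]).
  exact: mb.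
by rewrite setTI; apply/seteqP; split => x /=.
Qed.

Lemma mem_set_bool T (b : T -> bool) x : (x \in [set x | b x]) = b x.
Proof. by apply/idP/idP => [|bx]; rewrite inE. Qed.

Lemma indic_bool T (R : pzRingType) (b : T -> bool) x :
  \1_[set x | b x] x = (b x)%:R :> R.
Proof. by rewrite indicE mem_set_bool. Qed.

Lemma ge0_layer_cake d (T : measurableType d) (R : realType)
    (m : {sigma_finite_measure set T -> \bar R}) (f : T -> R) :
  measurable_fun setT f -> (forall x, 0 <= f x)%R ->
  \int[m]_x (f x)%:E =
  \int[lebesgue_measure]_(l in `[0%R, +oo[) m [set x | (l < f x)%R].
Proof.
move=> mf f0.
pose A : set (T * measurableTypeR R) := [set z | (0 <= z.2)%R && (z.2 < f z.1)%R].
have mA : measurable A.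
  apply: measurable_set_bool; apply: measurable_and.
  - by apply: measurable_fun_ler => //; exact: measurable_snd.
  - by apply: measurable_fun_ltr; [exact: measurable_snd|exact: measurableT_comp].
pose h (z : T * measurableTypeR R) : \bar R := (\1_A z)%:E.
have mh : measurable_fun setT h by apply/measurable_EFinP/measurable_indic.
have h0 z : 0 <= h z by rewrite lee_fin.
transitivity (\int[m]_x \int[lebesgue_measure]_l h (x, l)).
  apply: eq_integral => x _.
  transitivity (lebesgue_measure `[0%R, f x[%classic).
    rewrite lebesgue_measure_itv/= lte_fin oppr0 adde0; case: ltP => // fx0.
    by congr _%:E; apply/eqP; rewrite eq_le fx0 f0.
  rewrite -[X in lebesgue_measure X]setIT -integral_indic//.
rewrite (@fubini_tonelli _ _ _ _ R m lebesgue_measure)//.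
rewrite [RHS]integral_mkcond; apply: eq_integral => l _.
rewrite patchE mem_setE/= in_itv/= andbT; case: ifPn => l0.
  rewrite -[X in m X]setIT -integral_indic//; last first.
    by apply: measurable_set_bool; apply: measurable_fun_ltr.
  by apply: eq_integral => x _; rewrite /h !indic_bool/= l0.
apply: integral0_eq => x _; rewrite /h indic_bool/=.
by rewrite (negbTE l0).
Qed.

(** The hypothesis speaks of sets only. Layer cake turns the left-hand side into an integral of [m]
    over superlevel sets of [f], where it applies, and Tonelli swaps back. *)
Lemma ge0_integral_density d (T : measurableType d) (R : realType)
    (m n : {sigma_finite_measure set T -> \bar R}) (f g : T -> R) :
  measurable_fun setT f -> (forall x, 0 <= f x)%R ->
  measurable_fun setT g -> (forall x, 0 <= g x)%R ->
  (forall A, measurable A -> m A = \int[n]_(x in A) (g x)%:E) ->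
  \int[m]_x (f x)%:E = \int[n]_x (f x * g x)%:E.
Proof.
move=> mf f0 mg g0 mE.
rewrite ge0_layer_cake//.
pose A : set (T * measurableTypeR R) := [set z | (0 <= z.2)%R && (z.2 < f z.1)%R].
have mA : measurable A.
  apply: measurable_set_bool; apply: measurable_and.
  - by apply: measurable_fun_ler => //; exact: measurable_snd.
  - by apply: measurable_fun_ltr; [exact: measurable_snd|exact: measurableT_comp].
pose h (z : T * measurableTypeR R) : \bar R := (g z.1 * \1_A z)%:E.
have mh : measurable_fun setT h.
  apply/measurable_EFinP; apply: measurable_funM; first exact: measurableT_comp.
  exact: measurable_indic.
have h0 z : 0 <= h z by rewrite lee_fin mulr_ge0.
transitivity (\int[n]_x \int[lebesgue_measure]_l h (x, l)); last first.
  apply: eq_integral => x _.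
  transitivity ((g x)%:E * lebesgue_measure `[0%R, f x[%classic); last first.
    rewrite lebesgue_measure_itv/= lte_fin oppr0 adde0 mulrC EFinM; congr *%E.
    case: ltP => // fx0.
    by congr _%:E; apply/eqP; rewrite eq_le fx0 f0.
  rewrite -[X in lebesgue_measure X]setIT -integral_indic//.
  rewrite -ge0_integralZl//; last 2 first.
  - by apply/measurable_EFinP; exact: measurable_indic.
  - by rewrite lee_fin.
rewrite (@fubini_tonelli _ _ _ _ R n lebesgue_measure)//.
rewrite integral_mkcond; apply: eq_integral => l _.
rewrite patchE mem_setE/= in_itv/= andbT; case: ifPn => l0.
  rewrite mE; last by apply: measurable_set_bool; apply: measurable_fun_ltr.
  rewrite integral_mkcond; apply: eq_integral => x _.
  rewrite patchE mem_set_bool /h indic_bool/= l0/=.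
  by case: ifP => _; rewrite ?mulr1 ?mulr0.
apply/esym/integral0_eq => x _; rewrite /h indic_bool/=.
by rewrite (negbTE l0) mulr0.
Qed.

Lemma integral_normal_prob (R : realType) (m s : R) (f : measurableTypeR R -> R) :
  measurable_fun setT f -> (forall x, 0 <= f x)%R ->
  \int[normal_prob m s]_x (f x)%:E =
  \int[lebesgue_measure]_x (f x * normal_pdf m s x)%:E.
Proof.
move=> mf f0.
apply: (@ge0_integral_density _ _ R (normal_prob m s) lebesgue_measure f) => //.
- exact: measurable_normal_pdf.
- by move=> x; exact: normal_pdf_ge0.
Qed.

(* Completing the square: the density of the sum of two independent centered
   normal variables. *)
Lemma integral_normal_prob_gauss (R : realType) (x v t : R) :
  (0 < v)%R -> (0 < t)%R ->
  \int[normal_prob 0 (Num.sqrt t)]_z (expR (- (x + z) ^+ 2 / (2 * v)))%:E =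
  (Num.sqrt (v / (v + t)) * expR (- x ^+ 2 / (2 * (v + t))))%:E.
Proof.
move=> v0 t0.
rewrite integral_normal_prob; last 2 first.
- apply: measurableT_comp => //; apply: measurable_funM => //.
  apply: measurableT_comp => //; apply: measurable_funX => //.
  exact: measurable_funD.
- by move=> z; exact: expR_ge0.
(* As a function of [z], the Gaussian factor times the density of variance [t] is a multiple of the
   normal density of mean [m] and variance [s ^+ 2]. *)
pose s := Num.sqrt (v * t / (v + t)).
pose m := (- x * t / (v + t))%R.
have vt0 : (0 < v + t)%R by rewrite addr_gt0.
have s0 : s != 0%R by rewrite gt_eqF// sqrtr_gt0 divr_gt0// mulr_gt0.
have st0 : Num.sqrt t != 0%R by rewrite gt_eqF// sqrtr_gt0.
have s2 : (s ^+ 2 = v * t / (v + t))%R.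
  by rewrite sqr_sqrtr// divr_ge0// ?ltW// mulr_gt0.
transitivity (\int[lebesgue_measure]_z ((Num.sqrt (v / (v + t)) * expR (- x ^+ 2 / (2 * (v + t))))%:E * (normal_pdf m s z)%:E)).
  apply: eq_integral => z _.
  rewrite !normal_pdfE// -EFinM; congr _%:E.
  have E1 : (Num.sqrt (v / (v + t)) * normal_peak s = normal_peak (Num.sqrt t))%R.
    rewrite /normal_peak s2 sqr_sqrtr ?ltW//.
    have p0 := pi_gt0 R.
    rewrite -!sqrtrV ?mulrn_wge0 ?mulr_ge0 ?divr_ge0 ?mulr_ge0 ?invr_ge0 ?ltW//.
    rewrite -sqrtrM ?divr_ge0 ?ltW//; congr Num.sqrt.
    move: (@pi R) p0 => p p0; field.
    by rewrite (gt_eqF p0) (gt_eqF v0) (gt_eqF t0) (gt_eqF vt0).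
  have E2 : (expR (- (x + z) ^+ 2 / (2 * v)) * normal_fun 0 (Num.sqrt t) z =
      expR (- x ^+ 2 / (2 * (v + t))) * normal_fun m s z)%R.
    rewrite /normal_fun -!expRD; congr expR; rewrite s2 sqr_sqrtr ?ltW// /m.
    by field; rewrite !gt_eqF.
  by rewrite mulrCA E2 -E1; ring.
rewrite integralZl//; last exact: integrable_normal_pdf.
by rewrite integral_normal_pdf mule1.
Qed.

Lemma ex_pushforward d d' (T : measurableType d) (T' : measurableType d')
    (R : realType) (P : probability T R) (f : T -> T') :
  measurable_fun setT f ->
  exists2 Q : probability T' R, (forall A, Q A = P (f @^-1` A)) &
    forall g, measurable_fun setT g -> (forall y, 0 <= g y) ->
      \int[Q]_y g y = \int[P]_x g (f x).
Proof.
move=> mf; pose fm := isMeasurableFun.Build _ _ _ _ f mf.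
pose X : {mfun T >-> T'} := HB.pack f fm.
exists (distribution P X) => // g mg g0.
by rewrite ge0_integral_distribution.
Qed.

Lemma integral_prob_cst d (T : measurableType d) (R : realType)
    (P : probability T R) (c : \bar R) : \int[P]_x c = c.
Proof. by rewrite integral_cst//= probability_setT mule1. Qed.

(** From z^2 <= 4t exp(z^2 / 4t), where the exponential turns the density of variance t into sqrt 2
    times the density of variance 2t. With sqrt 2 <= 2 this gives 8t; any bound linear in t serves
    the transport cost. *)
Lemma integral_normal_prob_sqr_le (R : realType) (t : R) : (0 < t)%R ->
  \int[normal_prob 0 (Num.sqrt t)]_z (z ^+ 2)%:E <= (8 * t)%:E.
Proof.
move=> t0; rewrite integral_normal_prob; last 2 first.
- exact: measurable_funX.
- by move=> z; exact: sqr_ge0.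
have st0 : Num.sqrt t != 0%R by rewrite gt_eqF// sqrtr_gt0.
have s2t0 : Num.sqrt (2 * t) != 0%R by rewrite gt_eqF// sqrtr_gt0 mulr_gt0.
apply: (@le_trans _ _
  (\int[lebesgue_measure]_z ((8 * t)%:E * (normal_pdf 0 (Num.sqrt (2 * t)) z)%:E))).
  apply: ge0_le_integral => //.
  - by move=> z _; rewrite lee_fin mulr_ge0 ?sqr_ge0 ?normal_pdf_ge0.
  - apply/measurable_EFinP; apply: measurable_funM; first exact: measurable_funX.
    exact: measurable_normal_pdf.
  - apply/measurable_EFinP; apply: measurable_funM => //.
    exact: measurable_normal_pdf.
  - move=> z _; rewrite -EFinM lee_fin !normal_pdfE//.
    have E1 : normal_peak (Num.sqrt t) = (Num.sqrt 2 * normal_peak (Num.sqrt (2 * t)))%R.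
      rewrite /normal_peak !sqr_sqrtr ?ltW ?mulr_gt0//.
      have p0 := pi_gt0 R.
      rewrite -!sqrtrV ?mulrn_wge0 ?mulr_ge0 ?ltW//.
      rewrite -sqrtrM//; congr Num.sqrt.
      by move: (@pi R) p0 => p p0; field; rewrite (gt_eqF p0) (gt_eqF t0).
    have E2 : (normal_fun 0 (Num.sqrt (2 * t)) z =
        expR (z ^+ 2 / (4 * t)) * normal_fun 0 (Num.sqrt t) z)%R.
      rewrite /normal_fun -!expRD; congr expR; rewrite !sqr_sqrtr ?ltW ?mulr_gt0//.
      by field; rewrite (gt_eqF t0).
    rewrite E1 E2.
    have e0 := normal_fun_ge0 0 (Num.sqrt t) z.
    have k0 := normal_peak_ge0 (Num.sqrt (2 * t)).
    have sq2 : (Num.sqrt 2 <= 2 :> R)%R.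
      rewrite -[leRHS]ger0_norm// -sqrtr_sqr ler_sqrt; last by rewrite sqr_ge0.
      by rewrite expr2; lra.
    have h : (z ^+ 2 <= 4 * t * expR (z ^+ 2 / (4 * t)))%R.
      rewrite -ler_pdivrMl ?mulr_gt0// mulrC.
      by rewrite (le_trans _ (expR_ge1Dx _))// lerDr.
    set k := normal_peak _ in k0 *; set e := normal_fun _ _ _ in e0 *.
    set E := expR _ in h *.
    have ke0 : (0 <= k * e)%R by rewrite mulr_ge0.
    have E0 : (0 <= E)%R by exact: expR_ge0.
    rewrite (_ : (8 * t * _ = (4 * t * E) * 2 * (k * e))%R); last by ring.
    rewrite (_ : (z ^+ 2 * _ = z ^+ 2 * Num.sqrt 2 * (k * e))%R); last by ring.
    by rewrite ler_wpM2r// ler_pM ?sqr_ge0 ?sqrtr_ge0.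
rewrite integralZl//; last exact: integrable_normal_pdf.
by rewrite integral_normal_pdf mule1.
Qed.

Definition sqnorm (R : realType) n (x : Euclid R n) : R :=
  (\sum_(i < n) tnth x i ^+ 2)%R.

Definition tadd (R : realType) n (x z : Euclid R n) : Euclid R n :=
  [tuple (tnth x i + tnth z i)%R | i < n].

Lemma measurable_tnth_comp d (T : measurableType d) (R : realType) n
    (f : T -> Euclid R n) i :
  measurable_fun setT f -> measurable_fun setT (fun x => tnth (f x) i).
Proof. by move=> mf; exact: (measurableT_comp (measurable_tnth i) mf). Qed.

Lemma measurable_sqnorm (R : realType) n :
  measurable_fun setT (@sqnorm R n).
Proof.
apply: measurable_sum => i; apply: measurable_funX.
exact: measurable_tnth_comp.
Qed.

Lemma measurable_tadd d (T : measurableType d) (R : realType) n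
    (f g : T -> Euclid R n) :
  measurable_fun setT f -> measurable_fun setT g ->
  measurable_fun setT (fun x => tadd (f x) (g x)).
Proof.
move=> mf mg; apply/measurable_fun_tnthP => i.
rewrite (_ : _ \o _ = fun x => tnth (f x) i + tnth (g x) i)%R.
  by apply: measurable_funD; exact: measurable_tnth_comp.
by apply/funext => x /=; rewrite tnth_mktuple.
Qed.

Lemma sqnorm_cons (R : realType) n (a : R) (w : Euclid R n) :
  sqnorm [tuple of a :: w] = (a ^+ 2 + sqnorm w)%R.
Proof.
rewrite /sqnorm big_ord_recl/=; congr (_ + _)%R; apply: eq_bigr => i _.
by rewrite tnthS.
Qed.

Lemma sqnorm_tadd_cons (R : realType) n (x : Euclid R n.+1) (a : R) (w : Euclid R n) :
  sqnorm (tadd x [tuple of a :: w]) =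
  ((thead x + a) ^+ 2 + sqnorm (tadd (behead_tuple x) w))%R.
Proof.
rewrite /sqnorm big_ord_recl/= tnth_mktuple; congr (_ + _)%R.
apply: eq_bigr => i _; rewrite !tnth_mktuple tnthS.
by congr ((_ + _) ^+ 2)%R; rewrite [in LHS](tuple_eta x) tnthS.
Qed.

Lemma sqnorm_behead (R : realType) n (x : Euclid R n.+1) :
  sqnorm x = (thead x ^+ 2 + sqnorm (behead_tuple x))%R.
Proof. by rewrite {1}(tuple_eta x) sqnorm_cons. Qed.

(** Built one coordinate at a time, as a product with an independent one-dimensional normal law.
    Only two features of the Gaussian noise are retained: its action on Gaussians, which governs the
    energy, and its second moment, which governs the transport cost. *)
Lemma ex_normal_vector (R : realType) n (t : R) : (0 < t)%R ->
  exists2 p : probability (Euclid R n) R,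
    (forall x v, (0 < v)%R ->
      \int[p]_z (expR (- sqnorm (tadd x z) / (2 * v)))%:E =
      (Num.sqrt (v / (v + t)) ^+ n * expR (- sqnorm x / (2 * (v + t))))%:E) &
    \int[p]_z (sqnorm z)%:E <= (8 * n%:R * t)%:E.
Proof.
move=> t0; elim: n => [|n [p IH1 IH2]].
  exists (\d_([tuple] : Euclid R 0)).
    move=> x v v0; rewrite integral_dirac//.
      by rewrite diracT mul1e expr0 mul1r /sqnorm !big_ord0 oppr0 !mul0r.
    apply/measurable_EFinP; apply: measurableT_comp => //.
    apply: measurable_funM => //; apply: measurableT_comp => //.
    apply: (measurableT_comp (@measurable_sqnorm R 0)).
    by apply: measurable_tadd.
  rewrite integral_dirac//; last first.
    by apply/measurable_EFinP; exact: measurable_sqnorm.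
  by rewrite diracT mul1e /sqnorm big_ord0 mulr0 mul0r.
pose q : probability (measurableTypeR R) R := normal_prob 0 (Num.sqrt t).
pose f (z : measurableTypeR R * Euclid R n) : Euclid R n.+1 := [tuple of z.1 :: z.2].
have mf : measurable_fun setT f by apply: measurable_cons.
have [Q _ QE] := ex_pushforward (q \x p) mf.
have mtadd x : measurable_fun setT (fun z : Euclid R n => sqnorm (tadd x z)).
  by apply: (measurableT_comp (@measurable_sqnorm R n)); apply: measurable_tadd.
exists Q.
  move=> x v v0; rewrite QE; last 2 first.
  - apply/measurable_EFinP; apply: measurableT_comp => //.
    apply: measurable_funM => //; apply: measurableT_comp => //.
    apply: (measurableT_comp (@measurable_sqnorm R n.+1)).
    by apply: measurable_tadd.
  - by move=> y; rewrite lee_fin expR_ge0.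
  rewrite fubini_tonelli1; last 2 first.
  - apply/measurable_EFinP; apply: measurableT_comp => //.
    apply: measurable_funM => //; apply: measurableT_comp => //.
    apply: (measurableT_comp (@measurable_sqnorm R n.+1)).
    by apply: measurable_tadd.
  - by move=> y; rewrite lee_fin expR_ge0.
  rewrite /fubini_F/=.
  transitivity (\int[q]_a ((expR (- (thead x + a) ^+ 2 / (2 * v)))%:E *
      (Num.sqrt (v / (v + t)) ^+ n * expR (- sqnorm (behead_tuple x) / (2 * (v + t))))%:E)).
    apply: eq_integral => a _.
    rewrite -IH1// -ge0_integralZl//; last first.
      apply/measurable_EFinP; apply: measurableT_comp => //.
      by apply: measurable_funM => //; apply: measurableT_comp => //.
    apply: eq_integral => w _; rewrite -EFinM -expRD; congr (expR _)%:E.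
    by rewrite /f sqnorm_tadd_cons/=; ring.
  rewrite ge0_integralZr//; last first.
    apply/measurable_EFinP; apply: measurableT_comp => //.
    apply: measurable_funM => //; apply: measurableT_comp => //.
    by apply: measurable_funX; apply: measurable_funD.
  rewrite integral_normal_prob_gauss// -EFinM sqnorm_behead (exprS _ n).
  by rewrite mulrACA -expRD; congr (_ * expR _)%:E; ring.
rewrite QE; last 2 first.
- by apply/measurable_EFinP; exact: measurable_sqnorm.
- by move=> y; rewrite lee_fin sumr_ge0// => i _; exact: sqr_ge0.
rewrite fubini_tonelli1; last 2 first.
- apply/measurable_EFinP; exact: (measurableT_comp (@measurable_sqnorm R n.+1)).
- by move=> y; rewrite lee_fin sumr_ge0// => i _; exact: sqr_ge0.
rewrite /fubini_F/=.
apply: (@le_trans _ _ (\int[q]_a ((a ^+ 2)%:E + (8 * n%:R * t)%:E))).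
  apply: ge0_le_integral => //.
  - move=> a _; apply: integral_ge0 => w _; rewrite lee_fin.
    by rewrite sumr_ge0// => i _; exact: sqr_ge0.
  - apply: (@measurable_fun_fubini_tonelli_F _ _ _ _ _ p
      (fun z => (sqnorm (f z))%:E)).
      by apply/measurable_EFinP; exact: (measurableT_comp (@measurable_sqnorm R n.+1)).
    by move=> y; rewrite lee_fin sumr_ge0// => i _; exact: sqr_ge0.
  - apply: emeasurable_funD => //.
    by apply/measurable_EFinP; apply: measurable_funX.
  move=> a _; under eq_integral do rewrite /f sqnorm_cons EFinD.
  rewrite ge0_integralD//=; last 3 first.
  - by move=> w _; rewrite lee_fin sqr_ge0.
  - by move=> w _; rewrite lee_fin sumr_ge0// => i _; exact: sqr_ge0.
  - by apply/measurable_EFinP; exact: measurable_sqnorm.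
  rewrite integral_prob_cst; exact: leeD.
rewrite ge0_integralD//=; last 3 first.
- by move=> w _; rewrite lee_fin sqr_ge0.
- by apply/measurable_EFinP; apply: measurable_funX.
- by move=> w _; rewrite lee_fin !mulr_ge0// ltW.
rewrite integral_prob_cst.
rewrite (_ : (8 * n.+1%:R * t)%R = (8 * t + 8 * n%:R * t)%R); last by ring.
by rewrite EFinD; apply: leeD => //; exact: integral_normal_prob_sqr_le.
Qed.

(** * The Coulomb kernel as a superposition of heat kernels *)

Lemma FTC_is_derive (R : realType) (f F : R -> R) (a b : R) : (a <= b)%R ->
  (forall x, (a <= x <= b)%R -> is_derive x 1%R F (f x)) ->
  (forall x, (a <= x <= b)%R -> derivable f x 1%R) ->
  \int[lebesgue_measure]_(x in `[a, b]) (f x)%:E = (F b - F a)%:E.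
Proof.
rewrite le_eqVlt => /predU1P[<- _ _|ab dF df].
  by rewrite set_itv1 integral_set1 subrr.
have cF x : (a <= x <= b)%R -> {for x, continuous F}.
  move=> xab; apply/differentiable_continuous/derivable1_diffP.
  by have [] := dF x xab.
rewrite EFinB; apply: continuous_FTC2 => //.
- by apply: derivable_within_continuous => x; rewrite in_itv/=; exact: df.
- split.
  + move=> x; rewrite in_itv/= => /andP[ax xb].
    by have [] := dF x; rewrite ?ltW.
  + by apply: cvg_at_right_filter; apply: cF; rewrite lexx ltW.
  + by apply: cvg_at_left_filter; apply: cF; rewrite lexx ltW.
- move=> x; rewrite in_itv/= => /andP[ax xb]; rewrite derive1E.
  have : is_derive x 1%R F (f x) by apply: dF; rewrite !ltW.
  by move=> h; rewrite derive_val.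
Qed.

(** Lebesgue measure is [k] times its image under [x |-> k * x + t], since the two agree on
    half-open intervals. It serves both for the parabolic scaling [v = r ^+ 2 * w] and for
    translations in time. *)
Lemma ge0_integral_affine (R : realType) (k t : R) (f : R -> \bar R) : (0 < k)%R ->
  measurable_fun setT f -> (forall x, 0 <= f x) ->
  \int[lebesgue_measure]_x f x =
  k%:E * \int[lebesgue_measure]_x f (k * x + t)%R.
Proof.
move=> k0 mf f0.
pose g (x : measurableTypeR R) : measurableTypeR R := (k * x + t)%R.
have mg : measurable_fun setT g.
  by apply: measurable_funD => //; exact: measurable_funM.
pose m0 : {measure set (measurableTypeR R) -> \bar R} :=
  mscale (NngNum (ltW k0)) (pushforward lebesgue_measure g).
pose m := m0 mg.
have mE A : measurable A -> lebesgue_measure A = m A.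
  apply: lebesgue_measure_unique => _ [[a b]] _ <-.
  rewrite /m /m0/= /mscale/= /pushforward.
  rewrite (_ : _ @^-1` _ = `]((a - t) / k)%R, ((b - t) / k)%R]%classic); last first.
    apply/seteqP; split => x /=; rewrite !in_itv/= /g ltr_pdivrMr// ler_pdivlMr// ltrBlDr lerBrDr (mulrC x).
      by [].
    by [].
  rewrite !lebesgue_measure_itv/= !lte_fin ltr_pM2r ?invr_gt0// ltrD2r.
  case: ifPn => _; last by rewrite mule0.
  by rewrite -!EFinD -EFinM; congr _%:E; field; rewrite gt_eqF.
transitivity (\int[m]_x f x).
  by apply: eq_measure_integral => A mA _; exact: mE.
by rewrite ge0_integral_mscale//= ge0_integral_pushforward.
Qed.

(* The Gaussian density of variance v at distance r, without the factor
   (2 pi)^(-n/2); it is 0 for v <= 0 and n > 0, since then (sqrt v)^-1 = 0. *)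
Definition heat (R : realType) (n : nat) (v r : R) : R :=
  ((Num.sqrt v)^-1 ^+ n * expR (- r ^+ 2 / (2 * v)))%R.

Lemma heat_ge0 (R : realType) n (v r : R) : (0 <= heat n v r)%R.
Proof. by rewrite mulr_ge0 ?expR_ge0// exprn_ge0// invr_ge0 sqrtr_ge0. Qed.

Lemma heat_nincr (R : realType) n (v a b : R) : (0 <= v)%R ->
  (0 <= a <= b)%R -> (heat n v b <= heat n v a)%R.
Proof.
move=> v0 /andP[a0 ab]; rewrite ler_wpM2l ?exprn_ge0 ?invr_ge0 ?sqrtr_ge0//.
rewrite ler_expR !mulNr lerN2 ler_wpM2r ?invr_ge0 ?mulr_ge0//.
by rewrite lerXn2r// nnegrE// (le_trans a0).
Qed.

(** Inversion, extended by 0^-1 = 0, is discontinuous at 0, so measurability is checked on the rays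
    above [x]. The preimage depends on the sign of [x]; the point 0 belongs to it exactly when
    [x < 0]. *)
Lemma measurable_funV d (T : measurableType d) (R : realType) (f : T -> R) :
  measurable_fun setT f -> measurable_fun setT (fun x => (f x)^-1)%R.
Proof.
move=> mf.
have mV : measurable_fun setT (fun x : R => x^-1)%R.
  apply: (measurability _ (RGenOInfty.measurableE R)) => //.
  move=> _ [_ [x ->] <-]; rewrite setTI.
  rewrite (_ : _ @^-1` _ = [set y | (x < y^-1)%R]); last first.
    by apply/seteqP; split=> y/=; rewrite in_itv/= andbT.
  have [x0|x0] := leP 0%R x.
    rewrite (_ : [set y | _] = [set y | (0 < y)%R && (x * y < 1)%R]).
      apply: measurable_set_bool; apply: measurable_and; first exact: measurable_fun_ltr.
      by apply: measurable_fun_ltr => //; exact: measurable_funM.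
    apply/seteqP; split => y /=.
      move=> xy; have y0 : (0 < y)%R by rewrite -invr_gt0 (le_lt_trans x0).
      by rewrite y0/= -ltr_pdivlMr// div1r.
    by move=> /andP[y0]; rewrite -ltr_pdivlMr// div1r.
  rewrite (_ : [set y | _] = [set y | (0 <= y)%R || (x * y > 1)%R]).
    apply: measurable_set_bool; apply: measurable_or; first exact: measurable_fun_ler.
    by apply: measurable_fun_ltr => //; exact: measurable_funM.
  apply/seteqP; split => y /=.
    move=> xy; case: (leP 0%R y) => //= y0.
    by move: xy; rewrite -div1r ltr_ndivlMr.
  move=> /orP[y0|]; first by rewrite (lt_le_trans x0)// invr_ge0.
  case: (leP 0%R y) => y0; first by rewrite (lt_le_trans x0)// invr_ge0.
  by rewrite -div1r ltr_ndivlMr.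
exact: (measurableT_comp mV mf).
Qed.

Lemma measurable_sqrt (R : realType) : measurable_fun setT (@Num.sqrt R).
Proof.
by apply: continuous_measurable_fun; exact: sqrt_continuous.
Qed.

Lemma measurable_heat d (T : measurableType d) (R : realType) n (f g : T -> R) :
  measurable_fun setT f -> measurable_fun setT g ->
  measurable_fun setT (fun x => heat n (f x) (g x)).
Proof.
move=> mf mg; apply: measurable_funM.
  apply: measurable_funX; apply: measurable_funV.
  exact: (measurableT_comp (@measurable_sqrt R)).
apply: measurableT_comp => //; apply: measurable_funM.
  by apply: measurableT_comp => //; apply: measurable_funX.
by apply: measurable_funV; apply: measurable_funM.
Qed.

(** The integrand is minus the radial derivative of [heat n v]. A difference of heat kernels thus
    becomes the integral of a nonnegative function of time and radius, ready for Tonelli. *)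
Lemma integral_heat_radius (R : realType) n (v a b : R) : (0 < v)%R -> (a <= b)%R ->
  \int[lebesgue_measure]_(r in `[a, b]) (r / v * heat n v r)%:E =
  (heat n v a - heat n v b)%:E.
Proof.
move=> v0 ab.
have de (r : R) : is_derive r 1%R (fun r : R => expR (- r ^+ 2 / (2 * v)))%R
    (- (r / v) * expR (- r ^+ 2 / (2 * v)))%R.
  rewrite (_ : (fun r => _) = expR \o (fun r : R => (- (2 * v)^-1) * r ^+ 2))%R; last first.
    by apply/funext => x /=; congr expR; rewrite mulNr mulNr mulrC.
  apply: is_derive_eq.
  rewrite /GRing.scale/= mulr1 mulrC; congr (_ * expR _)%R; last by rewrite mulNr mulNr mulrC.
  by field; rewrite gt_eqF//.
have dh (r : R) : is_derive r 1%R (fun r => - heat n v r)%R (r / v * heat n v r)%R.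
  apply: is_derive_eq; rewrite /GRing.scale/= /heat.
  by ring.
rewrite (@FTC_is_derive _ _ (fun r => - heat n v r)%R) => //.
by rewrite opprK addrC.
Qed.

Definition coul (R : realType) (n : nat) (r : R) : \bar R :=
  match n with
  | 1%N => (- r)%:E
  | 2%N => - lne r%:E
  | _ => ((n - 2)%N%:R * r ^+ (n - 2))%R%:E^-1
  end.

Lemma coulombE (R : realType) n (z : Euclid R n * Euclid R n) :
  coulomb z = coul n (eucl_dist z.1 z.2).
Proof. by case: n z => [|[|[|n]]]. Qed.

Lemma coul_fin_num (R : realType) n (r : R) : (0 < n)%N -> (0 < r)%R ->
  coul n r \is a fin_num.
Proof.
move=> + r0; case: n => [|[|[|n]]]// _; rewrite /coul; first by rewrite lne_EFin.
by rewrite inver gt_eqF// mulr_gt0// exprn_gt0.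
Qed.

(** The normalizations of the kernel are such that, in every dimension, minus its radial derivative
    is r^(1 - n), without a constant. *)
Lemma integral_coul_pos (R : realType) n (a b : R) : (0 < n)%N ->
  (0 < a)%R -> (a <= b)%R ->
  \int[lebesgue_measure]_(r in `[a, b]) (r / r ^+ n)%:E = coul n a - coul n b.
Proof.
move=> + a0 ab; have b0 := lt_le_trans a0 ab; case: n => [|[|[|n]]]// _; rewrite /coul.
- have dF x : (a <= x <= b)%R -> is_derive x 1%R (@id R) (x / x ^+ 1)%R.
    move=> /andP[ax _]; apply: is_derive_eq.
    by rewrite expr1 divff// gt_eqF// (lt_le_trans a0).
  rewrite (FTC_is_derive ab dF); first by rewrite -EFinD opprK addrC.
  move=> x /andP[ax _]; apply: derivableM => //; apply: derivableV => //.
  by rewrite expr1 gt_eqF// (lt_le_trans a0).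
- have dF x : (a <= x <= b)%R -> is_derive x 1%R (@ln R) (x / x ^+ 2)%R.
    move=> /andP[ax _]; have x0 := lt_le_trans a0 ax.
    rewrite (_ : (x / x ^+ 2 = x^-1)%R); first exact: is_derive1_ln.
    by rewrite expr2 invfM mulrA divff ?mul1r// gt_eqF.
  rewrite !lne_EFin// (FTC_is_derive ab dF).
    by rewrite -EFinN -EFinD opprK addrC.
  move=> x /andP[ax _]; apply: derivableM => //; apply: derivableV => //.
  by rewrite sqrf_eq0 gt_eqF// (lt_le_trans a0).
- have E r : (0 < r)%R -> ((n.+3 - 2)%N%:R * r ^+ (n.+3 - 2))%R%:E^-1 =
      (n.+1%:R^-1 * (r ^+ n.+1)^-1)%:E :> \bar R.
    move=> r0; rewrite (_ : (n.+3 - 2)%N = n.+1)//.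
    by rewrite inver gt_eqF ?mulr_gt0 ?exprn_gt0// invfM.
  have dF x : (a <= x <= b)%R -> is_derive x 1%R
      (fun r : R => - (n.+1%:R^-1 * (r ^+ n.+1)^-1))%R (x / x ^+ n.+3)%R.
    move=> /andP[ax _]; have x0 := lt_le_trans a0 ax.
    have d1 : is_derive x 1%R (fun r : R => (r ^+ n.+1)^-1)%R
        (- (x ^+ n.+1) ^- 2 *: ((n.+1%:R * x ^+ n) *: (1%R : R)))%R.
      have x1 : (x ^+ n.+1 != 0)%R by rewrite expf_neq0// gt_eqF.
      have dX : is_derive x 1%R (fun r : R => r ^+ n.+1)%R
          ((n.+1%:R * x ^+ n) *: (1%R : R))%R.
        rewrite (_ : (fun r : R => _) = (id ^+ n.+1)%R); first exact: is_deriveX.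
        by apply/funext => r; rewrite exprfctE.
      exact: (@is_deriveV _ (fun r : R => r ^+ n.+1)%R).

    apply: is_derive_eq; rewrite /GRing.scale/= mulr1 !exprS.
    by field; rewrite ?(gt_eqF x0) ?expf_neq0 ?(gt_eqF x0)//= pnatr_eq0.
  rewrite !E// (FTC_is_derive ab dF).
    by rewrite -EFinD opprK addrC.
  move=> x /andP[ax _]; apply: derivableM => //; apply: derivableV => //; last exact: exprn_derivable.
  by rewrite expf_neq0// gt_eqF// (lt_le_trans a0).
Qed.

Lemma measurable_coul_density (R : realType) n :
  measurable_fun setT (fun r : R => r / r ^+ n)%R.
Proof. by apply: measurable_funM => //; exact: measurable_funV. Qed.

Lemma integral_coul (R : realType) n (a b : R) : (0 < n)%N ->
  (0 <= a)%R -> (a <= b)%R -> (0 < b)%R ->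
  \int[lebesgue_measure]_(r in `[a, b]) (r / r ^+ n)%:E = coul n a - coul n b.
Proof.
move=> n0; rewrite le_eqVlt => /predU1P[<- _ b0|]; last first.
  by move=> a0 ab _; exact: integral_coul_pos.
case: n n0 => [|[|n]]// _.
  rewrite -(@integral_itv_obnd_cbnd R 0%R); last first.
    apply/measurable_EFinP; apply: measurable_funTS.
    exact: (@measurable_coul_density R 1).
  transitivity (\int[lebesgue_measure]_(r in `]0%R, b]) (cst 1 r : \bar R)).
    apply: eq_integral => r; rewrite inE/= in_itv/= => /andP[r0 _].
    by rewrite expr1 divff// gt_eqF.
  rewrite integral_cst//= mul1e lebesgue_measure_itv/= lte_fin b0 /coul.
  by rewrite -!EFinD opprK oppr0 addr0 add0r.
have cb : coul n.+2 b \is a fin_num by apply: coul_fin_num.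
have -> : coul n.+2 (0%R : R) = +oo.
  case: n {cb} => [|n]; rewrite /coul; first by rewrite /lne lexx.
  by rewrite (_ : (n.+3 - 2)%N = n.+1)// expr0n/= mulr0 inver eqxx.
rewrite addye ?fin_numN//; last first.
  by move: cb; rewrite fin_numE => /andP[_]; apply: contra => /eqP/eqe_oppLRP ->.
apply/eqyP => M M0.
(* Divergence at 0 is reduced to that of 1/r: [c <= 1] ensures r^(n+2) <= r^2 on the interval, and
   [e] is chosen so that the integral of 1/r over [[e, c]] equals [M]. *)
pose c := Num.min b 1%R; have c0 : (0 < c)%R by rewrite lt_min b0 ltr01.
pose e := expR (ln c - M)%R.
have a0 : (0 < e)%R by exact: expR_gt0.
have ac : (e <= c)%R by rewrite -[leRHS]lnK ?posrE// ler_expR gerBl ltW.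
apply: (@le_trans _ _ (\int[lebesgue_measure]_(r in `[e, c]) (r / r ^+ 2)%:E)).
  rewrite integral_coul_pos// /coul !lne_EFin// expRK -EFinN -EFinD lee_fin.
  by lra.
have md k (D : set R) : measurable_fun D (fun r : R => (r / r ^+ k)%:E).
  by apply/measurable_EFinP/measurable_funTS; exact: measurable_coul_density.
apply: (@le_trans _ _ (\int[lebesgue_measure]_(r in `[e, c]) (r / r ^+ n.+2)%:E)).
  apply: ge0_le_integral => //.
  - move=> r /=; rewrite in_itv/= => /andP[ar _].
    by rewrite lee_fin divr_ge0// ?exprn_ge0// (le_trans (ltW a0)).
  - exact: md.
  - exact: md.
  - move=> r /=; rewrite in_itv/= => /andP[ar rc]; have r0 := lt_le_trans a0 ar.
    rewrite lee_fin ler_wpM2l ?(ltW r0)// lef_pV2 ?posrE ?exprn_gt0//.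
    by rewrite ler_wiXn2l// ?(ltW r0)// (le_trans rc)// ge_min lexx orbT.
apply: ge0_subset_integral => //; first exact: md.
- move=> r /=; rewrite in_itv/= => /andP[r0 _].
  by rewrite lee_fin divr_ge0// exprn_ge0.
- move=> r /=; rewrite !in_itv/= => /andP[ar rc].
  rewrite (le_trans (ltW a0))//= (le_trans rc)// ge_min lexx//.
Qed.

Lemma heat_le0 (R : realType) n (v r : R) : (0 < n)%N -> (v <= 0)%R -> heat n v r = 0%R.
Proof.
by move=> n0 v0; rewrite /heat ler0_sqrtr// invr0 expr0n gtn_eqF// mul0r.
Qed.

(** Write exp(a/v) as the (k+1)-st power of exp(a/((k+1)v)) and bound the latter below by its
    argument. *)
Lemma expR_Ndiv_le (R : realType) (a v : R) k : (0 < a)%R -> (0 < v)%R ->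
  (expR (- (a / v)) <= (k.+1%:R * v / a) ^+ k.+1)%R.
Proof.
move=> a0 v0; have k0 : (0 < k.+1%:R :> R)%R by rewrite ltr0n.
rewrite -[leRHS]invrK -exprVn invf_div expRN lef_pV2 ?posrE ?expR_gt0 ?exprn_gt0 ?divr_gt0 ?mulr_gt0//.
rewrite (_ : (a / v = k.+1%:R * (a / (k.+1%:R * v)))%R); last first.
  move: (k.+1%:R : R) k0 => K k0.
  by field; rewrite (gt_eqF v0) (gt_eqF k0).
rewrite expRM_natl lerXn2r ?nnegrE ?expR_ge0// ?divr_ge0 ?mulr_ge0 ?(ltW a0) ?(ltW v0)//.
by rewrite (le_trans _ (expR_ge1Dx _))// lerDr.
Qed.

(** The exponential supplies n+1 powers of v; n of them absorb the factor v^(-n/2) since v <= 1. The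
    remaining one keeps [v^-1 * heat n v 1] bounded near 0. *)
Lemma heat_small_time (R : realType) n (v r : R) : (0 < v <= 1)%R -> (0 < r)%R ->
  (heat n v r <= v * (2 * n.+1%:R / r ^+ 2) ^+ n.+1)%R.
Proof.
move=> /andP[v0 v1] r0; rewrite /heat.
have s0 : (0 < Num.sqrt v)%R by rewrite sqrtr_gt0.
have r20 : (0 < r ^+ 2 / 2)%R by rewrite divr_gt0// exprn_gt0.
apply: (@le_trans _ _ ((Num.sqrt v)^-1 ^+ n * (n.+1%:R * v / (r ^+ 2 / 2)) ^+ n.+1)%R).
  rewrite ler_wpM2l ?exprn_ge0 ?invr_ge0 ?sqrtr_ge0//.
  rewrite (_ : (- r ^+ 2 / (2 * v) = - ((r ^+ 2 / 2) / v))%R); last first.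
    by field; rewrite gt_eqF.
  exact: expR_Ndiv_le.
rewrite (_ : (n.+1%:R * v / (r ^+ 2 / 2) = v * (2 * n.+1%:R / r ^+ 2))%R); last first.
  by field; rewrite gt_eqF.
rewrite exprMn mulrA ler_wpM2r//.
  by rewrite exprn_ge0 ?divr_ge0 ?mulr_ge0 ?exprn_ge0 ?(ltW r0)//.
rewrite exprS mulrCA -exprMn ler_piMr ?(ltW v0)//.
rewrite -{2}[v]sqr_sqrtr ?(ltW v0)// expr2 mulrA mulVf ?mul1r ?gt_eqF//.
by rewrite exprn_ile1 ?sqrtr_ge0// -sqrtr1 ler_sqrt.
Qed.

Lemma measurable_heat_radius (R : realType) n :
  measurable_fun setT (fun z : R * R => z.2 / z.1 * heat n z.1 z.2)%R.
Proof.
apply: measurable_funM.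
  by apply: measurable_funM => //; exact: measurable_funV.
exact: measurable_heat.
Qed.

(* The scaling identity
     int_0^oo (heat n v a - heat n v b) dv = heat_const * (coul n a - coul n b)
   holds in every dimension, also when each half of the left-hand side diverges. *)
Definition heat_const (R : realType) n : \bar R :=
  \int[lebesgue_measure]_v (v^-1 * heat n v 1)%:E.

Lemma measurable_heat_const (R : realType) n (D : set R) :
  measurable_fun D (fun v : R => (v^-1 * heat n v 1)%:E).
Proof.
apply/measurable_EFinP; apply: measurable_funTS; apply: measurable_funM.
  exact: measurable_funV.
exact: measurable_heat.
Qed.

Lemma heat_const_ge0 (R : realType) n (v : R) : (0 < n)%N -> (0 <= v^-1 * heat n v 1)%R.
Proof.
move=> n0; have [v0|v0] := leP v 0%R; first by rewrite heat_le0// mulr0.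
by rewrite mulr_ge0 ?heat_ge0// invr_ge0 ltW.
Qed.

Lemma heat_const_gt0 (R : realType) n : (0 < n)%N -> (0 < heat_const R n).
Proof.
move=> n0.
pose q : R := (2^-1 * (2^-1 ^+ n * expR (- (1 / 2))))%R.
have q0 : (0 < q)%R by rewrite !mulr_gt0 ?exprn_gt0 ?invr_gt0 ?expR_gt0.
apply: (@lt_le_trans _ _ (\int[lebesgue_measure]_(v in `[1%R, 2%R]) q%:E)).
  rewrite integral_cst//= lebesgue_measure_itv/= lte_fin.
  by rewrite (ltr_nat R 1 2) -EFinD -EFinM lte_fin mulr_gt0//; lra.
apply: (@le_trans _ _ (\int[lebesgue_measure]_(v in `[1%R, 2%R]) (v^-1 * heat n v 1)%:E)).
  apply: ge0_le_integral => //.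
  - by move=> v _; rewrite lee_fin ltW.
  - exact: measurable_heat_const.
  - move=> v; rewrite /= in_itv/= => /andP[v1 v2]; have v0 := lt_le_trans ltr01 v1.
    have h1 : (2^-1 <= v^-1)%R by rewrite lef_pV2 ?posrE.
    have h2 : (2^-1 ^+ n <= (Num.sqrt v)^-1 ^+ n)%R.
      rewrite lerXn2r ?nnegrE ?invr_ge0 ?sqrtr_ge0// lef_pV2 ?posrE ?sqrtr_gt0//.
      rewrite -[leRHS]ger0_norm// -sqrtr_sqr ler_sqrt ?sqr_ge0// (le_trans v2)//.
      by rewrite expr2; lra.
    have h3 : (expR (- (1 / 2)) <= expR (- 1 ^+ 2 / (2 * v)))%R.
      rewrite ler_expR expr1n mulNr lerN2 ler_pM2l// lef_pV2 ?posrE ?mulr_gt0//.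
      by rewrite ler_peMr.
    have h4 : (0 <= 2^-1 ^+ n :> R)%R by rewrite exprn_ge0.
    by rewrite lee_fin /heat /q !ler_pM// ?mulr_ge0 ?expR_ge0.
apply: ge0_subset_integral => //; first exact: measurable_heat_const.
by move=> v _; rewrite lee_fin heat_const_ge0.
Qed.

(** Below time 1 the integrand is bounded by [heat_small_time]; above it, it is at most v^(-3/2),
    with primitive -2 v^(-1/2). The factor v^-1 is what gives convergence at infinity also for n =
    1, 2, where [heat n v 1] itself is not integrable. *)
Lemma heat_const_lty (R : realType) n : (0 < n)%N -> (heat_const R n < +oo).
Proof.
move=> n0; rewrite /heat_const.
pose K : R := ((2 * n.+1%:R) ^+ n.+1)%R.
have K0 : (0 <= K)%R by rewrite exprn_ge0 ?mulr_ge0.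
pose g (v : R) : R := (K * \1_`[0%R, 1%R] v + (v^-1 * (Num.sqrt v)^-1) * \1_`[1%R, +oo[ v)%R.
have mV : measurable_fun setT (fun v : R => v^-1 * (Num.sqrt v)^-1)%R.
  apply: measurable_funM; first exact: measurable_funV.
  by apply: measurable_funV; exact: measurable_sqrt.
have V0 (v : R) : (1 <= v)%R -> (0 <= v^-1 * (Num.sqrt v)^-1)%R.
  by move=> v1; rewrite mulr_ge0 ?invr_ge0 ?sqrtr_ge0// (le_trans _ v1).
have g20 (v : R) : (0 <= (v^-1 * (Num.sqrt v)^-1) * \1_`[1%R, +oo[ v)%R.
  by rewrite indicE mem_setE/= in_itv/= andbT; case: (leP 1%R v) => v1; rewrite ?mulr0 ?mulr1 ?V0.
apply: (@le_lt_trans _ _ (\int[lebesgue_measure]_v (g v)%:E)).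
  apply: ge0_le_integral => //.
  - by move=> v _; rewrite lee_fin heat_const_ge0.
  - exact: measurable_heat_const.
  - apply/measurable_EFinP; apply: measurable_funD; apply: measurable_funM => //.
  - move=> v _; rewrite lee_fin /g.
    have [v0|v0] := leP v 0%R.
      by rewrite heat_le0// mulr0 addr_ge0// mulr_ge0.
    have [v1|v1] := leP v 1%R.
      apply: (@le_trans _ _ K).
        rewrite ler_pdivrMl//; apply: (le_trans (@heat_small_time R n v 1%R _ _)) => //.
          by rewrite v0.
        by rewrite expr1n divr1.
      by rewrite indicE mem_setE/= in_itv/= (ltW v0) v1/= mulr1 lerDl.
    rewrite !indicE !mem_setE/= !in_itv/= (ltW v0)/= (leNgt v 1%R) v1/= (ltW v1)/= mulr0 add0r mulr1.
    rewrite ler_pM2l ?invr_gt0// /heat.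
    have s1 : (1 <= Num.sqrt v)%R by rewrite -sqrtr1 ler_sqrt// ltW.
    have s0 : (0 < Num.sqrt v)%R by rewrite (lt_le_trans _ s1).
    have e1 : (expR (- 1 ^+ 2 / (2 * v)) <= 1)%R.
      by rewrite -[leRHS]expR0 ler_expR expr1n mulN1r oppr_le0 invr_ge0 mulr_ge0 ?ltW.
    rewrite -[leRHS]mulr1 ler_pM// ?exprn_ge0 ?invr_ge0 ?expR_ge0 ?sqrtr_ge0//.
    rewrite -[leRHS]expr1 ler_wiXn2l// ?invr_ge0 ?sqrtr_ge0//.
    by rewrite invf_le1.
rewrite /g; under eq_integral do rewrite EFinD.
rewrite ge0_integralD//=; last 4 first.
- by move=> v _; rewrite lee_fin mulr_ge0.
- by apply/measurable_EFinP; apply: measurable_funM.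
- by move=> v _; rewrite lee_fin.
- by apply/measurable_EFinP; apply: measurable_funM.
apply: lte_add_pinfty.
  under eq_integral do rewrite EFinM.
  rewrite ge0_integralZl//; last by apply/measurable_EFinP; apply: measurable_indic.
  rewrite integral_indic// setIT/= lebesgue_measure_itv/= lte_fin ltr01.
  by rewrite -EFinD -EFinM ltry.
rewrite (_ : (fun v => _) = (fun v => (v^-1 * (Num.sqrt v)^-1)%:E) \_ `[1%R, +oo[); last first.
  apply/funext => v; rewrite patchE indicE.
  by case: ifPn => _; rewrite ?mulr1 ?mulr0.
rewrite -integral_mkcond.
have dF (v : R) : (0 < v)%R -> is_derive v 1%R
    (fun v => - 2 * (Num.sqrt v)^-1)%R (v^-1 * (Num.sqrt v)^-1)%R.
  move=> v0; have s0 : (0 < Num.sqrt v)%R by rewrite sqrtr_gt0.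
  have d1 : is_derive v 1%R (fun v : R => (Num.sqrt v)^-1)%R
      (- (Num.sqrt v) ^- 2 *: (2 * Num.sqrt v)^-1)%R.
    have sn0 : Num.sqrt v != 0%R by rewrite gt_eqF.
    have dS := is_derive1_sqrt v0; exact: (@is_deriveV _ (@Num.sqrt R)).
  apply: is_derive_eq; rewrite /GRing.scale/= sqr_sqrtr ?ltW//.
  by field; rewrite !gt_eqF.
have cV (v : R) : (0 < v)%R -> {for v, continuous (fun v : R => v^-1 * (Num.sqrt v)^-1)%R}.
  move=> v0; apply: cvgM; apply: cvgV; rewrite ?gt_eqF ?sqrtr_gt0//.
  exact: sqrt_continuous.
rewrite (@ge0_continuous_FTC2y _ _ (fun v => - 2 * (Num.sqrt v)^-1)%R _ 0%R) ?ltry//.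
- apply/continuous_within_itvcyP; split.
    by move=> v; rewrite in_itv/= andbT => v1; apply: cV; rewrite (lt_trans _ v1).
  by apply: cvg_at_right_filter; exact: cV.
- rewrite -[X in _ --> X](mulr0 (-2)%R); apply: cvgMr.
  apply/cvgrPdist_lt => e e0; near=> v; rewrite sub0r normrN ger0_norm ?invr_ge0 ?sqrtr_ge0//.
  have v0 : (0 < v)%R by near: v; apply: nbhs_pinfty_gt; exact: num_real.
  rewrite invf_plt ?posrE ?sqrtr_gt0// -[ltLHS]ger0_norm ?invr_ge0 ?ltW//.
  rewrite -sqrtr_sqr ltr_sqrt//; near: v; apply: nbhs_pinfty_gt; exact: num_real.
- by move=> v v1; have [] := dF v (lt_trans ltr01 v1).
- have cF : {for 1%R, continuous (fun v : R => - 2 * (Num.sqrt v)^-1)%R}.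
    apply/differentiable_continuous/derivable1_diffP.
    by have [] := dF 1%R ltr01.
  by apply: cvg_at_right_filter; exact: cF.
- move=> v; rewrite in_itv/= andbT => v1; rewrite derive1E.
  by have h := dF v (lt_trans ltr01 v1); rewrite derive_val.
Unshelve. all: by end_near. Qed.

(** Parabolic scaling: with v = r^2 w, [heat n v r] becomes r^(-n) times [heat n w 1]. *)
Lemma integral_heat_time (R : realType) n (r : R) : (0 < n)%N -> (0 < r)%R ->
  \int[lebesgue_measure]_v (r / v * heat n v r)%:E = (r / r ^+ n)%:E * heat_const R n.
Proof.
move=> n0 r0.
have p0 (v : R) : (0 <= r / v * heat n v r)%R.
  have [v0|v0] := leP v 0%R; first by rewrite heat_le0// mulr0.
  by rewrite mulr_ge0 ?heat_ge0// divr_ge0 ?ltW.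
rewrite (@ge0_integral_affine _ (r ^+ 2)%R 0%R); last 3 first.
- by rewrite exprn_gt0.
- apply/measurable_EFinP; apply: measurable_funM; last exact: measurable_heat.
  by apply: measurable_funM => //; exact: measurable_funV.
- by move=> v; rewrite lee_fin.
have mA : measurable_fun setT
    (fun v => (r / (r ^+ 2 * v + 0) * heat n (r ^+ 2 * v + 0) r)%:E).
  apply/measurable_EFinP; apply: measurable_funM.
    apply: measurable_funM => //; apply: measurable_funV.
    by apply: measurable_funD => //; exact: measurable_funM.
  apply: measurable_heat => //.
  by apply: measurable_funD => //; exact: measurable_funM.
have mB := @measurable_heat_const R n setT.
rewrite /heat_const -[LHS]ge0_integralZl; [|by []|exact: mA| |]; last 2 first.
- by move=> v _; rewrite lee_fin.
- by rewrite lee_fin exprn_ge0// ltW.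
rewrite -[RHS]ge0_integralZl; [|by []|exact: mB| |]; last 2 first.
- by move=> v _; rewrite lee_fin heat_const_ge0.
- by rewrite lee_fin divr_ge0 ?exprn_ge0// ltW.
apply: eq_integral => v _; rewrite addr0 -!EFinM; congr _%:E.
have [v0|v0] := leP v 0%R.
  by rewrite !heat_le0// ?mulr0// mulr_ge0_le0// exprn_ge0// ltW.
have s0 : (0 < Num.sqrt v)%R by rewrite sqrtr_gt0.
rewrite /heat sqrtrM ?exprn_ge0 ?(ltW r0)// sqrtr_sqr ger0_norm ?(ltW r0)//.
rewrite (invfM r (Num.sqrt v)) exprMn.
rewrite (_ : (- r ^+ 2 / (2 * (r ^+ 2 * v)) = - 1 ^+ 2 / (2 * v))%R); last first.
  by field; rewrite !gt_eqF.
set X := ((Num.sqrt v)^-1 ^+ n)%R; set E := expR _; rewrite exprVn.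
have rn0 : (r ^+ n != 0)%R by rewrite expf_neq0// gt_eqF.
by field; rewrite rn0 !gt_eqF.
Qed.

(** The difference is written as an integral over radii between [a] and [b]; Tonelli then allows the
    integral in time to be done first, and it yields the radial derivative of the Coulomb kernel.
    For [a = 0] and n >= 2 both sides are [+oo]. *)
Lemma integral_heat_sub (R : realType) n (a b : R) : (0 < n)%N ->
  (0 <= a)%R -> (a <= b)%R -> (0 < b)%R ->
  \int[lebesgue_measure]_v (heat n v a - heat n v b)%:E =
  heat_const R n * (coul n a - coul n b).
Proof.
move=> n0 a0 ab b0.
pose h (z : R * R) : \bar R := (z.2 / z.1 * heat n z.1 z.2 * \1_`[a, b] z.2)%:E.
have mh : measurable_fun setT h.
  apply/measurable_EFinP; apply: measurable_funM; first exact: measurable_heat_radius.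
  by apply: measurableT_comp => //; exact: measurable_snd.
have h0 z : 0 <= h z.
  rewrite lee_fin indicE mem_setE/= in_itv/=; case: andP => [[az _]|_]; last by rewrite mulr0.
  rewrite mulr1; have [v0|v0] := leP z.1 0%R; first by rewrite heat_le0// mulr0.
  by rewrite mulr_ge0 ?heat_ge0// divr_ge0 ?(ltW v0)// (le_trans a0).
transitivity (\int[lebesgue_measure]_v \int[lebesgue_measure]_r h (v, r)).
  apply: eq_integral => v _.
  have [v0|v0] := leP v 0%R.
    rewrite !heat_le0// subr0; apply/esym/integral0_eq => r _.
    by rewrite /h/= heat_le0// mulr0 mul0r.
  rewrite -integral_heat_radius// integral_mkcond; apply: eq_integral => r _.
  by rewrite patchE /h/= indicE; case: ifPn => _; rewrite ?mulr1 ?mulr0.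
rewrite (@fubini_tonelli _ _ _ _ R lebesgue_measure lebesgue_measure)//.
rewrite -integral_coul// muleC -ge0_integralZr//; last 3 first.
- by apply/measurable_EFinP/measurable_funTS; exact: measurable_coul_density.
- move=> r; rewrite /= in_itv/= => /andP[ar _].
  by rewrite lee_fin divr_ge0 ?exprn_ge0// (le_trans a0).
- by rewrite ltW// heat_const_gt0.
rewrite [RHS]integral_mkcond.
(* The scaling identity holds for positive radii only, so the null set r = 0 is removed from both
   sides. *)
rewrite -(@integral_setD1 R _ 0%R setT)//; last 2 first.
- by apply: measurableD.
- apply: measurable_funTS.
  by apply: (@measurable_fun_fubini_tonelli_G _ _ _ _ _ lebesgue_measure h).
rewrite -[RHS](@integral_setD1 R _ 0%R setT)//; last 2 first.
- by apply: measurableD.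
- apply: measurable_funTS; apply/(measurable_restrictT _ _).1 => //.
  apply: emeasurable_funM => //.
  by apply/measurable_EFinP/measurable_funTS; exact: measurable_coul_density.
apply: eq_integral => r; rewrite inE/= => -[_ /eqP r0].
rewrite patchE mem_setE/=; case: ifPn => rab; last first.
  by apply: integral0_eq => v _; rewrite /h/= indicE mem_setE/= (negbTE rab) mulr0.
have rp : (0 < r)%R.
  by rewrite lt_neqAle eq_sym r0/= (le_trans a0)//; move: rab; rewrite in_itv/= => /andP[].
rewrite -integral_heat_time//; apply: eq_integral => v _.
by rewrite /h/= indicE mem_setE/= rab mulr1.
Qed.

(** * The Euclidean norm *)

Definition enorm (R : realType) n (x : Euclid R n) : R := Num.sqrt (sqnorm x).

Definition tsub (R : realType) n (x y : Euclid R n) : Euclid R n :=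
  [tuple (tnth x i - tnth y i)%R | i < n].

Lemma sqnorm_ge0 (R : realType) n (x : Euclid R n) : (0 <= sqnorm x)%R.
Proof. by rewrite sumr_ge0// => i _; exact: sqr_ge0. Qed.

Lemma enorm_ge0 (R : realType) n (x : Euclid R n) : (0 <= enorm x)%R.
Proof. exact: sqrtr_ge0. Qed.

Lemma sqr_enorm (R : realType) n (x : Euclid R n) : (enorm x ^+ 2 = sqnorm x)%R.
Proof. by rewrite sqr_sqrtr// sqnorm_ge0. Qed.

Lemma eucl_distE (R : realType) n (x y : Euclid R n) :
  eucl_dist x y = enorm (tsub x y).
Proof.
by rewrite /eucl_dist /enorm /sqnorm; congr Num.sqrt; apply: eq_bigr => i _;
  rewrite tnth_mktuple.
Qed.

Lemma tsub_tadd (R : realType) n (x y z : Euclid R n) :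
  tsub (tadd x z) y = tadd (tsub x y) z.
Proof. by apply: eq_from_tnth => i; rewrite !tnth_mktuple addrAC. Qed.

Lemma cauchy_schwarz_tuple (R : realType) n (x z : Euclid R n) :
  (\sum_(i < n) tnth x i * tnth z i <= enorm x * enorm z)%R.
Proof.
have H (u : Euclid R n) : enorm u = 0%R -> forall i, tnth u i = 0%R.
  move=> /eqP; rewrite sqrtr_eq0 => u0 i.
  have /eqP : sqnorm u = 0%R by apply/eqP; rewrite eq_le u0 sqnorm_ge0.
  rewrite psumr_eq0; last by move=> j _; exact: sqr_ge0.
  by move=> /allP/(_ i); rewrite mem_index_enum => /(_ isT)/=; rewrite sqrf_eq0 => /eqP.
have [x0|x0] := eqVneq (enorm x) 0%R.
  by rewrite x0 mul0r big1// => i _; rewrite (H _ x0) mul0r.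
have [z0|z0] := eqVneq (enorm z) 0%R.
  by rewrite z0 mulr0 big1// => i _; rewrite (H _ z0) mulr0.
set X := enorm x in x0 *; set Z := enorm z in z0 *.
have X0 : (0 < X)%R by rewrite lt_neqAle eq_sym x0 enorm_ge0.
have Z0 : (0 < Z)%R by rewrite lt_neqAle eq_sym z0 enorm_ge0.
have : (0 <= \sum_(i < n) (tnth x i * Z - tnth z i * X) ^+ 2)%R.
  by rewrite sumr_ge0// => i _; exact: sqr_ge0.
have -> : (\sum_(i < n) (tnth x i * Z - tnth z i * X) ^+ 2 =
    2 * (X * Z) * (X * Z - \sum_(i < n) tnth x i * tnth z i))%R.
  rewrite (eq_bigr (fun i => tnth x i ^+ 2 * Z ^+ 2 + tnth z i ^+ 2 * X ^+ 2 -
    2 * (X * Z) * (tnth x i * tnth z i)))%R; last by move=> i _; ring.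
  rewrite sumrB big_split/= -!mulr_suml -mulr_sumr -/(sqnorm x) -/(sqnorm z).
  by rewrite -!sqr_enorm -/X -/Z; ring.
by rewrite pmulr_rge0 ?mulr_gt0// subr_ge0.
Qed.

Lemma enorm_triangle (R : realType) n (x z : Euclid R n) :
  (enorm (tadd x z) <= enorm x + enorm z)%R.
Proof.
have xz0 : (0 <= enorm x + enorm z)%R by rewrite addr_ge0 ?enorm_ge0.
rewrite -[leRHS]ger0_norm// -sqrtr_sqr ler_sqrt ?sqr_ge0//.
have -> : sqnorm (tadd x z) =
    (sqnorm x + sqnorm z + 2 * \sum_(i < n) tnth x i * tnth z i)%R.
  rewrite /sqnorm mulr_sumr -!big_split/=; apply: eq_bigr => i _.
  by rewrite tnth_mktuple; ring.
rewrite -!sqr_enorm; have := cauchy_schwarz_tuple x z.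
by move: (enorm x) (enorm z) => X Z h; rewrite sqrrD; lra.
Qed.

Lemma measurable_enorm d (T : measurableType d) (R : realType) n (f : T -> Euclid R n) :
  measurable_fun setT f -> measurable_fun setT (fun x => enorm (f x)).
Proof.
move=> mf; apply: (measurableT_comp (@measurable_sqrt R)).
exact: (measurableT_comp (@measurable_sqnorm R n)).
Qed.

Lemma measurable_tsub d (T : measurableType d) (R : realType) n
    (f g : T -> Euclid R n) :
  measurable_fun setT f -> measurable_fun setT g ->
  measurable_fun setT (fun x => tsub (f x) (g x)).
Proof.
move=> mf mg; apply/measurable_fun_tnthP => i.
rewrite (_ : _ \o _ = fun x => tnth (f x) i - tnth (g x) i)%R.
  by apply: measurable_funB; exact: measurable_tnth_comp.
by apply/funext => x /=; rewrite tnth_mktuple.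
Qed.

(** * Splitting the Coulomb kernel at distance 1 *)

Lemma heat_constE (R : realType) n : (0 < n)%N ->
  exists2 k : R, (0 < k)%R & heat_const R n = k%:E.
Proof.
move=> n0; have := heat_const_gt0 R n0; have := heat_const_lty R n0.
by case: (heat_const R n) => // k _ k0; exists k.
Qed.

Section coul_decomposition.
Context (R : realType) (n : nat).
Hypothesis n0 : (0 < n)%N.

(* Splitting at r = 1 makes both parts of coul r - coul 1 = coul_near r - coul_far r
   nonnegative, so that Tonelli's theorem applies to each of them. *)
Definition coul_near (r : R) : \bar R := coul n (Num.min r 1%R) - coul n 1%R.
Definition coul_far (r : R) : R := fine (coul n 1%R - coul n (Num.max r 1%R)).

Let c1 : coul n (1%R : R) \is a fin_num.
Proof. exact: coul_fin_num. Qed.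

Let max0 (r : R) : (0 < Num.max r 1)%R.
Proof. by rewrite lt_max ltr01 orbT. Qed.

Lemma coul_farE (r : R) : (coul_far r)%:E = coul n 1%R - coul n (Num.max r 1%R).
Proof. by rewrite fineK// fin_numB c1 coul_fin_num. Qed.

Lemma coul_nincr (a b : R) : (0 <= a)%R -> (a <= b)%R -> (0 < b)%R ->
  coul n b <= coul n a.
Proof.
move=> a0 ab b0; rewrite -sube_ge0; last by rewrite (coul_fin_num n0 b0) ?orbT.
rewrite -integral_coul//; apply: integral_ge0 => r /=; rewrite in_itv/= => /andP[ar _].
by rewrite lee_fin divr_ge0 ?exprn_ge0// (le_trans a0).
Qed.

Lemma coul_near_ge0 (r : R) : (0 <= r)%R -> 0 <= coul_near r.
Proof.
move=> r0; rewrite sube_ge0 ?c1 ?orbT//; apply: coul_nincr => //.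
  by rewrite le_min r0/=.
by rewrite ge_min lexx orbT.
Qed.

Lemma coul_far_ge0 (r : R) : (0 <= coul_far r)%R.
Proof.
rewrite -lee_fin coul_farE sube_ge0 ?coul_fin_num ?orbT//.
by apply: coul_nincr => //; rewrite le_max lexx orbT.
Qed.

Lemma coul_decomp (r : R) : (0 <= r)%R ->
  coul n r - coul n 1%R = coul_near r - (coul_far r)%:E.
Proof.
move=> r0; rewrite coul_farE /coul_near; have [r1|r1] := leP r 1%R.
  by rewrite subee// sube0.
by rewrite subee// add0e oppeB ?fin_num_adde_defr// addeC.
Qed.

(** Beyond distance 1 the radial derivative r^(1 - n) is at most 1. This is how the unbounded far
    part is controlled by the second moment of the noise. *)
Lemma coul_far_lipschitz (r s : R) : (0 <= s)%R ->
  (coul_far (r + s) <= coul_far r + s)%R.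
Proof.
move=> s0; rewrite -lee_fin EFinD !coul_farE.
set a : R := Num.max r 1%R; set b : R := Num.max (r + s)%R 1%R.
have a1 : (1 <= a)%R by rewrite le_max lexx orbT.
have a0 := lt_le_trans ltr01 a1.
have ab : (a <= b)%R.
  by rewrite ge_max !le_max lexx orbT andbT lerDl s0.
have bas : (b - a <= s)%R.
  rewrite lerBlDl ge_max; apply/andP; split; last by rewrite (le_trans a1)// lerDl.
  by rewrite lerD2r le_max lexx.
have b0 := lt_le_trans a0 ab.
have h : coul n a - coul n b <= s%:E.
  rewrite -integral_coul ?(ltW a0)//.
  apply: (@le_trans _ _ (\int[lebesgue_measure]_(r in `[a, b]) (cst 1 r))).
    apply: ge0_le_integral => //.
    - move=> x /=; rewrite in_itv/= => /andP[ax _].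
      by rewrite lee_fin divr_ge0 ?exprn_ge0// (le_trans (ltW a0)).
    - by apply/measurable_EFinP/measurable_funTS; exact: measurable_coul_density.
    - move=> x /=; rewrite in_itv/= => /andP[ax _].
      have x1 := le_trans a1 ax; have x0 := lt_le_trans ltr01 x1.
      rewrite lee_fin ler_pdivrMr ?exprn_gt0// mul1r.
      by rewrite -[leLHS]expr1 ler_weXn2l.
  rewrite integral_cst//= mul1e lebesgue_measure_itv/= lte_fin.
  by case: ifPn => _; rewrite -?EFinD lee_fin.
move: h; rewrite -(fineK c1) -(fineK (coul_fin_num n0 a0)) -(fineK (coul_fin_num n0 b0)).
by rewrite -!EFinD !lee_fin; lra.
Qed.

Lemma coul_far_nondecr (r s : R) : (r <= s)%R -> (coul_far r <= coul_far s)%R.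
Proof.
move=> rs; rewrite -lee_fin !coul_farE leeB// coul_nincr ?(ltW (max0 _))//.
by rewrite ge_max !le_max lexx orbT andbT rs.
Qed.

Lemma heat_nearE (r : R) : (0 <= r)%R ->
  \int[lebesgue_measure]_v (heat n v (Num.min r 1) - heat n v 1)%:E =
  heat_const R n * coul_near r.
Proof.
by move=> r0; rewrite integral_heat_sub// ?le_min ?r0//= ge_min lexx orbT.
Qed.

Lemma heat_farE (r : R) :
  \int[lebesgue_measure]_v (heat n v 1 - heat n v (Num.max r 1))%:E =
  heat_const R n * (coul_far r)%:E.
Proof.
by rewrite integral_heat_sub// ?coul_farE// le_max lexx orbT.
Qed.

(** Measurability is read off the heat representation: the near and far parts are, up to the factor
    [heat_const], integrals in time of nonnegative measurable functions. This treats all dimensions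
    and the infinite value at 0 at once. *)
Lemma measurable_coul d (T : measurableType d) (f : T -> R) :
  measurable_fun setT f -> (forall x, 0 <= f x)%R ->
  measurable_fun setT (fun x => coul n (f x)).
Proof.
move=> mf f0.
suff : measurable_fun setT (fun x => coul_near (f x) - (coul_far (f x))%:E + coul n 1%R).
  by apply: eq_measurable_fun => x _; rewrite -coul_decomp// subeK.
have [k k0 kE] := heat_constE R n0.
have mh : measurable_fun setT (fun z : measurableTypeR R * T => heat n z.1 (Num.min (f z.2) 1) - heat n z.1 1)%R.
  apply: measurable_funB; apply: measurable_heat => //.
  by apply: measurable_minr => //; apply: measurableT_comp => //; exact: measurable_snd.
have mh' : measurable_fun setT (fun z : measurableTypeR R * T => heat n z.1 1 - heat n z.1 (Num.max (f z.2) 1))%R.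
  apply: measurable_funB; apply: measurable_heat => //.
  by apply: measurable_maxr => //; apply: measurableT_comp => //; exact: measurable_snd.
apply: emeasurable_funD => //; apply: emeasurable_funB.
- rewrite (_ : (fun x => _) = (fun x => (k^-1)%:E *
      \int[lebesgue_measure]_v (heat n v (Num.min (f x) 1) - heat n v 1)%:E)); last first.
    apply/funext => x; rewrite heat_nearE// muleA kE -EFinM.
    by rewrite mulVf ?mul1e// gt_eqF.
  apply: emeasurable_funM => //.
  apply: (@measurable_fun_fubini_tonelli_G _ _ _ _ _ lebesgue_measure
    (fun z : measurableTypeR R * T => (heat n z.1 (Num.min (f z.2) 1) - heat n z.1 1)%:E)).
    exact/measurable_EFinP.
  move=> z; rewrite lee_fin subr_ge0; have [v0|v0] := leP z.1 0%R.
    by rewrite !heat_le0.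
  apply: heat_nincr; first exact: ltW.
  by rewrite le_min f0 ler01/= ge_min lexx orbT.
- rewrite (_ : (fun x => _) = (fun x => (k^-1)%:E *
      \int[lebesgue_measure]_v (heat n v 1 - heat n v (Num.max (f x) 1))%:E)); last first.
    apply/funext => x; rewrite heat_farE// kE -!EFinM.
    by rewrite mulrA mulVf ?mul1r// gt_eqF.
  apply: emeasurable_funM => //.
  apply: (@measurable_fun_fubini_tonelli_G _ _ _ _ _ lebesgue_measure
    (fun z : measurableTypeR R * T => (heat n z.1 1 - heat n z.1 (Num.max (f z.2) 1))%:E)).
    exact/measurable_EFinP.
  move=> z; rewrite lee_fin subr_ge0; have [v0|v0] := leP z.1 0%R.
    by rewrite !heat_le0.
  by apply: heat_nincr; rewrite ?(ltW v0)// ler01 le_max lexx orbT.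
Qed.

End coul_decomposition.

(** * Gaussian smoothing of the Coulomb kernel *)

Section smoothing.
Context (R : realType) (n : nat).
Hypothesis n0 : (0 < n)%N.
Variable t : R.
Hypothesis t01 : (0 < t <= 1)%R.
Variable p : probability (Euclid R n) R.
Hypothesis p_gauss : forall x v, (0 < v)%R ->
  \int[p]_z (expR (- sqnorm (tadd x z) / (2 * v)))%:E =
  (Num.sqrt (v / (v + t)) ^+ n * expR (- sqnorm x / (2 * (v + t))))%:E.
Hypothesis p_moment : \int[p]_z (sqnorm z)%:E <= (8 * n%:R * t)%:E.

Let t0 : (0 < t)%R. Proof. by case/andP: t01. Qed.

Notation L := (@lebesgue_measure R).

Let mdist d (T : measurableType d) (f g : T -> Euclid R n) :
  measurable_fun setT f -> measurable_fun setT g ->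
  measurable_fun setT (fun x => enorm (tadd (f x) (g x))).
Proof. by move=> mf mg; apply: measurable_enorm; exact: measurable_tadd. Qed.

(** The semigroup property: adding noise of variance [t] advances the heat kernel by time [t]. *)
Lemma integral_heat_smooth w (v : R) : (0 < v)%R ->
  \int[p]_z (heat n v (enorm (tadd w z)))%:E = (heat n (v + t) (enorm w))%:E.
Proof.
move=> v0; have vt0 : (0 < v + t)%R by rewrite addr_gt0.
rewrite /heat; under eq_integral do rewrite sqr_enorm EFinM.
rewrite ge0_integralZl; [|by []| | |]; last 3 first.
- apply/measurable_EFinP; apply: measurableT_comp => //.
  apply: measurable_funM => //; apply: measurableT_comp => //.
  by apply: (measurableT_comp (@measurable_sqnorm R n)); apply: measurable_tadd.
- by move=> z _; rewrite lee_fin expR_ge0.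
- by rewrite lee_fin exprn_ge0// invr_ge0 sqrtr_ge0.
rewrite p_gauss// -EFinM mulrA sqr_enorm -exprMn; congr (_ ^+ n * _)%:E.
have sv : Num.sqrt v != 0%R by rewrite gt_eqF// sqrtr_gt0.
by rewrite sqrtrM ?(ltW v0)// mulrA mulVf// mul1r sqrtrV// ltW.
Qed.

(** The splitting of [coul] at distance 1, performed at each time [v]: both halves are nonnegative
    and integrate over time to [heat_const] times [coul_near] and [coul_far]. *)
Definition heat_near (v r : R) : R := (heat n v (Num.min r 1) - heat n v 1)%R.
Definition heat_far (v r : R) : R := (heat n v 1 - heat n v (Num.max r 1))%R.

Let heat_nincr' (v a b : R) : (0 <= a <= b)%R -> (heat n v b <= heat n v a)%R.
Proof.
move=> ab; have [v0|v0] := leP v 0%R; first by rewrite !heat_le0.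
by rewrite heat_nincr// ltW.
Qed.

Lemma heat_near_ge0 (v r : R) : (0 <= r)%R -> (0 <= heat_near v r)%R.
Proof. by move=> r0; rewrite subr_ge0 heat_nincr'// le_min r0 ler01/= ge_min lexx orbT. Qed.

Lemma heat_far_ge0 (v r : R) : (0 <= heat_far v r)%R.
Proof. by rewrite subr_ge0 heat_nincr'// ler01 le_max lexx orbT. Qed.

Lemma heat_near_far (v r : R) : (heat_near v r - heat_far v r = heat n v r - heat n v 1)%R.
Proof. by rewrite /heat_near /heat_far; case: (leP r 1%R) => _; ring. Qed.

Lemma measurable_heat_near d (T : measurableType d) (f g : T -> R) :
  measurable_fun setT f -> measurable_fun setT g ->
  measurable_fun setT (fun x => heat_near (f x) (g x)).
Proof.
move=> mf mg; apply: measurable_funB; apply: measurable_heat => //.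
exact: measurable_minr.
Qed.

Lemma measurable_heat_far d (T : measurableType d) (f g : T -> R) :
  measurable_fun setT f -> measurable_fun setT g ->
  measurable_fun setT (fun x => heat_far (f x) (g x)).
Proof.
move=> mf mg; apply: measurable_funB; apply: measurable_heat => //.
exact: measurable_maxr.
Qed.

Lemma heat_le_time (v r : R) : (0 < v)%R -> (heat n v r <= (Num.sqrt v)^-1 ^+ n)%R.
Proof.
move=> v0; rewrite ler_piMr ?exprn_ge0 ?invr_ge0 ?sqrtr_ge0//.
by rewrite -[leRHS]expR0 ler_expR mulNr oppr_le0 divr_ge0 ?sqr_ge0// mulr_ge0// ltW.
Qed.

(** For v >= 1 one has v^(-n/2) <= v^(-1/2), so dimension 1 dominates. Its bound is integrable in
    time because [coul 1] is finite at 0. *)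
Lemma heat_near_large_time (v r : R) : (0 <= r)%R -> (1 <= v)%R ->
  (heat_near v r <= heat 1 v 0 - heat 1 v 1)%R.
Proof.
move=> r0 v1; have v0 := lt_le_trans ltr01 v1.
apply: (@le_trans _ _ (heat n v 0 - heat n v 1)%R).
  by rewrite /heat_near lerB// heat_nincr'// lexx le_min r0 ler01.
rewrite /heat -!mulrBr ler_wpM2r//.
  rewrite subr_ge0 ler_expR expr0n/= oppr0 mul0r mulNr oppr_le0.
  by rewrite expr1n divr_ge0// mulr_ge0// ltW.
rewrite expr1 -[leRHS]expr1 ler_wiXn2l// ?invr_ge0 ?sqrtr_ge0//.
have s1 : (1 <= Num.sqrt v)%R by rewrite -[leLHS]sqrtr1 ler_sqrt// ltW.
by rewrite invf_le1// (lt_le_trans _ s1).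
Qed.

Lemma integral_coul_near_smooth w :
  heat_const R n * \int[p]_z coul_near n (enorm (tadd w z)) =
  \int[L]_v \int[p]_z (heat_near v (enorm (tadd w z)))%:E.
Proof.
have h0 z : 0 <= (heat_near z.2 (enorm (tadd w z.1)))%:E.
  by rewrite lee_fin heat_near_ge0// enorm_ge0.
have mh : measurable_fun setT (fun z : Euclid R n * measurableTypeR R =>
    (heat_near z.2 (enorm (tadd w z.1)))%:E).
  apply/measurable_EFinP; apply: measurable_heat_near => //.
  by apply: mdist => //; exact: measurable_fst.
rewrite -(@fubini_tonelli _ _ _ _ R p L
  (fun z => (heat_near z.2 (enorm (tadd w z.1)))%:E))//.
rewrite -ge0_integralZl; [|by []| | |]; last 3 first.
- apply: emeasurable_funB => //; apply: (measurable_coul n0); last first.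
    by move=> x; rewrite le_min ler01 enorm_ge0.
  by apply: measurable_minr => //; apply: mdist.
- by move=> z _; rewrite coul_near_ge0// enorm_ge0.
- by rewrite ltW// heat_const_gt0.
by apply: eq_integral => z _; rewrite -heat_nearE// enorm_ge0.
Qed.

Lemma integral_coul_far_smooth w :
  heat_const R n * \int[p]_z (coul_far n (enorm (tadd w z)))%:E =
  \int[L]_v \int[p]_z (heat_far v (enorm (tadd w z)))%:E.
Proof.
have h0 z : 0 <= (heat_far z.2 (enorm (tadd w z.1)))%:E.
  by rewrite lee_fin heat_far_ge0.
have mh : measurable_fun setT (fun z : Euclid R n * measurableTypeR R =>
    (heat_far z.2 (enorm (tadd w z.1)))%:E).
  apply/measurable_EFinP; apply: measurable_heat_far => //.
  by apply: mdist => //; exact: measurable_fst.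
rewrite -(@fubini_tonelli _ _ _ _ R p L
  (fun z => (heat_far z.2 (enorm (tadd w z.1)))%:E))//.
rewrite -ge0_integralZl; [|by []| | |]; last 3 first.
- under eq_fun do rewrite coul_farE//.
  apply: emeasurable_funB => //; apply: (measurable_coul n0); last first.
    by move=> x; rewrite le_max ler01 orbT.
  by apply: measurable_maxr => //; apply: mdist.
- by move=> z _; rewrite lee_fin coul_far_ge0.
- by rewrite ltW// heat_const_gt0.
by apply: eq_integral => z _; rewrite -heat_farE.
Qed.

(** The Lipschitz bound and s <= 1 + s^2 for s the length of the noise; the second moment of [p]
    gives the term [8 * n%:R * t]. *)
Lemma integral_coul_far_smooth_le w :
  \int[p]_z (coul_far n (enorm (tadd w z)))%:E <=
  (coul_far n (enorm w) + (1 + 8 * n%:R * t))%:E.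
Proof.
have mfar : measurable_fun setT (fun z => (coul_far n (enorm (tadd w z)))%:E).
  under eq_fun do rewrite coul_farE//.
  apply: emeasurable_funB => //; apply: (measurable_coul n0); last first.
    by move=> x; rewrite le_max ler01 orbT.
  by apply: measurable_maxr => //; apply: mdist.
apply: (@le_trans _ _ (\int[p]_z ((coul_far n (enorm w) + 1)%:E + (sqnorm z)%:E))).
  apply: ge0_le_integral => //.
  - by move=> z _; rewrite lee_fin coul_far_ge0.
  - apply: emeasurable_funD => //; apply/measurable_EFinP; exact: measurable_sqnorm.
  - move=> z _; rewrite -EFinD lee_fin.
    apply: (@le_trans _ _ (coul_far n (enorm w + enorm z))).
      by rewrite coul_far_nondecr// enorm_triangle.
    apply: (le_trans (coul_far_lipschitz n0 _ (enorm_ge0 z))).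
    rewrite -addrA lerD2l -sqr_enorm; have := sqr_ge0 (enorm z - 2^-1).
    by move: (enorm z) => e; rewrite sqrrB; lra.
rewrite ge0_integralD; [|by []| | | |]; last 4 first.
- by move=> z _; rewrite lee_fin addr_ge0// coul_far_ge0.
- by [].
- by move=> z _; rewrite lee_fin sqnorm_ge0.
- by apply/measurable_EFinP; exact: measurable_sqnorm.
by rewrite integral_prob_cst [in leRHS]addrA [in leRHS]EFinD leeD.
Qed.

(** Smoothing replaces time v by v + t, and at times at least t the heat kernel is at most t^(-n/2).
    The smoothed kernel is therefore finite everywhere, even at [w] = 0 where [coul_near] may be
    infinite. *)
Lemma integral_coul_near_smooth_lty w :
  \int[p]_z coul_near n (enorm (tadd w z)) < +oo.
Proof.
have [k k0 kE] := heat_constE R n0.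
suff : heat_const R n * \int[p]_z coul_near n (enorm (tadd w z)) < +oo.
  rewrite kE; case: (\int[p]_z _) => [r|//|//]; first by rewrite !ltry.
  by rewrite gt0_muley.
rewrite integral_coul_near_smooth.
have h0 v z : (0 <= heat_near v (enorm (tadd w z)))%R.
  by rewrite heat_near_ge0// enorm_ge0.
pose B : R := ((Num.sqrt t)^-1 ^+ n)%R.
have B0 : (0 <= B)%R by rewrite exprn_ge0// invr_ge0 sqrtr_ge0.
have a0 (v : R) : (0 <= heat 1 v 0 - heat 1 v 1)%R.
  rewrite subr_ge0; have [v0|v0] := leP v 0%R; first by rewrite !heat_le0.
  by rewrite heat_nincr ?(ltW v0)// lexx ler01.
have mB : measurable_fun setT (fun v : R => (B * \1_`[0%R, 1%R] v)%:E).
  by apply/measurable_EFinP; apply: measurable_funM => //.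
have ma : measurable_fun setT (fun v : R => (heat 1 v 0 - heat 1 v 1)%:E).
  by apply/measurable_EFinP; apply: measurable_funB; exact: measurable_heat.
have mz v : measurable_fun setT (fun z => (heat n v (enorm (tadd w z)))%:E).
  by apply/measurable_EFinP; apply: measurable_heat => //; exact: mdist.
have mhz v : measurable_fun setT (fun z => (heat_near v (enorm (tadd w z)))%:E).
  by apply/measurable_EFinP; apply: measurable_heat_near => //; exact: mdist.
apply: (@le_lt_trans _ _ (\int[L]_v ((B * \1_`[0%R, 1%R] v)%:E + (heat 1 v 0 - heat 1 v 1)%:E))).
  apply: ge0_le_integral => //.
  - by move=> v _; apply: integral_ge0 => z _; rewrite lee_fin.
  - apply: (@measurable_fun_fubini_tonelli_G _ _ _ _ _ p
      (fun z => (heat_near z.2 (enorm (tadd w z.1)))%:E)); last by move=> z; rewrite lee_fin.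
    apply/measurable_EFinP; apply: measurable_heat_near => //.
    by apply: mdist => //; exact: measurable_fst.
  - exact: emeasurable_funD.
  - move=> v _; have [v0|v0] := leP v 0%R.
      rewrite integral0_eq; first by rewrite -EFinD lee_fin addr_ge0// mulr_ge0.
      by move=> z _; rewrite /heat_near !heat_le0// subrr.
    have [v1|v1] := leP v 1%R.
      apply: (@le_trans _ _ (\int[p]_z (heat n v (enorm (tadd w z)))%:E)).
        apply: ge0_le_integral => //.
        - by move=> z _; rewrite lee_fin.
        - move=> z _; rewrite lee_fin /heat_near; case: (leP (enorm (tadd w z)) 1%R) => _.
            by rewrite gerBl heat_ge0.
          by rewrite subrr heat_ge0.
      rewrite integral_heat_smooth// indicE mem_setE/= in_itv/= (ltW v0) v1/= mulr1.
      rewrite -EFinD lee_fin -[leLHS]addr0 lerD//.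
      rewrite (le_trans (heat_le_time _ _)) ?addr_gt0//.
      rewrite lerXn2r ?nnegrE ?invr_ge0 ?sqrtr_ge0//.
      rewrite lef_pV2 ?posrE ?sqrtr_gt0 ?addr_gt0// ler_sqrt ?addr_gt0//.
        by rewrite lerDr ltW.
      by rewrite addr_ge0// ltW.
    apply: (@le_trans _ _ (\int[p]_z (heat 1 v 0 - heat 1 v 1)%:E)).
      apply: ge0_le_integral => //.
      - by move=> z _; rewrite lee_fin.
      - by move=> z _; rewrite lee_fin heat_near_large_time ?enorm_ge0// ltW.
    by rewrite integral_prob_cst leeDr// lee_fin mulr_ge0.
rewrite ge0_integralD; [|by []| |by []| |by []]; last 2 first.
- by move=> v _; rewrite lee_fin mulr_ge0.
- by move=> v _; rewrite lee_fin.
apply: lte_add_pinfty.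
  under eq_integral do rewrite EFinM.
  rewrite ge0_integralZl; [|by []| | |by rewrite lee_fin]; last 2 first.
  - by apply/measurable_EFinP; apply: measurable_indic.
  - by move=> v _; rewrite lee_fin.
  rewrite integral_indic// setIT/= lebesgue_measure_itv/= lte_fin ltr01.
  by rewrite -EFinD -EFinM ltry.
rewrite integral_heat_sub//=; have [k1 k10 ->] := @heat_constE R 1 isT.
by rewrite -EFinD -EFinM ltry.
Qed.


(** The density in time of the smoothed kernel relative to distance 1. The test on [v] matters: for
    -t < v <= 0 the shifted kernel is positive, although such times are absent from the Coulomb
    kernel. *)
Definition heat_gap (w : Euclid R n) (v : R) : R :=
  if (0 < v)%R then (heat n (v + t) (enorm w) - heat n v 1)%R else 0%R.

Lemma integral_heat_gap w :
  L.-integrable setT (fun v => (heat_gap w v)%:E) /\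
  \int[L]_v (heat_gap w v)%:E = heat_const R n *
    (\int[p]_z coul_near n (enorm (tadd w z)) -
     \int[p]_z (coul_far n (enorm (tadd w z)))%:E).
Proof.
have [k k0 kE] := heat_constE R n0.
have np0 v z : 0 <= (heat_near v (enorm (tadd w z)))%:E.
  by rewrite lee_fin heat_near_ge0// enorm_ge0.
have nf0 v z : 0 <= (heat_far v (enorm (tadd w z)))%:E.
  by rewrite lee_fin heat_far_ge0.
pose P v := \int[p]_z (heat_near v (enorm (tadd w z)))%:E.
pose M v := \int[p]_z (heat_far v (enorm (tadd w z)))%:E.
have P0 v : 0 <= P v by apply: integral_ge0.
have M0 v : 0 <= M v by apply: integral_ge0.
have mP : measurable_fun setT P.
  apply: (@measurable_fun_fubini_tonelli_G _ _ _ _ _ p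
    (fun z => (heat_near z.2 (enorm (tadd w z.1)))%:E)) => //.
  apply/measurable_EFinP; apply: measurable_heat_near => //.
  by apply: mdist => //; exact: measurable_fst.
have mM : measurable_fun setT M.
  apply: (@measurable_fun_fubini_tonelli_G _ _ _ _ _ p
    (fun z => (heat_far z.2 (enorm (tadd w z.1)))%:E)) => //.
  apply/measurable_EFinP; apply: measurable_heat_far => //.
  by apply: mdist => //; exact: measurable_fst.
have iP : L.-integrable setT P.
  apply/integrableP; split; first exact: mP.
  under eq_integral => v _ do rewrite (gee0_abs (P0 v)).
  rewrite -integral_coul_near_smooth kE.
  have := integral_coul_near_smooth_lty w.
  have : 0 <= \int[p]_z coul_near n (enorm (tadd w z)).
    by apply: integral_ge0 => z _; rewrite coul_near_ge0// enorm_ge0.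
  by case: (\int[p]_z _) => // r _ _; rewrite -EFinM ltry.
have iM : L.-integrable setT M.
  apply/integrableP; split; first exact: mM.
  under eq_integral => v _ do rewrite (gee0_abs (M0 v)).
  rewrite -integral_coul_far_smooth kE.
  have := integral_coul_far_smooth_le w.
  have : 0 <= \int[p]_z (coul_far n (enorm (tadd w z)))%:E.
    by apply: integral_ge0 => z _; rewrite lee_fin coul_far_ge0.
  by case: (\int[p]_z _) => // r _ _; rewrite -EFinM ltry.
have PM v : (heat_gap w v)%:E = P v - M v.
  rewrite /heat_gap; case: ltP => v0; last first.
    by rewrite /P /M !integral0_eq ?subee// => z _;
      rewrite /heat_near /heat_far !heat_le0// subrr.
  have mz : measurable_fun setT (fun z => (heat n v (enorm (tadd w z)))%:E).
    by apply/measurable_EFinP; apply: measurable_heat => //; exact: mdist.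
  have mnz : measurable_fun setT (fun z => (heat_near v (enorm (tadd w z)))%:E).
    by apply/measurable_EFinP; apply: measurable_heat_near => //; exact: mdist.
  have mfz : measurable_fun setT (fun z => (heat_far v (enorm (tadd w z)))%:E).
    by apply/measurable_EFinP; apply: measurable_heat_far => //; exact: mdist.
  have h0 r : 0 <= (heat n v r)%:E by rewrite lee_fin heat_ge0.
  (* The relation is first stated as an equality of sums of nonnegative terms, where no
     integrability is required; the finite terms are subtracted afterwards. *)
  have E : P v + (heat n v 1)%:E = (heat n (v + t) (enorm w))%:E + M v.
    rewrite -integral_heat_smooth// -ge0_integralD//.
    rewrite -[X in P v + X](integral_prob_cst p) -ge0_integralD//.
    apply: eq_integral => z _; rewrite -!EFinD; congr _%:E.
    by have := heat_near_far v (enorm (tadd w z)); lra.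
  have Mfin : M v \is a fin_num.
    rewrite ge0_fin_numE//; apply: (@le_lt_trans _ _ (\int[p]_z (heat n v 1)%:E)).
      apply: ge0_le_integral => //.
      by move=> z _; rewrite lee_fin gerBl heat_ge0.
    by rewrite integral_prob_cst ltry.
  have -> : P v = (heat n (v + t) (enorm w))%:E + M v - (heat n v 1)%:E.
    by rewrite -E addeK.
  by rewrite -(fineK Mfin) -!EFinD; congr _%:E; ring.
have -> : (fun v => (heat_gap w v)%:E) = (fun v => P v - M v) by exact/funext.
split; first exact: integrableB.
rewrite (integralB measurableT iP iM).
rewrite -integral_coul_near_smooth -integral_coul_far_smooth.
rewrite kE [RHS]muleBr; [by []|by []|apply: fin_num_adde_defl].
rewrite fin_numN ge0_fin_numE.
  by rewrite (le_lt_trans (integral_coul_far_smooth_le w))// ltry.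
by apply: integral_ge0 => z _; rewrite lee_fin coul_far_ge0.
Qed.

Lemma ex_unit_vector : exists w : Euclid R n, enorm w = 1%R.
Proof.
exists [tuple (if i == Ordinal n0 then 1%R else 0%R) | i < n].
rewrite /enorm /sqnorm (bigD1 (Ordinal n0))//= tnth_mktuple eqxx expr1n.
rewrite big1 ?addr0 ?sqrtr1// => i /negbTE i0.
by rewrite tnth_mktuple i0 expr0n.
Qed.

(** The kernel k_t as a function of the distance, normalized so that it is subtracted from
    [heat_const] times [coul]. It is infinite at r = 0 as soon as n >= 2. *)
Definition heat_time (r : R) : \bar R :=
  \int[L]_(v in `]0%R, t]) (heat n v r)%:E.

Lemma heat_time_fin r : (0 < r)%R -> heat_time r < +oo.
Proof.
move=> r0; pose K : R := ((2 * n.+1%:R / r ^+ 2) ^+ n.+1)%R.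
have K0 : (0 <= K)%R by rewrite /K exprn_ge0// mulr_ge0 ?invr_ge0 ?sqr_ge0.
apply: (@le_lt_trans _ _ (\int[L]_(v in `]0%R, t]) (cst K%:E v))).
  apply: ge0_le_integral => //.
  - by move=> v _; rewrite lee_fin heat_ge0.
  - by apply/measurable_EFinP; apply: measurable_funTS; exact: measurable_heat.
  - move=> v; rewrite /= in_itv/= => /andP[v0 vt]; rewrite lee_fin.
    have v1 : (v <= 1)%R by rewrite (le_trans vt)//; case/andP: t01.
    apply: (le_trans (@heat_small_time R n v r _ r0)); first by rewrite v0.
    by rewrite ler_piMl.
rewrite integral_cst//= lebesgue_measure_itv/= lte_fin t0.
by rewrite -EFinD -EFinM ltry.
Qed.

(** Smoothing shifts the times v > 0 to v > t, so the range up to [t] is lost. The reference term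
    [heat n v 1] is not shifted, and the discrepancy does not depend on [w]: comparison with a unit
    vector [w1] gives [E] as the integral of [heat_gap w1] plus [heat_time 1]. Both sides may be
    [+oo], at [w] = 0. *)
Lemma smooth_identity : exists E : R, forall w,
  heat_const R n * (\int[p]_z coul_near n (enorm (tadd w z)) -
     \int[p]_z (coul_far n (enorm (tadd w z)))%:E) + heat_time (enorm w) =
  heat_const R n * (coul_near n (enorm w) - (coul_far n (enorm w))%:E) + E%:E.
Proof.
have [w1 w1E] := ex_unit_vector.
have [ig1 _] := integral_heat_gap w1.
have [e0 e0E] : exists e0 : R, \int[L]_v (heat_gap w1 v)%:E = e0%:E.
  by eexists; rewrite -[LHS]fineK//; exact: integrable_fin_num.
have [b bE] : exists b : R, heat_time 1 = b%:E.
  eexists; rewrite -[LHS]fineK// ge0_fin_numE ?heat_time_fin//.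
  by apply: integral_ge0 => v _; rewrite lee_fin heat_ge0.
exists (e0 + b)%R => w.
have r0 := enorm_ge0 w; set r := enorm w in r0 *.
have [ig igE] := integral_heat_gap w; rewrite -igE.
have mn : measurable_fun setT (fun v : R => (heat_near v r)%:E).
  by apply/measurable_EFinP; apply: measurable_heat_near.
have mf : measurable_fun setT (fun v : R => (heat_far v r)%:E).
  by apply/measurable_EFinP; apply: measurable_heat_far.
have n_ge0 v : 0 <= (heat_near v r)%:E by rewrite lee_fin heat_near_ge0.
have f_ge0 v : 0 <= (heat_far v r)%:E by rewrite lee_fin heat_far_ge0.
(* Cut the time axis at [t] and translate the part beyond [t] back to the positive half-line. *)
have split_at (g : R -> R) : measurable_fun setT (fun v : R => (g v)%:E) ->
    (forall v, 0 <= (g v)%:E) -> (forall v, (v <= 0)%R -> g v = 0%R) ->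
    \int[L]_v (g v)%:E = \int[L]_(v in `]0%R, t]) (g v)%:E +
      \int[L]_v (if (0 < v)%R then g (v + t)%R else 0%R)%:E.
  move=> mg g0 gle0.
  have m1 : measurable_fun setT ((fun v : R => (g v)%:E) \_ `]0%R, t]).
    exact/(measurable_restrictT _ _).1/measurable_funTS.
  have m2 : measurable_fun setT ((fun v : R => (g v)%:E) \_ `]t, +oo[).
    exact/(measurable_restrictT _ _).1/measurable_funTS.
  have p0 D v : 0 <= ((fun v : R => (g v)%:E) \_ D) v.
    by rewrite patchE; case: ifPn.
  have -> : \int[L]_v (if (0 < v)%R then g (v + t)%R else 0%R)%:E =
      \int[L]_(v in `]t, +oo[) (g v)%:E.
    rewrite [RHS]integral_mkcond [RHS](@ge0_integral_affine R 1 t)//.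
    rewrite mul1e; apply: eq_integral => v _; rewrite mul1r patchE mem_setE/=.
    by rewrite in_itv/= andbT ltrDr; case: ifPn.
  rewrite [X in _ = X + _]integral_mkcond [X in _ = _ + X]integral_mkcond.
  rewrite -ge0_integralD//.
  apply: eq_integral => v _; rewrite !patchE !mem_setE/= !in_itv/= andbT.
  have [v0|v0] := leP v 0%R.
    by rewrite gle0// (ltNge t) (le_trans v0 (ltW t0))/= adde0.
  by case: (leP v t) => _; rewrite ?adde0 ?add0e.
have [k k0 kE] := heat_constE R n0.
set gn : R -> R := fun v => if (0 < v)%R then heat_near (v + t) r else 0%R.
set gf : R -> R := fun v => if (0 < v)%R then heat_far (v + t) r else 0%R.
have Hn : heat_const R n * coul_near n r =
    \int[L]_(v in `]0%R, t]) (heat_near v r)%:E + \int[L]_v (gn v)%:E.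
  rewrite -heat_nearE; [|exact: n0|exact: r0].
  apply: (split_at (fun v => heat_near v r)); [exact: mn|exact: n_ge0|].
  by move=> v v0; rewrite /heat_near !heat_le0// subrr.
have Hf : heat_const R n * (coul_far n r)%:E =
    \int[L]_(v in `]0%R, t]) (heat_far v r)%:E + \int[L]_v (gf v)%:E.
  rewrite -heat_farE; last exact: n0.
  apply: (split_at (fun v => heat_far v r)); [exact: mf|exact: f_ge0|].
  by move=> v v0; rewrite /heat_far !heat_le0// subrr.
have mgf : measurable_fun setT (fun v : R => (gf v)%:E).
  apply/measurable_EFinP; apply: measurable_fun_ifT => //.
    exact: measurable_fun_ltr.
  by apply: measurable_heat_far => //; exact: measurable_funD.
have gf0 v : 0 <= (gf v)%:E by rewrite /gf; case: ifP.
have gn_ge0 v : 0 <= (gn v)%:E by rewrite /gn; case: ifP.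
have Hl : \int[L]_(v in `]0%R, t]) (heat_near v r)%:E + heat_time 1 =
    heat_time r + \int[L]_(v in `]0%R, t]) (heat_far v r)%:E.
  have mh q : measurable_fun `]0%R, t] (fun v : R => (heat n v q)%:E).
    by apply/measurable_EFinP; apply: measurable_funTS; exact: measurable_heat.
  have h0 (v q : R) : 0 <= (heat n v q)%:E by rewrite lee_fin heat_ge0.
  rewrite /heat_time -!ge0_integralD//; try exact: measurable_funTS; try exact: mh.
  apply: eq_integral => v _; rewrite -!EFinD; congr _%:E.
  by have := heat_near_far v r; lra.
move: Hf Hl Hn; rewrite kE.
have : 0 <= \int[L]_(v in `]0%R, t]) (heat_far v r)%:E by apply: integral_ge0.
have afE : 0 <= \int[L]_v (gf v)%:E by apply: integral_ge0.
have agE : \int[L]_v (gf v)%:E < +oo ->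
    \int[L]_v (gn v)%:E =
    \int[L]_v (heat_gap w v)%:E - \int[L]_v (heat_gap w1 v)%:E + \int[L]_v (gf v)%:E.
  move=> afin.
  have igf : L.-integrable setT (fun v => (gf v)%:E).
    by apply/integrableP; split => //; under eq_integral do rewrite gee0_abs//.
  rewrite -integralB// -integralD//; last exact: integrableB.
  apply: eq_integral => v _; rewrite -EFinB -EFinD; congr _%:E.
  rewrite /gn /gf /heat_gap w1E -/r; case: ifP => _; last by ring.
  by have := heat_near_far (v + t) r; lra.
have [gw gwE] : exists gw : R, \int[L]_v (heat_gap w v)%:E = gw%:E.
  by eexists; rewrite -[LHS]fineK//; exact: integrable_fin_num.
rewrite gwE e0E in agE *.
have : 0 <= \int[L]_(v in `]0%R, t]) (heat_near v r)%:E by apply: integral_ge0.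
have : 0 <= heat_time r by apply: integral_ge0 => v _; rewrite lee_fin heat_ge0.
rewrite bE.
(* Case analysis on infinite values. The two far integrals are finite, their sum being [k] times a
   real; only the near integral up to [t], and [heat_time r] with it, can be [+oo], and then both
   sides are. *)
move: (\int[L]_(v in `]0%R, t]) (heat_near v r)%:E) (heat_time r).
move: (\int[L]_(v in `]0%R, t]) (heat_far v r)%:E) afE agE.
move: (\int[L]_v (gf v)%:E) (\int[L]_v (gn v)%:E) => A' A l' A'0 AE l q q0 l0 l'0.
move: A' A'0 AE => [a'| |]// _ AE; last by case: l' l'0.
rewrite AE ?ltry//.
case: l' l'0 => [l'| |]// _.
rewrite (@muleBr _ k%:E (coul_near n r) (coul_far n r)%:E); [|by []|by apply: fin_num_adde_defl].
move=> -> Hl ->; move: Hl.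
case: l l0 => [l| |]// _; case: q q0 => [q| |]// _.
by rewrite -!EFinD => -[lq]; congr _%:E; lra.
Qed.

(** The form used for energies: the constant [coul n 1] is put back, and a bound uniform in [w] is
    added, so that the displaced measure inherits integrability from the original one. The bound
    holds since [heat_time] is nonnegative: up to a constant, smoothing can only lower the
    kernel. *)
Lemma smooth_coul : exists E C : R, forall w,
  [/\ p.-integrable setT (fun z => coul n (enorm (tadd w z))),
      heat_const R n * \int[p]_z coul n (enorm (tadd w z)) + heat_time (enorm w) =
        heat_const R n * coul n (enorm w) + E%:E &
      \int[p]_z `|coul n (enorm (tadd w z))| <= `|coul n (enorm w)| + C%:E].
Proof.
have [k k0 kE] := heat_constE R n0.
have [E EE] := smooth_identity.
have c1fin : coul n (1%R : R) \is a fin_num by apply: coul_fin_num.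
have [c1 c1E] : exists c1 : R, coul n 1%R = c1%:E.
  by eexists; rewrite -[LHS]fineK.
have decomp r : (0 <= r)%R -> coul n r = coul_near n r - (coul_far n r)%:E + c1%:E.
  by move=> r0; rewrite -coul_decomp// c1E subeK.
pose M : R := (1 + 8 * n%:R * t)%R.
(* In [C], the term |E|/k comes from the smoothing identity, 2M from two uses of the bound on the
   far part, and 2|c1| from removing and restoring [coul n 1]. *)
exists E, (`|E| / k + 2 * M + 2 * `|c1|)%R => w.
have r0 := enorm_ge0 w; set r := enorm w in r0 *.
pose np z := coul_near n (enorm (tadd w z)).
pose nf z := (coul_far n (enorm (tadd w z)))%:E.
have mnp : measurable_fun setT np.
  apply: emeasurable_funB => //; apply: (measurable_coul n0); last first.
    by move=> x; rewrite le_min ler01 enorm_ge0.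
  by apply: measurable_minr => //; apply: mdist.
have mnf : measurable_fun setT nf.
  rewrite /nf; under eq_fun do rewrite coul_farE//.
  apply: emeasurable_funB => //; apply: (measurable_coul n0); last first.
    by move=> x; rewrite le_max ler01 orbT.
  by apply: measurable_maxr => //; apply: mdist.
have np0 z : 0 <= np z by rewrite coul_near_ge0// enorm_ge0.
have nf0 z : 0 <= nf z by rewrite lee_fin coul_far_ge0.
have inp : p.-integrable setT np.
  apply/integrableP; split; first exact: mnp.
  under eq_integral => z _ do rewrite (gee0_abs (np0 z)).
  exact: integral_coul_near_smooth_lty.
have inf : p.-integrable setT nf.
  apply/integrableP; split; first exact: mnf.
  under eq_integral => z _ do rewrite (gee0_abs (nf0 z)).
  exact: le_lt_trans (integral_coul_far_smooth_le w) (ltry _).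
have ic : p.-integrable setT (cst c1%:E : Euclid R n -> \bar R).
  exact: finite_measure_integrable_cst.
have fE : (fun z => coul n (enorm (tadd w z))) = (fun z => np z - nf z + c1%:E).
  by apply/funext => z; rewrite decomp ?enorm_ge0.
have iD : p.-integrable setT (fun z => np z - nf z) by exact: integrableB.
have I1 : \int[p]_z coul n (enorm (tadd w z)) =
    \int[p]_z np z - \int[p]_z nf z + c1%:E.
  rewrite fE (integralD measurableT iD ic) (integralB measurableT inp inf).
  by rewrite integral_prob_cst.
have [a aE] : exists a : R, \int[p]_z np z = a%:E.
  by eexists; rewrite -[LHS]fineK//; exact: integrable_fin_num.
have [b bE] : exists b : R, \int[p]_z nf z = b%:E.
  by eexists; rewrite -[LHS]fineK//; exact: integrable_fin_num.
have bM : (b <= coul_far n r + M)%R by rewrite -lee_fin -bE; exact: integral_coul_far_smooth_le.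
have b0 : (0 <= b)%R by rewrite -lee_fin -bE; apply: integral_ge0.
have a0 : (0 <= a)%R by rewrite -lee_fin -aE; apply: integral_ge0.
have Ew : k%:E * (a%:E - b%:E) + heat_time r =
    k%:E * (coul_near n r - (coul_far n r)%:E) + E%:E.
  by rewrite -kE -aE -bE; exact: EE.
have hp0 : 0 <= heat_time r by apply: integral_ge0 => v _; rewrite lee_fin heat_ge0.
have f0 := coul_far_ge0 n0 r; have nr0 := coul_near_ge0 n0 r0.
split.
- by rewrite fE; exact: integrableD.
- rewrite I1 aE bE kE (decomp r r0); move: Ew nr0 hp0.
  case: (coul_near n r) => [s| |]//.
    case: (heat_time r) => [q| |]//.
    rewrite -!EFinB -!(EFinD _ c1) -!EFinM -!EFinD => -[h] _ _.
    by congr _%:E; lra.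
  rewrite !addye// gt0_muley ?lte_fin// !addye//.
  by case: (heat_time r).
- apply: (@le_trans _ _ (\int[p]_z (np z + nf z + `|c1|%:E))).
    apply: ge0_le_integral => //.
    + apply: measurableT_comp => //; rewrite fE.
      by apply: emeasurable_funD => //; apply: emeasurable_funB.
    + by apply: emeasurable_funD => //; apply: emeasurable_funD.
    + move=> z _; have := decomp (enorm (tadd w z)) (enorm_ge0 _); rewrite -/(np z) -/(nf z) => ->.
      rewrite (le_trans (lee_abs_add _ _))// leeD2r//.
      by rewrite (le_trans (lee_abs_sub _ _))// !gee0_abs.
  rewrite ge0_integralD; [|by []| | |by []|by []]; last 2 first.
  + by move=> z _; rewrite adde_ge0.
  + exact: emeasurable_funD.
  rewrite integral_prob_cst ge0_integralD; [|by []|by []|exact: mnp|by []|exact: mnf].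
  rewrite aE bE.
  (* The near and far parts are never both nonzero, so their sum is the absolute value of their
     difference, which is what the bound by [coul] requires. *)
  have sf : coul_near n r = 0 \/ coul_far n r = 0%R.
    have [r1|r1] := leP r 1%R.
      by right; rewrite /coul_far max_r// subee.
    by left; rewrite /coul_near min_r ?(ltW r1)// subee.
  rewrite (decomp r r0); move: Ew nr0 hp0 sf.
  case: (coul_near n r) => [s| |]//.
    case: (heat_time r) => [q| |]//.
    rewrite -!EFinB -!EFinM -!EFinD => -[h]; rewrite !lee_fin => s0 q0 sf.
    have h1 : (a <= b + s - coul_far n r + `|E| / k)%R.
      rewrite -(ler_pM2l k0) !mulrDr mulrN (mulrC k (_ / k)%R) divfK ?gt_eqF//.
      by have := ler_norm E; lra.
    have h2 : (s + coul_far n r <= `|s - coul_far n r|)%R.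
      case: sf => [[->]|->]; first by rewrite add0r sub0r normrN ler_norm.
      by rewrite addr0 subr0 ler_norm.
    have h3 : (`|s - coul_far n r| <= `|s - coul_far n r + c1| + `|c1|)%R.
      by rewrite -{1}[(s - coul_far n r)%R](addrK c1) (le_trans (ler_normB _ _)).
    by rewrite /M in bM *; lra.
  by move=> _ _ _ _; rewrite !addye//= leey.
Qed.
End smoothing.

(** * A Besicovitch covering inequality *)

Lemma eucl_distC (R : realType) n (x y : Euclid R n) : eucl_dist x y = eucl_dist y x.
Proof.
by rewrite /eucl_dist; congr Num.sqrt; apply: eq_bigr => i _; rewrite -sqrrN opprB.
Qed.

Lemma eucl_dist_ge0 (R : realType) n (x y : Euclid R n) : (0 <= eucl_dist x y)%R.
Proof. exact: sqrtr_ge0. Qed.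

Lemma eucl_dist_triangle (R : realType) n (x y z : Euclid R n) :
  (eucl_dist x z <= eucl_dist x y + eucl_dist y z)%R.
Proof.
rewrite !eucl_distE (_ : tsub x z = tadd (tsub x y) (tsub y z)).
  exact: enorm_triangle.
by apply: eq_from_tnth => i; rewrite !tnth_mktuple; ring.
Qed.

Lemma eucl_dist_coord (R : realType) n (x y : Euclid R n) i :
  (`|tnth x i - tnth y i| <= eucl_dist x y)%R.
Proof.
rewrite -sqrtr_sqr ler_sqrt; last by rewrite sumr_ge0// => j _; exact: sqr_ge0.
by rewrite (bigD1 i)//= lerDl sumr_ge0// => j _; exact: sqr_ge0.
Qed.

Lemma sqr_eucl_dist (R : realType) n (x y : Euclid R n) :
  (eucl_dist x y ^+ 2 = \sum_(i < n) (tnth x i - tnth y i) ^+ 2)%R.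
Proof. by rewrite sqr_sqrtr// sumr_ge0// => j _; exact: sqr_ge0. Qed.

(* Cells of the grid of mesh 1 / n.+1 hit by the unit vector from y to x: two
   unit vectors in the same cell make an angle less than 60 degrees. *)
Definition direction (R : realType) n (y x : Euclid R n) :
    {ffun 'I_n -> 'I_(2 * n.+1).+1} :=
  [ffun i => inord (Num.truncn
    (n.+1%:R * ((tnth x i - tnth y i) / eucl_dist y x + 1)))].

Lemma direction_close (R : realType) n (y x z : Euclid R n) i :
  (0 < eucl_dist y x)%R -> (0 < eucl_dist y z)%R ->
  direction y x = direction y z ->
  (`|(tnth x i - tnth y i) / eucl_dist y x -
     (tnth z i - tnth y i) / eucl_dist y z| <= n.+1%:R^-1)%R.
Proof.
move=> x0 z0 /ffunP/(_ i); rewrite !ffunE => /(congr1 val) /=.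
(* The coordinates of a unit vector lie in [-1, 1], so the index of its cell is at most 2(n+1) and
   [inord] loses nothing. *)
have H w : (0 < eucl_dist y w)%R ->
    (0 <= n.+1%:R * ((tnth w i - tnth y i) / eucl_dist y w + 1))%R /\
    (Num.truncn (n.+1%:R * ((tnth w i - tnth y i) / eucl_dist y w + 1))%R < (2 * n.+1).+1)%N.
  move=> w0; have := eucl_dist_coord y w i.
  rewrite distrC ler_norml => /andP[h1 h2].
  have u1 : (-1 <= (tnth w i - tnth y i) / eucl_dist y w)%R.
    by rewrite ler_pdivlMr// mulN1r.
  have u2 : ((tnth w i - tnth y i) / eucl_dist y w <= 1)%R.
    by rewrite ler_pdivrMr// mul1r.
  have h : (0 <= n.+1%:R * ((tnth w i - tnth y i) / eucl_dist y w + 1))%R.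
    by rewrite mulr_ge0//; lra.
  split=> //; rewrite ltnS -(ler_nat R).
  have h3 := h; rewrite -truncn_le in h3; apply: (le_trans h3).
  by rewrite natrM mulrC ler_wpM2r//; lra.
have [hx1 hx2] := H x x0; have [hz1 hz2] := H z z0.
rewrite !inordK// => E.
set u := ((tnth x i - tnth y i) / eucl_dist y x)%R in hx1 E *.
set v := ((tnth z i - tnth y i) / eucl_dist y z)%R in hz1 E *.
have := truncn_itv hx1; have := truncn_itv hz1; rewrite E.
move: (Num.truncn _) => m /andP[a1 a2] /andP[b1 b2].
rewrite -(@ler_pM2l _ n.+1%:R)// mulfV// -[X in (X * _)%R]ger0_norm// -normrM.
rewrite ler_norml; move: a2 b2; rewrite -!natr1; lra.
Qed.

(** The unit vectors u, v from y to x and z satisfy |u - v|^2 <= n/(n+1) <= 1, so u.v >= 1/2. The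
    law of cosines then gives |x - z|^2 <= a^2 + b^2 - ab <= b^2 for a <= b. *)
Lemma direction_separation (R : realType) n (y x z : Euclid R n) :
  (eucl_dist y x <= eucl_dist y z)%R -> direction y x = direction y z ->
  (eucl_dist x z <= eucl_dist y z)%R.
Proof.
move=> xz dxz; have [x0|x0] := leP (eucl_dist y x) 0%R.
  rewrite (le_trans (eucl_dist_triangle x y z))// (eucl_distC x) -[leRHS]add0r.
  by rewrite lerD2r.
have z0 := lt_le_trans x0 xz.
set a := eucl_dist y x in xz x0 *; set b := eucl_dist y z in xz z0 *.
pose X i := (tnth x i - tnth y i)%R; pose Z i := (tnth z i - tnth y i)%R.
have a2 : (\sum_(i < n) X i ^+ 2 = a ^+ 2)%R by rewrite /a eucl_distC sqr_eucl_dist.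
have b2 : (\sum_(i < n) Z i ^+ 2 = b ^+ 2)%R by rewrite /b eucl_distC sqr_eucl_dist.
pose XZ := (\sum_(i < n) X i * Z i)%R.
have c2 : (eucl_dist x z ^+ 2 = a ^+ 2 + b ^+ 2 - 2 * XZ)%R.
  rewrite sqr_eucl_dist -a2 -b2 /XZ mulr_sumr -big_split -sumrB/=.
  by apply: eq_bigr => i _; rewrite /X /Z; ring.
have h1 : (\sum_(i < n) (X i / a - Z i / b) ^+ 2 <= 1)%R.
  apply: (@le_trans _ _ (\sum_(i < n) n.+1%:R^-1)%R).
    apply: ler_sum => i _.
    have := direction_close i x0 z0 dxz; rewrite -/a -/b -/(X i) -/(Z i) => h.
    rewrite -real_normK ?num_real// expr2.
    apply: (@le_trans _ _ (n.+1%:R^-1 * 1)%R); last by rewrite mulr1.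
    by apply: ler_pM => //; rewrite (le_trans h)// invf_le1// ler1n.
  by rewrite sumr_const card_ord -[leLHS]mulr_natl ler_pdivrMr// mul1r ler_nat.
have h2 : (\sum_(i < n) (X i / a - Z i / b) ^+ 2 = 2 - 2 * XZ / (a * b))%R.
  rewrite (eq_bigr (fun i => X i ^+ 2 * a ^- 2 + Z i ^+ 2 * b ^- 2 -
      2 / (a * b) * (X i * Z i)))%R; last first.
    by move=> i _; field; rewrite !gt_eqF.
  rewrite sumrB big_split/= -!mulr_suml -mulr_sumr a2 b2 -/XZ.
  by field; rewrite !gt_eqF.
have h3 : (a * b <= 2 * XZ)%R.
  have ab0 : (0 < a * b)%R by rewrite mulr_gt0.
  by rewrite -[leLHS]mul1r -ler_pdivlMr//; lra.
rewrite -(@ler_pXn2r _ 2)// ?nnegrE ?eucl_dist_ge0 ?(ltW z0)// c2.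
have : (a * a <= a * b)%R by rewrite ler_pM2l.
by rewrite !expr2; lra.
Qed.

(** Neither center lies in the other open ball; the balls themselves may intersect. *)
Definition ball_separated (R : realType) n : rel (Euclid R n * R) :=
  fun a b => (Num.max a.2 b.2 <= eucl_dist a.1 b.1)%R.

Definition overlap n := #|{ffun 'I_n -> 'I_(2 * n.+1).+1}|.

(** The centers of the balls containing y are seen from y in distinct cells: in a common cell,
    [direction_separation] would put one center inside the other ball. *)
Lemma ball_separated_overlap (R : realType) n (s : seq (Euclid R n * R)) y :
  pairwise (@ball_separated R n) s ->
  (count (fun a => eucl_dist y a.1 < a.2)%R s <= overlap n)%N.
Proof.
move=> sep; rewrite -size_filter.
set s' := [seq _ <- _ | _].
have sep' : pairwise (@ball_separated R n) s' by apply: pairwise_filter.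
have dir a b : a \in s' -> b \in s' -> ball_separated a b ->
    direction y a.1 != direction y b.1.
  rewrite !mem_filter => /andP[ya _] /andP[yb _]; rewrite /ball_separated ge_max => /andP[sa sb].
  apply/eqP => dab; have [ab|ab] := leP (eucl_dist y a.1) (eucl_dist y b.1).
    by have := direction_separation ab dab; rewrite leNgt (lt_le_trans yb).
  have := direction_separation (ltW ab) (esym dab).
  by rewrite eucl_distC leNgt (lt_le_trans ya).
have us : uniq [seq direction y a.1 | a <- s'].
  rewrite uniq_pairwise pairwise_map.
  apply: (sub_in_pairwise (P := mem s') _ _ sep') => [a b /= sa sb|].
    exact: dir.
  exact/allP.
by rewrite -(size_map (fun a => direction y a.1)) -(card_uniqP us) max_card.
Qed.

Lemma measurable_eucl_dist d (T : measurableType d) (R : realType) n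
    (f g : T -> Euclid R n) :
  measurable_fun setT f -> measurable_fun setT g ->
  measurable_fun setT (fun x => eucl_dist (f x) (g x)).
Proof.
move=> mf mg; under eq_fun do rewrite eucl_distE.
by apply: measurable_enorm; exact: measurable_tsub.
Qed.

Lemma measurable_eucl_ball (R : realType) n (x : Euclid R n) r :
  measurable (eucl_ball x r).
Proof.
apply: measurable_set_bool; apply: measurable_fun_ltr => //.
exact: measurable_eucl_dist.
Qed.

Lemma measurable_fun_eucl_ball (R : realType) n
    (m : {finite_measure set (Euclid R n) -> \bar R}) r :
  measurable_fun setT (fun x => m (eucl_ball x r)).
Proof.
pose A : set (Euclid R n * Euclid R n) := [set z | (eucl_dist z.1 z.2 < r)%R].
have mA : measurable A.
  apply: measurable_set_bool; apply: measurable_fun_ltr => //.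
  exact: measurable_eucl_dist.
rewrite (_ : (fun x => _) = m \o xsection A); first exact: measurable_fun_xsection.
apply/funext => x /=; congr (m _).
by apply/seteqP; split => y; rewrite /xsection/= inE.
Qed.

(** The radii are treated in nonincreasing order. At each one, the family is extended to a separated
    family of maximal size, which exists by the bound [K]. A point with that radius left uncovered
    could be added: all earlier radii being at least as large, not being covered is all that
    separation asks. *)
Lemma greedy_cover (R : realType) n (G : Euclid R n -> R -> Prop) K (rs : seq R) :
  pairwise >=%R rs ->
  (forall s, (forall a, a \in s -> G a.1 a.2) -> pairwise (@ball_separated R n) s ->
    (size s <= K)%N) ->
  exists s : seq (Euclid R n * R),
    [/\ forall a, a \in s -> G a.1 a.2 /\ a.2 \in rs,
        pairwise (@ball_separated R n) s &
        forall x q, q \in rs -> G x q ->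
          exists2 a, a \in s & (eucl_dist x a.1 < a.2)%R].
Proof.
move=> + bound; elim/last_ind: rs => [_|rs q IH]; first by exists [::].
rewrite pairwise_rcons => /andP[/allP rsq /IH[s [sG ssep scov]]].
pose ext (s' : seq (Euclid R n * R)) :=
  [/\ forall a, a \in s' -> G a.1 a.2 /\ a.2 \in rcons rs q,
      pairwise (@ball_separated R n) s' & {subset s <= s'}].
pose E k := `[< exists2 s', ext s' & size s' = k >].
have exE : exists k, E k.
  exists (size s); apply/asboolP; exists s => //; split => // a /sG[? ars].
  by rewrite mem_rcons inE ars orbT.
have ubE k : E k -> (k <= K)%N.
  by move=> /asboolP[s' [s'G s'sep _] <-]; apply: bound => // a /s'G[].
case: (ex_maxnP exE ubE) => k /asboolP[s' [s'G s'sep ss'] s'k] kmax.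
exists s'; split=> // x q'; rewrite mem_rcons inE => /predU1P[->|q'rs] xG; last first.
  by have [a /ss' as' xa] := scov x q' q'rs xG; exists a.
apply: contrapT => ncov.
have far a : a \in s' -> (a.2 <= eucl_dist x a.1)%R.
  by move=> as'; rewrite leNgt; apply/negP => xa; apply: ncov; exists a.
have : E k.+1; last by move=> /kmax; rewrite ltnn.
apply/asboolP; exists ((x, q) :: s'); last by rewrite /= s'k.
split.
- move=> a; rewrite inE => /predU1P[->|]; last exact: s'G.
  by rewrite mem_rcons mem_head.
- rewrite pairwise_cons s'sep andbT; apply/allP => a as'.
  rewrite /ball_separated ge_max far// andbT (le_trans _ (far a as'))//=.
  have [_] := s'G a as'; rewrite mem_rcons inE => /predU1P[->//|]; exact: rsq.
- by move=> a /ss' as'; rewrite inE as' orbT.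
Qed.

(** The pointwise bound of [ball_separated_overlap], integrated against [m]. *)
Lemma sum_overlap_le (R : realType) n
    (m : {finite_measure set (Euclid R n) -> \bar R}) (U : set (Euclid R n))
    (s : seq (Euclid R n * R)) : measurable U ->
  pairwise (@ball_separated R n) s ->
  (forall a, a \in s -> eucl_ball a.1 a.2 `<=` U) ->
  \sum_(a <- s) m (eucl_ball a.1 a.2) <= (overlap n)%:R%:E * m U.
Proof.
move=> mU sep sU.
have mI a : measurable_fun setT (fun y : Euclid R n => (\1_(eucl_ball a.1 a.2) y : R)%:E).
  by apply/measurable_EFinP; apply: measurable_indic; exact: measurable_eucl_ball.
rewrite (eq_bigr (fun a => \int[m]_y (\1_(eucl_ball a.1 a.2) y)%:E)); last first.
  by move=> a _; rewrite integral_indic ?setIT//; exact: measurable_eucl_ball.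
rewrite -ge0_integral_sum//.
rewrite -[in leRHS](setIT U) -integral_indic// -ge0_integralZl//; last first.
  by apply/measurable_EFinP; exact: measurable_indic.
apply: ge0_le_integral => //.
- by move=> y _; rewrite sume_ge0.
- exact: emeasurable_sum.
- by apply: emeasurable_funM => //; apply/measurable_EFinP; exact: measurable_indic.
move=> y _; rewrite sumEFin -EFinM lee_fin.
have cE : (\sum_(a <- s) \1_(eucl_ball a.1 a.2) y =
    (count (fun a => eucl_dist y a.1 < a.2)%R s)%:R :> R)%R.
  rewrite -sum1_count natr_sum [RHS]big_mkcond; apply: eq_bigr => a _.
  by rewrite /eucl_ball indic_bool eucl_distC; case: ifP.
rewrite cE indicE; have [yU|yU] := boolP (y \in U).
  by rewrite mulr1 ler_nat ball_separated_overlap.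
rewrite mulr0 lern0 -leqn0 leqNgt -has_count; apply/hasPn => a as_.
apply: contra yU => ya; rewrite inE; apply: (sU a as_).
by rewrite /eucl_ball/= eucl_distC.
Qed.

(** On the balls of a separated covering family, [m1] is less than twice [m2], and their [m2] masses
    add up to at most [overlap n] times that of [U]. To keep the families finite and the sets
    measurable, this is done for the sets [D_ j] that increase to [D]. *)
Lemma besicovitch_weak_type (R : realType) n
    (m1 m2 : {finite_measure set (Euclid R n) -> \bar R}) (D U : set (Euclid R n))
    (r : R) : measurable D -> measurable U ->
  (forall x y, D x -> (eucl_dist x y < r)%R -> U y) ->
  (forall x, D x -> exists2 q : rat, (0 < (ratr q : R) < r)%R &
    m1 (eucl_ball x (ratr q)) < 2%:E * m2 (eucl_ball x (ratr q))) ->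
  m1 D <= (2 * overlap n)%:R%:E * m2 U.
Proof.
move=> mD mU DU Dbad.
(* The lower bound on the mass of the ball limits the size of separated families, as [greedy_cover]
   demands. The strict inequality makes the [m2] mass of a bad ball positive, so every bad ball
   qualifies for large [j]. *)
pose G j (x : Euclid R n) (q : R) := [/\ D x, (q < r)%R,
  m1 (eucl_ball x q) < 2%:E * m2 (eucl_ball x q) &
  (j.+1%:R^-1 : R)%:E <= m2 (eucl_ball x q)].
(* The first [j] codes of rationals. The default value 0, like the nonpositive rationals, is
   harmless: the corresponding ball is empty and fails [G]. *)
pose rats j : seq R := [seq ratr (odflt 0%R (unpickle i)) | i <- iota 0 j].
pose D_ j := \big[setU/set0]_(q <- rats j) [set x | G j x q].
have mG j q : measurable [set x | G j x q].
  have [qr|qr] := ltP q r; last first.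
    rewrite (_ : [set x | _] = set0)//; apply/seteqP; split => // x [_].
    by rewrite ltNge qr.
  rewrite (_ : [set x | _] = D `&`
    [set x | (m1 (eucl_ball x q) < 2%:E * m2 (eucl_ball x q)) &&
             ((j.+1%:R^-1 : R)%:E <= m2 (eucl_ball x q))]).
    apply: measurableI => //; apply: measurable_set_bool; apply: measurable_and.
      apply: measurable_fun_lte; first exact: measurable_fun_eucl_ball.
      by apply: emeasurable_funM => //; exact: measurable_fun_eucl_ball.
    by apply: measurable_fun_lee => //; exact: measurable_fun_eucl_ball.
  apply/seteqP; split => x /=; first by case=> ? _ h1 h2; split=> //; apply/andP.
  by case=> ? /andP[].
have mD_ j : measurable (D_ j) by apply: bigsetU_measurable.
have D_P j x : D_ j x <-> exists2 q, q \in rats j & G j x q.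
  by rewrite /D_ -bigcup_seq; split=> [[q ? ?]|[q ? ?]]; exists q.
have fin2 A : measurable A -> m2 A \is a fin_num by exact: fin_num_measure.
have key j : m1 (D_ j) <= (2 * overlap n)%:R%:E * m2 U.
  have GU x q : G j x q -> eucl_ball x q `<=` U.
    by move=> [Dx qr _ _] y xy; apply: (DU x) => //; exact: lt_trans qr.
  have [M M0 ME] : exists2 M : R, (0 <= M)%R & (overlap n)%:R%:E * m2 U = M%:E.
    exists ((overlap n)%:R * fine (m2 U))%R; first by rewrite mulr_ge0// fine_ge0.
    by rewrite EFinM fineK// fin2.
  have bound s : (forall a, a \in s -> G j a.1 a.2) -> pairwise (@ball_separated R n) s ->
      (size s <= Num.truncn (j.+1%:R * M))%N.
    move=> sG sep; rewrite truncn_ge_nat ?mulr_ge0// mulrC -ler_pdivrMr//.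
    rewrite -lee_fin -ME; apply: le_trans (sum_overlap_le m2 mU sep _); last first.
      by move=> a /sG; exact: GU.
    rewrite (_ : (_ / _)%:E = \sum_(a <- s) (j.+1%:R^-1)%:E); last first.
      by rewrite sumEFin big_const_seq count_predT iter_addr_0 mulr_natl.
    by rewrite big_seq [leRHS]big_seq; apply: lee_sum => a /sG[].
  pose rs := sort >=%R (rats j).
  have rs_sorted : pairwise >=%R rs.
    rewrite -sorted_pairwise; last by move=> ? ? ? h1 h2; exact: le_trans h2 h1.
    by apply: sort_sorted => a b; rewrite le_total.
  have [s [sG sep scov]] := greedy_cover rs_sorted bound.
  have sG' a : a \in s -> G j a.1 a.2 by case/sG.
  have mB (a : Euclid R n * R) : measurable (eucl_ball a.1 a.2) by exact: measurable_eucl_ball.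
  have DB : D_ j `<=` \big[setU/set0]_(a <- s) eucl_ball a.1 a.2.
    move=> x /D_P[q qj xG]; rewrite -bigcup_seq.
    have [||a as_ xa] := scov x q; [by rewrite mem_sort|by []|].
    by exists a => //; rewrite /eucl_ball/= eucl_distC.
  apply: (@le_trans _ _ (m1 (\big[setU/set0]_(a <- s) eucl_ball a.1 a.2))).
    by apply: le_measure => //; rewrite inE//; exact: bigsetU_measurable.
  apply: (@le_trans _ _ (\sum_(a <- s) m1 (eucl_ball a.1 a.2))).
    elim: (s) => [|a s' IH]; first by rewrite !big_nil measure0.
    rewrite !big_cons (le_trans (measureU2 _ _ _))// ?leeD2l//.
    exact: bigsetU_measurable.
  apply: (@le_trans _ _ (\sum_(a <- s) 2%:E * m2 (eucl_ball a.1 a.2))).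
    rewrite big_seq [leRHS]big_seq; apply: lee_sum => a /sG'[_ _ + _].
    exact: ltW.
  rewrite -ge0_sume_distrr// natrM EFinM -muleA lee_pmul2l//.
  by apply: sum_overlap_le => // a /sG'; exact: GU.
have nd : nondecreasing_seq D_.
  move=> i j ij; apply/subsetPset => x /D_P[q qi [? ? ? h]]; apply/D_P; exists q.
    move/mapP: qi => [k]; rewrite mem_iota add0n => /andP[_ ki] ->.
    by apply/map_f; rewrite mem_iota add0n (leq_trans ki).
  split=> //; rewrite (le_trans _ h)// lee_fin lef_pV2 ?posrE// ler_nat ltnS//.
have DE : D = \bigcup_j D_ j.
  apply/seteqP; split => [x Dx|x [j _ /D_P[q _ []]]//].
  have [q /andP[q0 qr] bad] := Dbad x Dx.
  have mB := measurable_eucl_ball x (ratr q).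
  have B0 : (0 < fine (m2 (eucl_ball x (ratr q))))%R.
    rewrite fine_gt0// ltey_eq fin2// andbT lt_neqAle measure_ge0 andbT.
    by apply/eqP => B0; move: bad; rewrite -B0 mule0 ltNge measure_ge0.
  pose j := maxn (pickle q).+1 (Num.truncn (fine (m2 (eucl_ball x (ratr q))))^-1).
  exists j => //; apply/D_P; exists (ratr q).
    apply/mapP; exists (pickle q); last by rewrite pickleK.
    by rewrite mem_iota add0n leq_max leqnn.
  split=> //; rewrite -[leRHS]fineK ?fin2// lee_fin invf_ple ?posrE//.
  apply: ltW; apply: lt_le_trans (truncnS_gt _) _.
  by rewrite ler_nat ltnS leq_max leqnn orbT.
rewrite [in leLHS]DE.
have cv : (m1 \o D_) j @[j --> \oo] --> m1 (\bigcup_j D_ j).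
  by apply: nondecreasing_cvg_mu => //; exact: bigcupT_measurable.
by apply: (cvge_le _ cv); apply: nearW => j; exact: key.
Qed.

(** * Differentiation of mutually singular measures *)

(** An alias of [m], to which a finite-measure structure can be attached from the proof [mfin];
    [measure_as_probability] plays the same part for total mass 1. *)
Definition measure_as_finite d (T : measurableType d) (R : realType)
    (m : {measure set T -> \bar R}) (mfin : fin_num_fun m) : set T -> \bar R := m.

HB.instance Definition _ d (T : measurableType d) (R : realType)
    (m : {measure set T -> \bar R}) (mfin : fin_num_fun m) :=
  Measure.copy (measure_as_finite mfin) m.

HB.instance Definition _ d (T : measurableType d) (R : realType)
    (m : {measure set T -> \bar R}) (mfin : fin_num_fun m) :=
  Measure_isFinite.Build _ _ _ (measure_as_finite mfin) mfin.

Lemma ex_finite_measure d (T : measurableType d) (R : realType)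
    (m : {measure set T -> \bar R}) : fin_num_fun m ->
  exists m' : {finite_measure set T -> \bar R}, forall A, m' A = m A.
Proof. by move=> mfin; exists (measure_as_finite mfin). Qed.

Definition measure_as_probability d (T : measurableType d) (R : realType)
    (m : {measure set T -> \bar R}) (m1 : m setT = 1) : set T -> \bar R := m.

HB.instance Definition _ d (T : measurableType d) (R : realType)
    (m : {measure set T -> \bar R}) (m1 : m setT = 1) :=
  Measure.copy (measure_as_probability m1) m.

HB.instance Definition _ d (T : measurableType d) (R : realType)
    (m : {measure set T -> \bar R}) (m1 : m setT = 1) :=
  Measure_isProbability.Build _ _ _ (measure_as_probability m1) m1.

Lemma ex_probability d (T : measurableType d) (R : realType)
    (m : {measure set T -> \bar R}) : m setT = 1 ->
  exists P : probability T R, forall A, P A = m A.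
Proof. by move=> m1; exists (measure_as_probability m1). Qed.

Lemma ex_measure_bigcup_approx d (T : measurableType d) (R : realType)
    (m : {finite_measure set T -> \bar R}) (F : (set T)^nat) (e : R) :
  (forall k, measurable (F k)) -> nondecreasing_seq F -> (0 < e)%R ->
  exists k, m ((\bigcup_k F k) `\` F k) <= e%:E.
Proof.
move=> mF ndF e0; apply: contrapT => /forallNP H.
have mB : measurable (\bigcup_k F k) by exact: bigcupT_measurable.
pose D k := (\bigcup_k F k) `\` F k.
have mD k : measurable (D k) by exact: measurableD.
have D0 : \bigcap_k D k = set0.
  apply/seteqP; split => // x h; have [[k _ Fkx] _] := h 0%N I.
  by have [_] := h k I; apply.
have cv : (m \o D) k @[k --> \oo] --> m (\bigcap_k D k).
  apply: nonincreasing_cvg_mu => //.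
  - by rewrite -ge0_fin_numE// fin_num_measure.
  - by rewrite D0.
  - by move=> i j ij; apply/subsetPset; apply: setDS; apply/subsetPset; exact: ndF.
have : e%:E <= m (\bigcap_k D k).
  apply: (cvge_ge _ cv); apply: nearW => k /=; rewrite ltW// ltNge.
  by apply/negP; exact: H.
by rewrite D0 measure0 lee_fin leNgt e0.
Qed.

(** * Approximation of Borel sets with a positive gap *)

Section thick_regularity.
Context (R : realType) (n : nat) (m : {finite_measure set (Euclid R n) -> \bar R}).

(* The exchange (E, U) -> (~` U, ~` E) makes the class stable under complement;
   this is why E is not required to be included in B. *)
Definition thick_regular (B : set (Euclid R n)) : Prop :=
  measurable B /\ forall e : R, (0 < e)%R -> exists E U r,
    [/\ measurable E, measurable U, (0 < r)%R,
        forall x y, E x -> (eucl_dist x y < r)%R -> U y &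
        m (B `\` E) <= e%:E /\ m (U `\` B) <= e%:E].

Lemma thick_regular0 : thick_regular set0.
Proof.
split=> // e e0; exists set0, set0, 1%R.
by split=> //; rewrite setD0 measure0 lee_fin ltW.
Qed.

Lemma thick_regularC B : thick_regular B -> thick_regular (~` B).
Proof.
move=> [mB H]; split; first exact: measurableC.
move=> e e0; have [E [U [r [mE mU r0 EU [BE UB]]]]] := H e e0.
exists (~` U), (~` E), r; split=> //; try exact: measurableC.
- by move=> x y Ux xy Ey; apply: Ux; apply: (EU y) => //; rewrite eucl_distC.
- by rewrite !setDE !setCK setIC -setDE setIC -setDE.
Qed.

Lemma thick_regularU A B :
  thick_regular A -> thick_regular B -> thick_regular (A `|` B).
Proof.
move=> [mA HA] [mB HB]; split; first exact: measurableU.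
move=> e e0; have e20 : (0 < e / 2)%R by rewrite divr_gt0.
have [E1 [U1 [r1 [mE1 mU1 r10 EU1 [AE UA]]]]] := HA _ e20.
have [E2 [U2 [r2 [mE2 mU2 r20 EU2 [BE UB]]]]] := HB _ e20.
exists (E1 `|` E2), (U1 `|` U2), (Num.min r1 r2); split.
- exact: measurableU.
- exact: measurableU.
- by rewrite lt_min r10.
- move=> x y [Ex|Ex]; rewrite lt_min => /andP[xy1 xy2].
    by left; exact: (EU1 x).
  by right; exact: (EU2 x).
have ee : e%:E = (e / 2)%:E + (e / 2)%:E by rewrite -EFinD -splitr.
split; rewrite ee.
  apply: (@le_trans _ _ (m ((A `\` E1) `|` (B `\` E2)))).
    apply: le_measure; rewrite ?inE.
    - by apply: measurableD; exact: measurableU.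
    - by apply: measurableU; exact: measurableD.
    - by move=> x [[Ax|Bx] /not_orP[? ?]]; [left|right].
  rewrite (le_trans (measureU2 _ _ _)) ?leeD//; exact: measurableD.
apply: (@le_trans _ _ (m ((U1 `\` A) `|` (U2 `\` B)))).
  apply: le_measure; rewrite ?inE.
  - by apply: measurableD; exact: measurableU.
  - by apply: measurableU; exact: measurableD.
  - by move=> x [[Ax|Bx] /not_orP[? ?]]; [left|right].
rewrite (le_trans (measureU2 _ _ _)) ?leeD//; exact: measurableD.
Qed.

(** The pair chosen for a single [F k] of nearly full measure works for the union, because [U] is
    not asked to contain the approximated set. *)
Lemma thick_regular_nondecr (F : (set (Euclid R n))^nat) :
  (forall k, thick_regular (F k)) -> nondecreasing_seq F ->
  thick_regular (\bigcup_k F k).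
Proof.
move=> HF ndF; have mF k : measurable (F k) by case: (HF k).
split; first exact: bigcupT_measurable.
move=> e e0; have e20 : (0 < e / 2)%R by rewrite divr_gt0.
have [k Hk] := ex_measure_bigcup_approx m mF ndF e20.
have [_ /(_ _ e20)[E [U [r [mE mU r0 EU [FE UF]]]]]] := HF k.
have mB : measurable (\bigcup_k F k) by exact: bigcupT_measurable.
exists E, U, r; split=> //; split.
  have -> : e%:E = (e / 2)%:E + (e / 2)%:E by rewrite -EFinD -splitr.
  apply: (@le_trans _ _ (m (((\bigcup_k F k) `\` F k) `|` (F k `\` E)))).
    apply: le_measure; rewrite ?inE.
    - exact: measurableD.
    - by apply: measurableU; exact: measurableD.
    - by move=> x [Bx Ex]; have [Fx|Fx] := pselect (F k x); [right|left].
  rewrite (le_trans (measureU2 _ _ _)) ?leeD//; exact: measurableD.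
apply: (@le_trans _ _ (m (U `\` F k))).
  apply: le_measure; rewrite ?inE; try exact: measurableD.
  by move=> x [Ux Bx]; split=> // Fx; apply: Bx; exists k.
by rewrite (le_trans UF)// lee_fin; lra.
Qed.

Lemma thick_regular_bigcup (F : (set (Euclid R n))^nat) :
  (forall k, thick_regular (F k)) -> thick_regular (\bigcup_k F k).
Proof.
move=> HF; rewrite -bigcup_bigsetU_bigcup.
apply: thick_regular_nondecr; last first.
  by move=> i j ij; apply/subsetPset; exact: subset_bigsetU.
move=> k; elim: k.+1 => [|j IH]; first by rewrite big_ord0; exact: thick_regular0.
by rewrite big_ord_recr/=; exact: thick_regularU.
Qed.

(** Coordinates are 1-Lipschitz, so the points at height at least 1/(k+1) above [a] keep that
    distance from the complement; the half-space itself serves as [U]. *)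
Lemma thick_regular_halfspace i (a : R) :
  thick_regular [set x : Euclid R n | (a < tnth x i)%R].
Proof.
pose F k := [set x : Euclid R n | (a + k.+1%:R^-1 <= tnth x i)%R].
have mt : measurable_fun setT (fun x : Euclid R n => tnth x i) by exact: measurable_tnth.
have mF k : measurable (F k) by apply: measurable_set_bool; apply: measurable_fun_ler.
have ndF : nondecreasing_seq F.
  move=> k l kl; apply/subsetPset => x; apply: le_trans.
  by rewrite lerD2l lef_pV2 ?posrE// ler_nat ltnS.
have FE : [set x : Euclid R n | (a < tnth x i)%R] = \bigcup_k F k.
  apply/seteqP; split => [x /= ax|x [k _] /=]; last first.
    by apply: lt_le_trans; rewrite ltrDl.
  exists (Num.truncn (tnth x i - a)^-1) => //=.
  rewrite /F/= -lerBrDl invf_ple ?posrE ?subr_gt0//.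
  by apply: ltW; apply: truncnS_gt.
have mB : measurable [set x : Euclid R n | (a < tnth x i)%R].
  by apply: measurable_set_bool; apply: measurable_fun_ltr.
split=> // e e0; have [k Hk] := ex_measure_bigcup_approx m mF ndF e0.
exists (F k), [set x | (a < tnth x i)%R], k.+1%:R^-1%R; split=> //.
- move=> x y; rewrite /F/= => Fx xy.
  have := le_lt_trans (eucl_dist_coord x y i) xy; rewrite ltr_norml => /andP[_].
  by move: (k.+1%:R^-1)%R Fx => q; rewrite /F/=; lra.
- by rewrite setDv measure0 lee_fin (ltW e0) FE.
Qed.

(** The regular sets form a sigma-algebra. For each coordinate, so do the sets of reals with regular
    preimage, and these contain the open rays that generate the Borel sets. *)
Lemma measurable_thick_regular B : measurable B -> thick_regular B.
Proof.
pose S := [set B | thick_regular B].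
have sS : sigma_algebra setT S.
  split; first exact: thick_regular0.
    by move=> A /thick_regularC; rewrite setTD.
  by move=> F HF; exact: thick_regular_bigcup.
move=> mB; apply: (mB S); split=> // A.
rewrite -bigcup_seq => -[i _] /= [Y mY <-]; rewrite setTI.
pose Si := [set Y | thick_regular ((fun x : Euclid R n => tnth x i) @^-1` Y)].
have sSi : sigma_algebra setT Si.
  split; first by rewrite /Si/= preimage_set0; exact: thick_regular0.
    by move=> Z HZ; rewrite /Si/= setTD preimage_setC; exact: thick_regularC.
  by move=> F HF; rewrite /Si/= preimage_bigcup; exact: thick_regular_bigcup.
have : <<s @RGenOInfty.G R >> Y.
  have E := RGenOInfty.measurableE R; rewrite [X in X Y](_ : _ = @measurable _ (measurableTypeR R)); first exact: mY.
  by rewrite E.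
move=> /(_ Si); apply; split=> // _ [a ->]; rewrite /Si/=.
rewrite (_ : _ @^-1` _ = [set x | (a < tnth x i)%R]).
  exact: thick_regular_halfspace.
by apply/seteqP; split => x /=; rewrite in_itv/= andbT.
Qed.

End thick_regularity.

(** Regularity for [m1 + m2] yields [E] carrying most of the [m1] mass of [D], and [U] around [E]
    with small [m2] mass since [m2 D = 0]. The positive gap [r] lets all bad balls of radius below
    [r] centered in [E] stay inside [U], where the weak-type bound applies. *)
Lemma singular_ball_ratio (R : realType) n
    (m1 m2 : {finite_measure set (Euclid R n) -> \bar R}) (D : set (Euclid R n)) :
  measurable D -> m2 D = 0 ->
  (forall x (r : R), D x -> (0 < r)%R -> exists2 q : rat, (0 < (ratr q : R) < r)%R &
    m1 (eucl_ball x (ratr q)) < 2%:E * m2 (eucl_ball x (ratr q))) ->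
  m1 D = 0.
Proof.
move=> mD D0 Dbad; apply/eqP; rewrite eq_le measure_ge0 andbT.
have mE A : measure_add m1 m2 A = m1 A + m2 A by exact: measure_addE.
have [m' m'm] : exists m' : {finite_measure set (Euclid R n) -> \bar R},
    forall A, m' A = measure_add m1 m2 A.
  apply: ex_finite_measure => A mA.
  have h : measure_add m1 m2 A \is a fin_num by rewrite mE fin_numD !fin_num_measure.
  exact: h.
have m'E A : m' A = m1 A + m2 A by rewrite m'm.
apply/lee_addgt0Pr => e e0; rewrite add0e.
(* 1 accounts for the part of [D] outside [E], [2 * overlap n] for the covering inequality, so that
   the errors add up to [e]. *)
pose K : R := (1 + (2 * overlap n)%:R)%R.
have K0 : (0 < K)%R by rewrite ltr_wpDr.
have eK0 : (0 < e / K)%R by rewrite divr_gt0.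
have [_ /(_ _ eK0)[E [U [r [mE' mU r0 EU [DE UD]]]]]] := measurable_thick_regular m' mD.
have h1 : m1 (D `\` E) <= (e / K)%:E.
  by apply: le_trans DE; rewrite m'E leeDl.
have h2 : m2 U <= (e / K)%:E.
  apply: (@le_trans _ _ (m2 (U `\` D) + m2 D)); last first.
    rewrite D0 adde0; apply: le_trans UD; rewrite m'E leeDr//.
  apply: (@le_trans _ _ (m2 ((U `\` D) `|` D))).
    apply: le_measure; rewrite ?inE//; first by apply: measurableU => //; exact: measurableD.
    by move=> x Ux; have [Dx|Dx] := pselect (D x); [right|left].
  by apply: measureU2 => //; exact: measurableD.
have h3 : m1 (D `&` E) <= (2 * overlap n)%:R%:E * m2 U.
  apply: (@besicovitch_weak_type _ _ _ _ _ _ r) => //; first exact: measurableI.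
    by move=> x y [_ Ex]; exact: EU.
  by move=> x [Dx _]; exact: Dbad.
apply: (@le_trans _ _ (m1 (D `\` E) + m1 (D `&` E))).
  apply: (@le_trans _ _ (m1 ((D `\` E) `|` (D `&` E)))).
    apply: le_measure; rewrite ?inE.
    - by [].
    - by apply: measurableU; [exact: measurableD|exact: measurableI].
    - by move=> x Dx; have [Ex|Ex] := pselect (E x); [right|left].
  by apply: measureU2; [exact: measurableD|exact: measurableI].
apply: (@le_trans _ _ ((e / K)%:E + (2 * overlap n)%:R%:E * (e / K)%:E)).
  by apply: leeD => //; apply: (le_trans h3); exact: lee_wpmul2l.
rewrite -EFinM -EFinD lee_fin (_ : (e / K + _)%R = e)//.
by rewrite -[X in (X + _)%R]mul1r -mulrDl -/K mulrC divfK ?gt_eqF.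
Qed.

(** * Bilinear integrals and the Jordan decomposition *)

Section lincomb.
Context (R : realType).

(** Stated through integrals rather than through values on sets, so that Tonelli transfers it at
    once to either factor of a product measure. *)
Definition int_lincomb d (T : measurableType d)
    (a : {measure set T -> \bar R}) (c1 : R) (a1 : {measure set T -> \bar R})
    (c2 : R) (a2 : {measure set T -> \bar R}) : Prop :=
  [/\ (0 <= c1)%R, (0 <= c2)%R &
    forall f, measurable_fun setT f -> (forall x, 0 <= f x) ->
      \int[a]_x f x = c1%:E * \int[a1]_x f x + c2%:E * \int[a2]_x f x].

Lemma int_lincombP d (T : measurableType d) (a a1 a2 : {measure set T -> \bar R})
    (c1 c2 : R) : (0 <= c1)%R -> (0 <= c2)%R ->
  (forall X, measurable X -> a X = c1%:E * a1 X + c2%:E * a2 X) ->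
  int_lincomb a c1 a1 c2 a2.
Proof.
move=> c10 c20 aE; split=> // f mf f0.
transitivity (\int[measure_add (mscale (NngNum c10) a1) (mscale (NngNum c20) a2)]_x f x).
  apply: eq_measure_integral => X mX _; rewrite aE//.
  by apply/esym; exact: measure_addE.
by rewrite ge0_integral_measure_add// !ge0_integral_mscale.
Qed.

Lemma int_lincomb_integral d (T : measurableType d) (a a1 a2 : {measure set T -> \bar R})
    (c1 c2 : R) (f : T -> \bar R) : int_lincomb a c1 a1 c2 a2 ->
  a1.-integrable setT f -> a2.-integrable setT f ->
  a.-integrable setT f /\
  \int[a]_x f x = c1%:E * \int[a1]_x f x + c2%:E * \int[a2]_x f x.
Proof.
move=> [c10 c20 H] i1 i2; have mf := measurable_int _ i1.
have mp : measurable_fun setT f^\+ by exact: measurable_funepos.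
have mn : measurable_fun setT f^\- by exact: measurable_funeneg.
have fin (m : {measure set T -> \bar R}) g : m.-integrable setT g ->
    exists r : R, \int[m]_x g x = r%:E.
  by move=> ig; eexists; rewrite -[LHS]fineK//; exact: integrable_fin_num.
split.
  apply/integrableP; split=> //.
  rewrite H//; last exact: measurableT_comp.
  have [r1 ->] := fin _ _ (integrable_abse i1).
  by have [r2 ->] := fin _ _ (integrable_abse i2); rewrite -!EFinM -EFinD ltry.
rewrite integralE [X in c1%:E * X]integralE [X in c2%:E * X]integralE !H//.
have [p1 ->] := fin _ _ (integrable_funepos measurableT i1).
have [p2 ->] := fin _ _ (integrable_funepos measurableT i2).
have [q1 ->] := fin _ _ (integrable_funeneg measurableT i1).
have [q2 ->] := fin _ _ (integrable_funeneg measurableT i2).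
by rewrite -(EFinB p1) -(EFinB p2) -!EFinM -!EFinD; congr _%:E; ring.
Qed.

Context d (T : measurableType d).
Implicit Types a b : {finite_measure set T -> \bar R}.

Lemma int_lincomb_prodl a a1 a2 b c1 c2 : int_lincomb a c1 a1 c2 a2 ->
  int_lincomb (a \x b) c1 (a1 \x b) c2 (a2 \x b).
Proof.
move=> [c10 c20 H]; split=> // f mf f0.
rewrite !fubini_tonelli1// H//.
- exact: measurable_fun_fubini_tonelli_F.
- by move=> x; apply: integral_ge0.
Qed.

Lemma int_lincomb_prodr a b b1 b2 c1 c2 : int_lincomb b c1 b1 c2 b2 ->
  int_lincomb (a \x b) c1 (a \x b1) c2 (a \x b2).
Proof.
move=> [c10 c20 H]; split=> // f mf f0.
rewrite !fubini_tonelli2// H//.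
- exact: measurable_fun_fubini_tonelli_G.
- by move=> x; apply: integral_ge0.
Qed.

Lemma le_integrable_prod a a' b b' (f : T * T -> \bar R) :
  (forall X, measurable X -> a X <= a' X) -> (forall X, measurable X -> b X <= b' X) ->
  (a' \x b').-integrable setT f -> (a \x b).-integrable setT f.
Proof.
move=> aa bb /integrableP[mf fi]; apply/integrableP; split=> //.
have mf' : measurable_fun setT (fun z => `|f z|) by exact: measurableT_comp.
have f0 z : 0 <= `|f z| by [].
apply: le_lt_trans fi.
rewrite !fubini_tonelli1//.
have mF := measurable_fun_fubini_tonelli_F _ mf' f0.
apply: (@le_trans _ _ (\int[a']_x \int[b]_y `|f (x, y)|)).
  apply: (ge0_le_measure_integral aa); [by []| |exact: mF].
  by move=> x; apply: integral_ge0.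
have mF' := measurable_fun_fubini_tonelli_F (m2 := b') _ mf' f0.
apply: ge0_le_integral; [by []| |exact: mF|exact: mF'|].
  by move=> x _; apply: integral_ge0.
move=> x _; apply: (ge0_le_measure_integral bb) => //.
exact: (measurableT_comp mf' (pair1_measurable x)).
Qed.

Lemma symmetric_integrable a b (f : T * T -> \bar R) :
  (forall x y, f (x, y) = f (y, x)) ->
  (a \x b).-integrable setT f ->
  (b \x a).-integrable setT f /\ \int[b \x a]_z f z = \int[a \x b]_z f z.
Proof.
move=> fC i; have mf := measurable_int _ i.
have E (g : T * T -> \bar R) : (forall x y, g (x, y) = g (y, x)) ->
    measurable_fun setT g -> (forall z, 0 <= g z) ->
    \int[b \x a]_z g z = \int[a \x b]_z g z.
  move=> gC mg g0; rewrite fubini_tonelli1// fubini_tonelli2//.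
  apply: eq_integral => x _; apply: eq_integral => y _; exact: gC.
split.
  apply/integrableP; split=> //; rewrite E//.
  - by move/integrableP: i => [].
  - by move=> x y; rewrite fC.
  - exact: measurableT_comp.
rewrite integralE [RHS]integralE !E//.
- by move=> x y; rewrite !funenegE fC.
- exact: measurable_funeneg.
- by move=> x y; rewrite !funeposE fC.
- exact: measurable_funepos.
Qed.

End lincomb.

Section discrepancy.
Context d (T : measurableType d) (R : realType).
Variables mu nu : probability T R.

Lemma jordan_pos_charge_subE P N (h : hahn_decomposition (charge_sub mu nu) P N) X :
  measurable X -> jordan_pos h X = mu (X `&` P) - nu (X `&` P).
Proof.
move=> mX; rewrite jordan_posE charge.cjordan_posE /crestr0 mem_set//.
Qed.

Lemma jordan_neg_charge_subE P N (h : hahn_decomposition (charge_sub mu nu) P N) X :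
  measurable X -> jordan_neg h X = nu (X `&` N) - mu (X `&` N).
Proof.
move=> mX; rewrite jordan_negE charge.cjordan_negE /crestr0 mem_set//.
have [_ [mN _] _ _] := h.
rewrite /crestr /charge_sub /cadd/= /copp/= oppeB ?fin_num_adde_defr//.
  by rewrite addeC.
by rewrite fin_num_measure//; exact: measurableI.
Qed.

Section jordan_parts.
Variables (P N : set T) (h : hahn_decomposition (charge_sub mu nu) P N).

Let mP : measurable P. Proof. by case: h => -[]. Qed.
Let mN : measurable N. Proof. by case: h => _ []. Qed.

Lemma jordan_pos_le X : measurable X -> jordan_pos h X <= mu X.
Proof.
move=> mX; rewrite jordan_pos_charge_subE//.
apply: (@le_trans _ _ (mu (X `&` P))); last first.
  by apply: le_measure; rewrite ?inE//; exact: measurableI.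
rewrite leeBlDr ?leeDl//.
by rewrite fin_num_measure//; exact: measurableI.
Qed.

Lemma jordan_neg_le X : measurable X -> jordan_neg h X <= nu X.
Proof.
move=> mX; rewrite jordan_neg_charge_subE//.
apply: (@le_trans _ _ (nu (X `&` N))); last first.
  by apply: le_measure; rewrite ?inE//; exact: measurableI.
rewrite leeBlDr ?leeDl//.
by rewrite fin_num_measure//; exact: measurableI.
Qed.

(** [k] is the minimum of the two measures: [mu] on the negative set and [nu] on the positive
    set. *)
Lemma ex_common_part : exists k : {finite_measure set T -> \bar R},
  [/\ forall X, measurable X -> mu X = jordan_pos h X + k X,
      forall X, measurable X -> nu X = jordan_neg h X + k X,
      forall X, measurable X -> k X <= mu X &
      forall X, measurable X -> k X <= nu X].
Proof.
have [posP negN PNT PN0] := h.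
have finI (m : probability T R) A B : measurable A -> measurable B -> m (A `&` B) \is a fin_num.
  by move=> mA mB; rewrite fin_num_measure//; exact: measurableI.
have kE X : measure_add (mrestr mu mN) (mrestr nu mP) X = mu (X `&` N) + nu (X `&` P).
  exact: measure_addE.
have [k kk] : exists k : {finite_measure set T -> \bar R},
    forall X, k X = measure_add (mrestr mu mN) (mrestr nu mP) X.
  apply: ex_finite_measure => X mX.
  have H : measure_add (mrestr mu mN) (mrestr nu mP) X \is a fin_num.
    by rewrite kE fin_numD !finI.
  exact: H.
have split_ (m : probability T R) X : measurable X -> m X = m (X `&` P) + m (X `&` N).
  move=> mX; rewrite -{1}(setIT X) -PNT setIUr measureU//; try exact: measurableI.
  by rewrite setIACA PN0 setI0.
have posX X : measurable X -> 0 <= mu (X `&` P) - nu (X `&` P).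
  by move=> mX; rewrite -(jordan_pos_charge_subE h mX) measure_ge0.
have negX X : measurable X -> 0 <= nu (X `&` N) - mu (X `&` N).
  by move=> mX; rewrite -(jordan_neg_charge_subE h mX) measure_ge0.
exists k; split => X mX; rewrite kk kE ?(split_ mu X mX) ?(split_ nu X mX).
- rewrite jordan_pos_charge_subE// -[RHS]addeA (addeC (- _)) -addeA.
  by rewrite subee ?finI// adde0 addeC.
- rewrite jordan_neg_charge_subE// addeA subeK ?finI//.
  by rewrite addeC.
- rewrite addeC leeD2r// -sube_ge0 ?finI//; exact: posX.
- rewrite addeC leeD2l// -sube_ge0 ?finI//; exact: negX.
Qed.

End jordan_parts.

Lemma charge_parts_jordan : exists P N (h : hahn_decomposition (charge_sub mu nu) P N),
  charge_pos (charge_sub mu nu) = jordan_pos h /\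
  charge_neg (charge_sub mu nu) = jordan_neg h.
Proof. by do 3 eexists; split. Qed.

End discrepancy.

Lemma measurable_coulomb (R : realType) n : (0 < n)%N ->
  measurable_fun setT (@coulomb R n).
Proof.
move=> n0; rewrite (_ : @coulomb R n = fun z => coul n (eucl_dist z.1 z.2)); last first.
  by apply/funext => z; exact: coulombE.
apply: measurable_coul => //.
  exact: measurable_eucl_dist.
by move=> z; exact: eucl_dist_ge0.
Qed.

Lemma coulombC (R : realType) n (x y : Euclid R n) : coulomb (x, y) = coulomb (y, x).
Proof. by rewrite !coulombE/= eucl_distC. Qed.

(** The discrepancy is defined through the Jordan parts. Adding the common part [k] to both turns it
    into the quadratic expression in [rho] and [nu]; the terms with [k] cancel, being finite by
    domination by [rho] or [nu]. *)
Lemma discrepancyE (R : realType) n (rho nu : probability (Euclid R n) R) (a b c : R) :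
  (rho \x rho).-integrable setT (@coulomb R n) ->
  (rho \x nu).-integrable setT (@coulomb R n) ->
  (nu \x nu).-integrable setT (@coulomb R n) ->
  \int[rho \x rho]_z coulomb z = a%:E ->
  \int[rho \x nu]_z coulomb z = b%:E ->
  \int[nu \x nu]_z coulomb z = c%:E ->
  coulomb_discrepancy nu rho = (a / 2 - b + c / 2)%:E.
Proof.
move=> irr irn inn aE bE cE.
have [P [N [h [pE mE]]]] := charge_parts_jordan rho nu.
have [k [rE nE kr kn]] := ex_common_part h.
have [inr _] := symmetric_integrable (@coulombC R n) irn.
have pr := @jordan_pos_le _ _ _ _ _ _ _ h; have mn := @jordan_neg_le _ _ _ _ _ _ _ h.
set p : {finite_measure set (Euclid R n) -> \bar R} := jordan_pos h in pE rE pr *.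
set m : {finite_measure set (Euclid R n) -> \bar R} := jordan_neg h in mE nE mn *.
have ipp := le_integrable_prod pr pr irr.
have ipm := le_integrable_prod pr mn irn.
have imp := le_integrable_prod mn pr inr.
have imm := le_integrable_prod mn mn inn.
have ipk := le_integrable_prod pr kr irr.
have ikp := le_integrable_prod kr pr irr.
have ikk := le_integrable_prod kr kr irr.
have imk := le_integrable_prod mn kn inn.
have ikm := le_integrable_prod kn mn inn.
have ipr := le_integrable_prod pr (fun X _ => lexx (rho X)) irr.
have ikr := le_integrable_prod kr (fun X _ => lexx (rho X)) irr.
have ipn := le_integrable_prod pr (fun X _ => lexx (nu X)) irn.
have ikn := le_integrable_prod kn (fun X _ => lexx (nu X)) inn.
have imn := le_integrable_prod mn (fun X _ => lexx (nu X)) inn.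
have Lr : int_lincomb rho 1%R p 1%R k.
  by apply: int_lincombP => // X mX; rewrite !mul1e; exact: rE.
have Ln : int_lincomb nu 1%R m 1%R k.
  by apply: int_lincombP => // X mX; rewrite !mul1e; exact: nE.
have fin (m' : {measure set (Euclid R n * Euclid R n) -> \bar R}) :
    m'.-integrable setT (@coulomb R n) ->
    exists r : R, \int[m']_z coulomb z = r%:E.
  move=> ig; exists (fine (\int[m']_z coulomb z)).
  by apply/esym/fineK; exact: integrable_fin_num.
have [_ r1] := int_lincomb_integral (int_lincomb_prodl rho Lr) ipr ikr.
have [_ r2] := int_lincomb_integral (int_lincomb_prodr p Lr) ipp ipk.
have [_ r3] := int_lincomb_integral (int_lincomb_prodr k Lr) ikp ikk.
have [_ r4] := int_lincomb_integral (int_lincomb_prodl nu Lr) ipn ikn.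
have [_ r5] := int_lincomb_integral (int_lincomb_prodr p Ln) ipm ipk.
have [_ r6] := int_lincomb_integral (int_lincomb_prodr k Ln) ikm ikk.
have [_ r7] := int_lincomb_integral (int_lincomb_prodl nu Ln) imn ikn.
have [_ r8] := int_lincomb_integral (int_lincomb_prodr m Ln) imm imk.
have [_ s1] := symmetric_integrable (@coulombC R n) ipk.
have [_ s2] := symmetric_integrable (@coulombC R n) imk.
have [_ s3] := symmetric_integrable (@coulombC R n) ipm.
have [vpp Epp] := fin _ ipp; have [vpm Epm] := fin _ ipm.
have [vmm Emm] := fin _ imm; have [vpk Epk] := fin _ ipk.
have [vmk Emk] := fin _ imk; have [vkk Ekk] := fin _ ikk.
rewrite Epk in s1; rewrite Emk in s2; rewrite Epm in s3.
move: r1; rewrite r2 r3 Epp Epk s1 Ekk aE !mul1e -!EFinD => -[r1].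
move: r4; rewrite r5 r6 Epm Epk s2 Ekk bE !mul1e -!EFinD => -[r4].
move: r7; rewrite r6 r8 Emm Emk s2 Ekk cE !mul1e -!EFinD => -[r7].
rewrite /coulomb_discrepancy asboolT; last first.
  by rewrite /charge_integrable2 pE mE; split.
rewrite /charge_integral2 pE mE Epp Epm s3 Emm -!EFinB -!EFinD -!EFinM.
by congr _%:E; clear -r1 r4 r7; lra.
Qed.

(** Finiteness of the discrepancy gives integrability for the product of the two Jordan parts. The
    other pieces of [mu \x nu] contain the common part, hence are dominated by [mu \x mu] or by
    [nu \x nu]. *)
Lemma integrable_cross (R : realType) n (mu nu : probability (Euclid R n) R) :
  (0 < n)%N -> finite_coulomb_energy mu -> finite_coulomb_energy nu ->
  coulomb_discrepancy nu mu < +oo ->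
  (mu \x nu).-integrable setT (@coulomb R n).
Proof.
move=> n0 imm inn; rewrite /coulomb_discrepancy; case: asboolP => // -[_ + _ _] _.
have [P [N [h [-> ->]]]] := charge_parts_jordan mu nu => ipm.
have [k [mE nE km kn]] := ex_common_part h.
have pr := @jordan_pos_le _ _ _ _ _ _ _ h.
have Lm : int_lincomb mu 1%R (jordan_pos h) 1%R k.
  by apply: int_lincombP => // X mX; rewrite !mul1e; exact: mE.
have Ln : int_lincomb nu 1%R (jordan_neg h) 1%R k.
  by apply: int_lincombP => // X mX; rewrite !mul1e; exact: nE.
have ipk := le_integrable_prod pr km imm.
have ikn := le_integrable_prod kn (fun X _ => lexx (nu X)) inn.
have [ipn _] := int_lincomb_integral (int_lincomb_prodr (jordan_pos h) Ln) ipm ipk.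
by have [] := int_lincomb_integral (int_lincomb_prodl nu Lm) ipn ikn.
Qed.

(** * Energy of a displaced measure *)

Lemma add_eq_le_norm (R : realDomainType) (k a b c e : R) : (0 <= k)%R ->
  (k * a + b = k * c + e -> b <= k * (c + `|a|) + `|e|)%R.
Proof.
move=> k0 abE; have -> : b = (k * c + e - k * a)%R by rewrite -abE; ring.
rewrite mulrDr -addrA -addrA lerD2l addrC lerD ?ler_norm//.
by rewrite -mulrN ler_wpM2l// -normrN ler_norm.
Qed.

Lemma heat_timeE (R : realType) n (t r : R) :
  heat_time n t r =
  \int[lebesgue_measure]_v (heat n v r * \1_(`]0%R, t]) v)%:E.
Proof.
rewrite /heat_time integral_mkcond; apply: eq_integral => v _.
by rewrite patchE indicE; case: ifP => /= _; rewrite ?mulr1 ?mulr0.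
Qed.

Lemma measurable_heat_indic (R : realType) n d (T : measurableType d) (t : R) (f : T -> R) :
  measurable_fun setT f -> measurable_fun setT (fun z : T * measurableTypeR R =>
    (heat n z.2 (f z.1) * \1_(`]0%R, t]) z.2)%:E).
Proof.
move=> mf; apply/measurable_EFinP; apply: measurable_funM.
  by apply: measurable_heat => //; exact: (measurableT_comp mf measurable_fst).
have mi : measurable_fun setT (\1_(`]0%R, t]) : measurableTypeR R -> R).
  exact: measurable_indic.
exact: (measurableT_comp mi measurable_snd).
Qed.

Lemma measurable_heat_time (R : realType) n d (T : measurableType d) (t : R) (f : T -> R) :
  measurable_fun setT f -> measurable_fun setT (fun x => heat_time n t (f x)).
Proof.
move=> mf; under eq_fun do rewrite heat_timeE.
have h0 (z : T * measurableTypeR R) :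
    0 <= (heat n z.2 (f z.1) * \1_(`]0%R, t]) z.2)%:E.
  by rewrite lee_fin mulr_ge0 ?heat_ge0.
exact: (measurable_fun_fubini_tonelli_F _ (measurable_heat_indic n t mf) h0).
Qed.

Section displacement.
Context (R : realType) (n : nat) (n0 : (0 < n)%N).
Variables (S : set (Euclid R n)) (mS : measurable S).

(** [w] is a pair of a point and a noise; only points of [S] are moved. The image of [mu \x p] is
    the measure toward which [mu] is perturbed. *)
Definition displace (w : Euclid R n * Euclid R n) : Euclid R n :=
  if w.1 \in S then tadd w.1 w.2 else w.1.

Lemma measurable_mem_fun d (T : measurableType d) (f : T -> Euclid R n) :
  measurable_fun setT f -> measurable_fun setT (fun x => f x \in S).
Proof.
move=> mf; apply: (@measurable_fun_bool _ _ _ _ true).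
rewrite (_ : (fun x => f x \in S) @^-1` _ = f @^-1` S); first exact: mf.
by apply/seteqP; split => x /=; [exact: set_mem|exact: mem_set].
Qed.

Lemma measurable_displace d (T : measurableType d) (f g : T -> Euclid R n) :
  measurable_fun setT f -> measurable_fun setT g ->
  measurable_fun setT (fun x => displace (f x, g x)).
Proof.
move=> mf mg; apply: measurable_fun_ifT => //.
- exact: measurable_mem_fun.
- exact: measurable_tadd.
Qed.

Variables (p mu rho : probability (Euclid R n) R).
Hypothesis rhoE : forall g : Euclid R n -> \bar R, measurable_fun setT g ->
  (forall x, 0 <= g x) -> \int[rho]_x g x = \int[mu \x p]_w g (displace w).

Lemma ge0_integral_displaced (m : {finite_measure set (Euclid R n) -> \bar R})
    (g : Euclid R n * Euclid R n -> \bar R) :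
  measurable_fun setT g -> (forall w, 0 <= g w) ->
  measurable_fun setT (fun w => \int[p]_z g (displace (w.1, z), w.2)) /\
  \int[rho \x m]_w g w = \int[mu \x m]_w \int[p]_z g (displace (w.1, z), w.2).
Proof.
move=> mg g0.
have m1 : measurable_fun setT (fun w : (Euclid R n * Euclid R n) * Euclid R n =>
    g (displace (w.1.1, w.2), w.1.2)).
  apply: (measurableT_comp mg); apply: measurable_fun_pair => /=.
    apply: measurable_displace => //; exact: (measurableT_comp measurable_fst).
  exact: (measurableT_comp measurable_snd).
have mF : measurable_fun setT (fun w => \int[p]_z g (displace (w.1, z), w.2)).
  exact: (measurable_fun_fubini_tonelli_F _ m1).
split=> //; rewrite fubini_tonelli2//.
rewrite [RHS]fubini_tonelli2//; last by move=> w; exact: integral_ge0.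
apply: eq_integral => y _; rewrite /fubini_G rhoE; last 2 first.
- exact: (measurableT_comp mg (pair2_measurable y)).
- by move=> x; exact: g0.
rewrite fubini_tonelli1//.
apply: (measurableT_comp mg); apply: measurable_fun_pair => //=.
by apply: (@eq_measurable_fun _ _ _ _ _ (fun w => displace (w.1, w.2)));
  [move=> [? ?]|apply: measurable_displace].
Qed.

Variable t : R.
Hypothesis t0 : (0 < t)%R.

(** k_t restricted to a first point in [S]: the interaction lost when the first point alone is
    displaced, hence the asymmetry. *)
Definition heat_kernel (w : Euclid R n * Euclid R n) : \bar R :=
  if w.1 \in S then heat_time n t (eucl_dist w.1 w.2) else 0.

Lemma heat_kernel_ge0 w : 0 <= heat_kernel w.
Proof.
rewrite /heat_kernel; case: ifP => // _.
by apply: integral_ge0 => v _; rewrite lee_fin heat_ge0.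
Qed.

Variables (E C : R).
Hypothesis HEC : forall w : Euclid R n,
  [/\ p.-integrable setT (fun z => coul n (enorm (tadd w z))),
      heat_const R n * \int[p]_z coul n (enorm (tadd w z)) + heat_time n t (enorm w) =
      heat_const R n * coul n (enorm w) + E%:E &
      \int[p]_z `|coul n (enorm (tadd w z))| <= `|coul n (enorm w)| + C%:E].

Lemma measurable_heat_kernel : measurable_fun setT heat_kernel.
Proof.
apply: measurable_fun_ifT => //; first exact: measurable_mem_fun.
by apply: measurable_heat_time; exact: measurable_eucl_dist.
Qed.

(** [smooth_coul] integrated over both points. The last term is the same for every probability [m],
    which makes it disappear when [m = mu] and [m = nu] are compared. *)
Lemma displaced_coulomb (m : probability (Euclid R n) R) :
  (mu \x m).-integrable setT (@coulomb R n) ->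
  [/\ (rho \x m).-integrable setT (@coulomb R n),
      (mu \x m).-integrable setT heat_kernel &
      heat_const R n * \int[rho \x m]_w coulomb w + \int[mu \x m]_w heat_kernel w =
      heat_const R n * \int[mu \x m]_w coulomb w + E%:E * mu S].
Proof.
move=> ig; have mG := @measurable_coulomb R n n0.
have [ma aE] := ge0_integral_displaced m (measurable_funepos mG) (funepos_ge0 _).
have [mb bE] := ge0_integral_displaced m (measurable_funeneg mG) (funeneg_ge0 _).
have mA : measurable_fun setT (fun w => `|@coulomb R n w|) by exact: measurableT_comp.
have [mc cE] := ge0_integral_displaced m mA (fun w => abse_ge0 _).
have dE x z y : x \in S -> coulomb (displace (x, z), y) = coul n (enorm (tadd (tsub x y) z)).
  by move=> xS; rewrite coulombE /displace/= xS eucl_distE tsub_tadd.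
have dE' x z y : x \notin S -> coulomb (displace (x, z), y) = coulomb (x, y).
  by move=> /negbTE xS; rewrite /displace/= xS.
have S0 : 0 <= mu S by [].
have cle w : \int[p]_z `|coulomb (displace (w.1, z), w.2)| <=
    `|coulomb w| + `|C|%:E.
  case: w => x y /=; have [xS|xS] := boolP (x \in S).
    under eq_integral do rewrite dE//.
    have [_ _ /le_trans] := HEC (tsub x y); apply.
    by rewrite coulombE/= eucl_distE; apply: leeD => //; rewrite lee_fin ler_norm.
  under eq_integral do rewrite dE'//.
  by rewrite integral_prob_cst// leeDl.
have icst (c : R) : (mu \x m).-integrable setT (fun=> c%:E).
  apply/integrableP; split => //; rewrite /= integral_cst//.
  by rewrite /= -[X in _ * X]/((mu \x m)%E setT) probability_setT mule1 ltry.
have ic : (mu \x m).-integrable setT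
    (fun w => \int[p]_z `|coulomb (displace (w.1, z), w.2)|).
  apply: (@le_integrable _ _ _ (mu \x m)%E setT measurableT _
    (fun w => `|coulomb w| + `|C|%:E)) => //.
    by move=> w _; rewrite gee0_abs ?integral_ge0// gee0_abs ?adde_ge0.
  by apply: integrableD; [exact: measurableT|exact: integrable_abse|exact: icst].
have cz w z : `|@coulomb R n (displace (w.1, z), w.2)| =
    (@coulomb R n)^\+ (displace (w.1, z), w.2) + (@coulomb R n)^\- (displace (w.1, z), w.2).
  exact: (congr1 (@^~ _) (fune_abse (@coulomb R n))).
have irho : (rho \x m).-integrable setT (@coulomb R n).
  apply/integrableP; split=> //; rewrite cE.
  have /integrableP[_] := ic; apply: le_lt_trans.
  apply: ge0_le_integral => //; [by move=> *; exact: integral_ge0| |].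
    exact: measurableT_comp.
  by move=> w _; rewrite gee0_abs// integral_ge0.
have mD (x y : Euclid R n) : measurable_fun setT (fun z : Euclid R n => (displace (x, z), y)).
  have m1 : measurable_fun setT (fun z : Euclid R n => displace (x, z)).
    exact: measurable_displace.
  exact: (measurable_fun_pair m1 (measurable_cst y)).
have ipos : (mu \x m).-integrable setT
    (fun w => \int[p]_z ((@coulomb R n)^\+ (displace (w.1, z), w.2))).
  apply: le_integrable ic => // w _.
  rewrite !gee0_abs; [|by apply: integral_ge0|by apply: integral_ge0].
  apply: ge0_le_integral => //.
  - exact: (measurableT_comp (measurable_funepos mG) (mD w.1 w.2)).
  - exact: (measurableT_comp mA (mD w.1 w.2)).
  - by move=> z _; rewrite cz leeDl.
have ineg : (mu \x m).-integrable setT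
    (fun w => \int[p]_z ((@coulomb R n)^\- (displace (w.1, z), w.2))).
  apply: le_integrable ic => // w _.
  rewrite !gee0_abs; [|by apply: integral_ge0|by apply: integral_ge0].
  apply: ge0_le_integral => //.
  - exact: (measurableT_comp (measurable_funeneg mG) (mD w.1 w.2)).
  - exact: (measurableT_comp mA (mD w.1 w.2)).
  - by move=> z _; rewrite cz leeDr.
have [k k0 kE] := heat_constE R n0.
have pw w : k%:E * (\int[p]_z coulomb (displace (w.1, z), w.2)) + heat_kernel w =
    k%:E * coulomb w + (E * \1_S w.1)%:E.
  case: w => x y; rewrite /heat_kernel indicE/=; have [xS|xS] := boolP (x \in S).
    under eq_integral do rewrite dE//.
    by have [_ + _] := HEC (tsub x y); rewrite kE mulr1 coulombE/= eucl_distE => ->.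
  under eq_integral do rewrite dE'//.
  by rewrite integral_prob_cst mulr0 !adde0.
(* Integrability of [heat_kernel] is forced by the smoothing identity, which bounds it by the
   kernels before and after displacement; where the Coulomb kernel is infinite the bound is
   trivial. *)
have hle w : heat_kernel w <= k%:E * (`|coulomb w| +
    \int[p]_z `|coulomb (displace (w.1, z), w.2)|) + `|E|%:E.
  have := pw w; rewrite /heat_kernel; have [xS E1|xS _] := boolP (w.1 \in S); last first.
    by rewrite adde_ge0 ?mule_ge0 ?lee_fin ?(ltW k0)// adde_ge0// integral_ge0.
  have ip : p.-integrable setT (fun z => @coulomb R n (displace (w.1, z), w.2)).
    have [ip _ _] := HEC (tsub w.1 w.2); apply: eq_integrable ip => // ? _.
    by case: w xS {E1} => x y xS; rewrite dE.
  have := @le_abse_integral _ _ _ p _ _ measurableT (measurable_int _ ip).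
  have : \int[p]_z coulomb (displace (w.1, z), w.2) \is a fin_num.
    exact: integrable_fin_num.
  move: E1; rewrite indicE xS mulr1.
  case: (\int[p]_z coulomb (displace (w.1, z), w.2)) => // r E1 _ rle.
  have : heat_time n t (eucl_dist w.1 w.2) <= k%:E * (coulomb w + `|r%:E|) + `|E|%:E.
    move: E1; case: (coulomb w) => [g| |]; case: (heat_time _ _ _) => [h| |] //=.
      by rewrite -!EFinM -!EFinD lee_fin => -[]; exact: add_eq_le_norm (ltW k0).
    all: rewrite -?EFinM/= ?addye ?addNye ?gt0_muley ?gt0_muleNy ?lte_fin//= ?leey ?leNye.
  move/le_trans; apply; rewrite leeD2r// lee_pmul2l// leeD//.
  by rewrite lee_abs.
have ihk : (mu \x m).-integrable setT heat_kernel.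
  apply: (@le_integrable _ _ _ (mu \x m)%E setT measurableT _ (fun w =>
    k%:E * (`|coulomb w| + \int[p]_z `|coulomb (displace (w.1, z), w.2)|) + `|E|%:E)) => //.
  - exact: measurable_heat_kernel.
  - move=> w _; rewrite gee0_abs ?heat_kernel_ge0// gee0_abs//.
    exact: le_trans (heat_kernel_ge0 w) (hle w).
  - apply: integrableD; [exact: measurableT| |exact: icst].
    apply: integrableZl; first exact: measurableT.
    by apply: integrableD; [exact: measurableT|exact: integrable_abse|].
split=> //.
have dec : (fun w => \int[p]_z coulomb (displace (w.1, z), w.2)) =
    ((fun w => \int[p]_z ((@coulomb R n)^\+ (displace (w.1, z), w.2))) \-
     (fun w => \int[p]_z ((@coulomb R n)^\- (displace (w.1, z), w.2)))).
  apply/funext => w; rewrite integralE; congr (_ - _); apply: eq_integral => z _.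
    by rewrite !funeposE.
  by rewrite !funenegE.
have -> : \int[rho \x m]_w coulomb w =
    \int[mu \x m]_w \int[p]_z coulomb (displace (w.1, z), w.2).
  rewrite dec integralB; [|exact: measurableT|exact: ipos|exact: ineg].
  by rewrite [LHS]integralE aE bE.
have iI : (mu \x m).-integrable setT
    (fun w => \int[p]_z coulomb (displace (w.1, z), w.2)).
  by rewrite dec; exact: (integrableB measurableT ipos ineg).
have iS c : (mu \x m).-integrable setT (fun w => (c * \1_S w.1)%:E).
  apply: le_integrable (icst c) => //.
    apply/measurable_EFinP; apply: measurable_funM => //.
    have mi : measurable_fun setT (\1_S : Euclid R n -> R) by exact: measurable_indic.
    exact: (measurableT_comp mi measurable_fst).
  move=> ? _; rewrite lee_fin normrM ler_piMr// indicE.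
  by case: (_ \in _); rewrite ?normr1 ?normr0.
rewrite kE -!integralZl// -integralD//; last exact: integrableZl.
under eq_integral do rewrite pw.
rewrite integralD//; last exact: integrableZl.
congr (_ + _).
under eq_integral do rewrite EFinM.
rewrite integralZl//; last first.
  by have := iS 1%R; under [X in _.-integrable _ X]eq_fun do rewrite mul1r.
congr (_ * _); rewrite (_ : (fun w => _) = fun w => (\1_(S `*` setT) w)%:E); last first.
  by apply/funext => w; rewrite !indicE in_setX in_setT andbT.
rewrite integral_indic ?setIT; [|exact: measurableT|exact: measurableX].
rewrite /= product_measure1E//.
have m1 : m setT = 1 by exact: probability_setT.
by rewrite [X in _ * X]m1 mule1.
Qed.

End displacement.

(** * First variation at a critical point *)

Lemma ex_mixture d (T : measurableType d) (R : realType) (P Q : probability T R)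
    (e : R) : (0 <= e <= 1)%R ->
  exists M : probability T R, forall X, M X = (1 - e)%:E * P X + e%:E * Q X.
Proof.
move=> /andP[e0 e1]; have e1' : (0 <= 1 - e)%R by rewrite subr_ge0.
pose m : {measure set T -> \bar R} :=
  measure_add (mscale (NngNum e1') P) (mscale (NngNum e0) Q).
have mE X : m X = (1 - e)%:E * P X + e%:E * Q X by exact: measure_addE.
have [|M ME] := @ex_probability _ _ _ m; last by exists M => X; rewrite ME mE.
by rewrite mE !probability_setT !mule1 -EFinD subrK.
Qed.

(** * Transport cost of a mixture *)

Section wasserstein.
Context (R : realType) (n : nat).
Implicit Types mu rho p : probability (Euclid R n) R.

Lemma wasserstein2_sqr_ge0 mu rho : 0 <= wasserstein2 mu rho ^+ 2.
Proof. by rewrite expe2 mule_ge0// poweR_ge0. Qed.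

Lemma wasserstein2_sqr_le mu rho (pi : probability _ R) (x : R) :
  couplings mu rho pi ->
  \int[pi]_z ((eucl_dist z.1 z.2) ^+ 2)%R%:E <= x%:E ->
  wasserstein2 mu rho ^+ 2 <= x%:E.
Proof.
move=> cpl pix; rewrite /wasserstein2.
set I := ereal_inf _.
have Ix : I <= x%:E.
  by apply: le_trans pix; apply: ereal_inf_lbound; exists pi.
have I0 : 0 <= I.
  apply: le_ereal_inf_tmp => _ [q _ <-]; apply: integral_ge0 => z _.
  by rewrite lee_fin sqr_ge0.
move: I0 Ix; case: I => // i; rewrite !lee_fin => i0 ix.
by rewrite -expr2 powR12_sqrt// sqr_sqrtr.
Qed.

(** The coupling keeps a fraction 1 - e on the diagonal, at no cost, and sends a fraction e from [x]
    to its displacement. This makes the squared distance linear in [e]. *)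
Lemma wasserstein2_sqr_mixture_le (S : set (Euclid R n)) mu p rho
    (rhoe : probability (Euclid R n) R) (e M : R) :
  measurable S -> (0 <= e <= 1)%R ->
  (forall X, rho X = (mu \x p) (displace S @^-1` X)) ->
  (forall X, rhoe X = (1 - e)%:E * mu X + e%:E * rho X) ->
  \int[p]_z (sqnorm z)%:E <= M%:E ->
  wasserstein2 mu rhoe ^+ 2 <= e%:E * (M%:E * mu S).
Proof.
move=> mS e01 rhoE rhoeE pM; have [e0 e1] := andP e01.
have mdiag : measurable_fun setT (fun x : Euclid R n => (x, x)).
  exact: measurable_fun_pair.
have mdis : measurable_fun setT (fun w => (w.1, displace S w)).
  apply: measurable_fun_pair => //.
  apply: (@eq_measurable_fun _ _ _ _ _ (fun w => displace S (w.1, w.2))); first by move=> [].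
  exact: measurable_displace.
have [Q0 Q0E Q0i] := ex_pushforward mu mdiag.
have [Q1 Q1E Q1i] := ex_pushforward (mu \x p)%E mdis.
have [pi piE] := ex_mixture Q0 Q1 e01.
have msq : measurable_fun setT (fun z : Euclid R n * Euclid R n =>
    ((eucl_dist z.1 z.2) ^+ 2)%R%:E).
  apply/measurable_EFinP; apply: measurable_funX; exact: measurable_eucl_dist.
have sq0 (z : Euclid R n * Euclid R n) : 0 <= ((eucl_dist z.1 z.2) ^+ 2)%R%:E.
  by rewrite lee_fin sqr_ge0.
have L : int_lincomb pi (1 - e)%R Q0 e Q1.
  by apply: int_lincombP => [||X _]; rewrite ?subr_ge0//; exact: piE.
have muS : (M%:E * mu S) = (M * fine (mu S))%:E by rewrite EFinM fineK// fin_num_measure.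
rewrite muS -EFinM; apply: (@wasserstein2_sqr_le _ _ pi).
  move=> B mB; split.
    rewrite piE Q0E Q1E (_ : _ @^-1` _ = B); last by apply/seteqP; split=> x //= [].
    rewrite (_ : _ @^-1` _ = B `*` setT); last first.
      by apply/seteqP; split=> -[x y] //= [].
    rewrite /= product_measure1E//.
    have p1 : p setT = 1 by exact: probability_setT.
    by rewrite [X in mu B * X]p1 mule1 -ge0_muleDl ?lee_fin ?subr_ge0// -EFinD subrK mul1e.
  rewrite piE rhoeE Q0E Q1E rhoE; congr (_ * mu _ + _ * _).
    by apply/seteqP; split=> x //= [].
  by congr (product_measure1 _ _ _); apply/seteqP; split=> -[x y] //= [].
have [_ _ ->] := L; [|exact: msq|exact: sq0].
rewrite Q0i// Q1i//.
rewrite (_ : (fun x => _) = cst 0) ?integral0 ?mule0 ?add0e; last first.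
  by apply/funext => x /=; rewrite sqr_eucl_dist big1// => i _; rewrite subrr expr0n.
rewrite EFinM -muS lee_wpmul2l// ?lee_fin//.
rewrite fubini_tonelli1//; last first.
  exact: (measurableT_comp msq mdis).
have dE x z : ((eucl_dist x (displace S (x, z))) ^+ 2 = \1_S x * sqnorm z)%R.
  rewrite sqr_eucl_dist /displace/= indicE; case: ifPn => xS.
    rewrite mul1r; apply: eq_bigr => i _.
    by rewrite tnth_mktuple opprD addNKr sqrrN.
  by rewrite mul0r big1// => i _; rewrite subrr expr0n.
have msn : measurable_fun setT (fun z : Euclid R n => (sqnorm z)%:E).
  by apply/measurable_EFinP; exact: measurable_sqnorm.
apply: (@le_trans _ _ (\int[mu]_x (M%:E * (\1_S x)%:E))).
  apply: ge0_le_integral => //.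
  - by move=> x _; apply: integral_ge0 => z _; exact: sq0.
  - apply: measurable_fun_fubini_tonelli_F; first exact: (measurableT_comp msq mdis).
    by move=> z; exact: sq0.
  - by apply: measurable_funeM; apply/measurable_EFinP; exact: measurable_indic.
  - move=> x _; rewrite /fubini_F/=; under eq_integral do rewrite dE EFinM.
    rewrite ge0_integralZl//; last by move=> z _; rewrite lee_fin sqnorm_ge0.
    by rewrite muleC lee_wpmul2r.
rewrite ge0_integralZl//; last 2 first.
  by apply/measurable_EFinP; exact: measurable_indic.
  by rewrite -[0]/(0%R%:E); apply: le_trans pM; apply: integral_ge0 => z _; rewrite lee_fin sqnorm_ge0.
by rewrite integral_indic ?setIT.
Qed.

End wasserstein.

Lemma first_order_ge0 (R : realFieldType) (a b : R) :
  (forall e : R, 0 < e <= 1 -> 0 <= e * a + e ^+ 2 * b)%R -> (0 <= a)%R.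
Proof.
move=> h; rewrite leNgt; apply/negP => a0.
(* With this [e], the term [e * b] is at most half of [- a], so [a + e * b] would be negative. *)
pose e : R := (Num.min 1 (- a / (2 * (`|b| + 1))))%R.
have b1 : (0 < 2 * (`|b| + 1) :> R)%R by rewrite mulr_gt0// ltr_wpDl.
have e0 : (0 < e)%R by rewrite lt_min ltr01/= divr_gt0// oppr_gt0.
have := h e; rewrite e0/= ge_min lexx/= => /(_ isT).
rewrite expr2 -mulrA -mulrDr pmulr_rge0// => ab.
have eb : (e * b <= e * (`|b| + 1))%R.
  by rewrite ler_wpM2l ?(ltW e0)// (le_trans (ler_norm b))// lerDl.
have : (e * (2 * (`|b| + 1)) <= - a)%R by rewrite -ler_pdivlMr// ge_min lexx orbT.
rewrite mulrCA; move: ab eb a0; lra.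
Qed.

(** [a1 - a] and [b1 - b] are the changes of interaction with [mu] and with [nu]; the common
    constant [e * s] drops out of their difference. *)
Lemma heat_exchange (R : realDomainType) (k a a1 b b1 u v e s T : R) : (0 <= k)%R ->
  (k * a1 + u = k * a + e * s)%R -> (k * b1 + v = k * b + e * s)%R ->
  (0 <= (a1 - a) - (b1 - b) + T * s)%R -> (u <= v + k * T * s)%R.
Proof.
move=> k0 hu hv /(mulr_ge0 k0).
have -> : (k * (a1 - a - (b1 - b) + T * s) =
  (k * a1 - k * a) - (k * b1 - k * b) + k * T * s)%R by ring.
by move: hu hv; lra.
Qed.

Lemma mixture_energy_le (R : realFieldType) (a a1 a2 b b1 c e u M s : R) :
  (a / 2 - b + c / 2 <=
    ((1 - e) * ((1 - e) * a + e * a1) + e * ((1 - e) * a1 + e * a2)) / 2 -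
    ((1 - e) * b + e * b1) + c / 2 + u * (e * (M * s)) ->
   0 <= e * ((a1 - a) - (b1 - b) + u * M * s) + e ^+ 2 * (a / 2 - a1 + a2 / 2))%R.
Proof.
rewrite -subr_ge0 => h; rewrite (le_trans h)// le_eqVlt; apply/orP; left.
by apply/eqP; field.
Qed.

Section criticality.
Context (R : realType) (n : nat) (n0 : (0 < n)%N).
Variables (mu nu : probability (Euclid R n) R).
Hypothesis imm : finite_coulomb_energy mu.
Hypothesis inn : finite_coulomb_energy nu.
Hypothesis imn : (mu \x nu).-integrable setT (@coulomb R n).

Lemma critical_heat_kernel_le (tau k : R) (S : set (Euclid R n)) (t : R) :
  (0 < tau)%R ->
  (forall rho : probability (Euclid R n) R,
     coulomb_discrepancy nu mu + ((2 * tau)^-1)%R%:E * wasserstein2 mu mu ^+ 2 <=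
     coulomb_discrepancy nu rho + ((2 * tau)^-1)%R%:E * wasserstein2 mu rho ^+ 2) ->
  heat_const R n = k%:E -> (0 < k)%R -> measurable S -> (0 < t <= 1)%R ->
  [/\ (mu \x mu).-integrable setT (heat_kernel S t),
      (mu \x nu).-integrable setT (heat_kernel S t) &
  \int[mu \x mu]_w heat_kernel S t w <= \int[mu \x nu]_w heat_kernel S t w +
    (k * ((2 * tau)^-1 * (8 * n%:R * t)))%:E * mu S].
Proof.
move=> tau0 crit kE k0 mS t01; have /andP[t0 _] := t01.
have [p gauss moment] := ex_normal_vector n t0.
have [E [C HEC]] := smooth_coul n0 t01 gauss moment.
have mdis : measurable_fun setT (displace S).
  apply: (@eq_measurable_fun _ _ _ _ _ (fun w => displace S (w.1, w.2))); first by move=> [].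
  exact: measurable_displace.
have [rho rhoE rhoi] := ex_pushforward (mu \x p)%E mdis.
have [irm ikm km] := displaced_coulomb n0 mS rhoi HEC imm.
have [irn ikn kn] := displaced_coulomb n0 mS rhoi HEC imn.
(* The second-order term requires the self-energy of [rho]. Since [displaced_coulomb] moves the
   first factor only, the factors are swapped by symmetry and it is applied again. *)
have [imr smr] := symmetric_integrable (@coulombC R n) irm.
have [irr _ _] := displaced_coulomb n0 mS rhoi HEC imr.
split=> //.
have fin (m' : {measure set (Euclid R n * Euclid R n) -> \bar R}) f :
    m'.-integrable setT f -> exists r : R, \int[m']_z f z = r%:E.
  move=> ig; exists (fine (\int[m']_z f z)).
  by apply/esym/fineK; exact: integrable_fin_num.
have [a aE] := fin _ _ imm; have [b bE] := fin _ _ imn.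
have [c cE] := fin _ _ inn; have [a1 a1E] := fin _ _ irm.
have [a2 a2E] := fin _ _ irr; have [b1 b1E] := fin _ _ irn.
have [km' kmE] := fin _ _ ikm; have [kn' knE] := fin _ _ ikn.
have [s sE] : exists s : R, mu S = s%:E.
  by exists (fine (mu S)); rewrite fineK// fin_num_measure.
move: km kn; rewrite kE a1E b1E aE bE kmE knE sE -!EFinM -!EFinD => -[km] -[kn].
rewrite lee_fin.
pose T := ((2 * tau)^-1 * (8 * n%:R * t))%R.
suff : (0 <= (a1 - a) - (b1 - b) + T * s)%R.
  exact: heat_exchange (ltW k0) km kn.
apply: (@first_order_ge0 _ _ (a / 2 - a1 + a2 / 2)%R) => e /andP[e0 e1].
have e01 : (0 <= e <= 1)%R by rewrite (ltW e0).
have [rhoe rhoeE] := ex_mixture mu rho e01.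
have L : int_lincomb rhoe (1 - e)%R mu e rho.
  by apply: int_lincombP => [||X _]; rewrite ?subr_ge0//; [exact: ltW|exact: rhoeE].
have [iem em] := int_lincomb_integral (int_lincomb_prodl mu L) imm irm.
have [ier er] := int_lincomb_integral (int_lincomb_prodl rho L) imr irr.
have [ien en] := int_lincomb_integral (int_lincomb_prodl nu L) imn irn.
have [iee ee] := int_lincomb_integral (int_lincomb_prodr rhoe L) iem ier.
have := crit rhoe.
move: em er en ee; rewrite aE a1E smr a1E a2E bE b1E -!EFinM -!EFinD.
move=> em er en; rewrite em er -!EFinM -!EFinD => ee.
rewrite (discrepancyE imm imn inn aE bE cE) (discrepancyE iee ien inn ee en cE).
have W := wasserstein2_sqr_mixture_le mS e01 rhoE rhoeE moment.
have tau1 : (0 <= (2 * tau)^-1)%R by rewrite invr_ge0 mulr_ge0// ltW.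
have W0 := wasserstein2_sqr_ge0 mu mu.
move=> H; have : (a / 2 - b + c / 2)%:E <=
    (((1 - e) * ((1 - e) * a + e * a1) + e * ((1 - e) * a1 + e * a2)) / 2 -
     ((1 - e) * b + e * b1) + c / 2)%:E +
    (2 * tau)^-1%:E * (e%:E * ((8 * n%:R * t)%:E * mu S)).
  apply: le_trans (le_trans H _); first by rewrite leeDl// mule_ge0// lee_fin.
  by rewrite leeD2l// lee_wpmul2l// lee_fin.
rewrite sE -!EFinM -!EFinD lee_fin; exact: mixture_energy_le.
Qed.

End criticality.

(** * Comparison of heat potentials *)

Lemma measurable_superlevel d (T : measurableType d) (R : realType)
    (m : {sigma_finite_measure set T -> \bar R}) (f : T -> R) :
  measurable_fun setT f ->
  measurable_fun setT (fun l : measurableTypeR R => m [set x | (l < f x)%R]).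
Proof.
move=> mf.
pose A : set (T * measurableTypeR R) := [set z | (z.2 < f z.1)%R].
have mA : measurable A.
  apply: measurable_set_bool; apply: measurable_fun_ltr; first exact: measurable_snd.
  exact: measurableT_comp.
have mh : measurable_fun setT (fun z => (\1_A z)%:E : \bar R).
  by apply/measurable_EFinP/measurable_indic.
have h0 z : 0 <= (\1_A z)%:E :> \bar R by rewrite lee_fin.
have := measurable_fun_fubini_tonelli_G (m1 := m) _ mh h0.
apply: eq_measurable_fun => l _; rewrite /fubini_G -[X in _ = m X]setIT -integral_indic//.
by apply: measurable_set_bool; apply: measurable_fun_ltr.
Qed.

(** Apply layer cake to the positive part of [f - h], whose superlevel sets are those of [f] above
    [h]. Replacing [f] by it under [m2] costs at most [h] times the total mass. *)
Lemma superlevel_integral_le d (T : measurableType d) (R : realType)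
    (m1 m2 : {finite_measure set T -> \bar R}) (f : T -> R) (h : R) :
  measurable_fun setT f -> (forall x, 0 <= f x)%R -> (0 <= h)%R ->
  (forall l, (h <= l)%R -> 2%:E * m2 [set x | (l < f x)%R] <= m1 [set x | (l < f x)%R]) ->
  2%:E * \int[m2]_x (f x)%:E <= \int[m1]_x (f x)%:E + 2%:E * (h%:E * m2 setT).
Proof.
move=> mf f0 h0 H.
pose g x : R := Num.max (f x - h)%R 0%R.
have mg : measurable_fun setT g.
  by apply: measurable_maxr => //; exact: measurable_funB.
have g0 x : (0 <= g x)%R by rewrite le_max lexx orbT.
have gE l : (0 <= l)%R -> [set x | (l < g x)%R] = [set x | (l + h < f x)%R].
  move=> l0; apply/seteqP; split=> x /=; rewrite lt_max ltrBrDr.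
    by case/orP => //; rewrite ltNge l0.
  by move=> ->.
have fg x : (f x <= g x + h)%R by rewrite -lerBlDr le_max lexx.
have gf x : (g x <= f x)%R by rewrite ge_max f0 lerBlDr lerDl h0.
apply: (@le_trans _ _ (2%:E * (\int[m2]_x (g x)%:E + h%:E * m2 setT))).
  apply: lee_wpmul2l; first by rewrite lee_fin.
  rewrite -integral_cst// -ge0_integralD//.
  - apply: ge0_le_integral => //.
    + by move=> x _; rewrite lee_fin.
    + exact/measurable_EFinP.
    + by apply/measurable_EFinP; apply: measurable_funD.
    + by move=> x _; rewrite -EFinD lee_fin.
  - by move=> x _; rewrite lee_fin.
  - exact/measurable_EFinP.
rewrite ge0_muleDr ?integral_ge0 ?mule_ge0 ?lee_fin//; last by move=> x _; rewrite lee_fin.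
rewrite leeD2r//.
apply: (@le_trans _ _ (\int[m1]_x (g x)%:E)); last first.
  apply: ge0_le_integral => //.
  - by move=> x _; rewrite lee_fin.
  - exact/measurable_EFinP.
  - exact/measurable_EFinP.
  - by move=> x _; rewrite lee_fin.
rewrite !ge0_layer_cake// -ge0_integralZl//; last first.
  exact: measurable_funTS (measurable_superlevel _ mg).
apply: ge0_le_integral => //.
- by move=> l _; rewrite mule_ge0.
- by apply: measurable_funeM; exact: measurable_funTS (measurable_superlevel _ mg).
- exact: measurable_funTS (measurable_superlevel _ mg).
move=> l; rewrite /= in_itv/= andbT => l0; rewrite gE//; apply: H.
by rewrite lerDr.
Qed.

Section heat_comparison.
Context (R : realType) (n : nat).

(** [heat n v] decreases with the distance, so its superlevel sets are balls, and levels at or above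
    the value at [r0] give radii at most [r0]. *)
Lemma heat_superlevel_ball (x : Euclid R n) (v r0 l : R) : (0 < v)%R -> (0 < r0)%R ->
  (heat n v r0 <= l)%R -> exists2 r : R, (r <= r0)%R &
  [set y | (l < heat n v (eucl_dist x y))%R] = eucl_ball x r.
Proof.
move=> v0 r00 hl.
pose c : R := ((Num.sqrt v)^-1 ^+ n)%R.
have c0 : (0 < c)%R by rewrite exprn_gt0// invr_gt0 sqrtr_gt0.
have l0 : (0 < l)%R by apply: lt_le_trans hl; rewrite mulr_gt0 ?expR_gt0.
(* [c] is the maximum of the heat kernel: at levels from [c] on the set is empty, a ball of radius
   0. Below [c], solving for the distance gives r^2 = -2v ln(l/c). *)
have [cl|lc] := leP c l.
  exists 0%R; first exact: ltW.
  apply/seteqP; split=> y /=.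
    by move=> /lt_le_trans /(_ (heat_le_time n (eucl_dist x y) v0)) /lt_le_trans /(_ cl); rewrite ltxx.
  by rewrite /eucl_ball/= ltNge eucl_dist_ge0.
have lc0 : (0 < l / c < 1)%R by rewrite divr_gt0//= ltr_pdivrMr// mul1r.
have L0 : (0 <= - (2 * v * ln (l / c)))%R.
  by rewrite -mulrN mulr_ge0 ?mulr_ge0 ?(ltW v0)// oppr_ge0 ltW// ln_lt0.
pose r := Num.sqrt (- (2 * v * ln (l / c)))%R.
have E (d : R) : (0 <= d)%R -> ((l < heat n v d) = (d < r))%R.
  move=> d0; rewrite /heat -/c -ltr_pdivrMl// mulrC -[X in (X < _)%R]lnK; last first.
    by rewrite posrE; case/andP: lc0.
  rewrite ltr_expR mulNr ltrNr ltr_pdivrMr ?mulr_gt0//.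
  rewrite mulNr [X in (_ < - X)%R]mulrC -[X in (_ < X)%R]sqr_sqrtr// -/r.
  by rewrite ltr_pXn2r// nnegrE sqrtr_ge0.
exists r; last first.
  by apply/seteqP; split=> y /=; rewrite /eucl_ball/= E// eucl_dist_ge0.
by rewrite leNgt -E ?(ltW r00)// -leNgt.
Qed.

Lemma heat_integral_ball_le (m1 m2 : {finite_measure set (Euclid R n) -> \bar R})
    (x : Euclid R n) (v r0 : R) : (0 < v)%R -> (0 < r0)%R ->
  (forall r, (r <= r0)%R -> 2%:E * m2 (eucl_ball x r) <= m1 (eucl_ball x r)) ->
  2%:E * \int[m2]_y (heat n v (eucl_dist x y))%:E <=
    \int[m1]_y (heat n v (eucl_dist x y))%:E + 2%:E * ((heat n v r0)%:E * m2 setT).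
Proof.
move=> v0 r00 H; apply: superlevel_integral_le.
- by apply: measurable_heat => //; exact: measurable_eucl_dist.
- by move=> y; exact: heat_ge0.
- exact: heat_ge0.
move=> l hl; have [r rr0 ->] := heat_superlevel_ball x v0 r00 hl; exact: H.
Qed.

End heat_comparison.

Section heat_time_comparison.
Context (R : realType) (n : nat).
Implicit Types m : {finite_measure set (Euclid R n) -> \bar R}.

Lemma integral_heat_time_swap m (x : Euclid R n) (t : R) :
  \int[m]_y heat_time n t (eucl_dist x y) =
  \int[lebesgue_measure]_(v in `]0%R, t]) \int[m]_y (heat n v (eucl_dist x y))%:E.
Proof.
have md : measurable_fun setT (fun y : Euclid R n => eucl_dist x y).
  exact: measurable_eucl_dist.
under eq_integral do rewrite heat_timeE.
rewrite (@fubini_tonelli _ _ _ _ R m lebesgue_measure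
  (fun z => (heat n z.2 (eucl_dist x z.1) * \1_(`]0%R, t]) z.2)%:E)); last 2 first.
- exact: measurable_heat_indic.
- by move=> z; rewrite lee_fin mulr_ge0 ?heat_ge0.
rewrite [RHS]integral_mkcond; apply: eq_integral => v _; rewrite patchE; case: ifPn => vt.
  by apply: eq_integral => y _; rewrite indicE vt mulr1.
by apply: integral0_eq => y _; rewrite indicE (negbTE vt) mulr0.
Qed.

Lemma measurable_integral_heat m (x : Euclid R n) (D : set R) :
  measurable_fun D (fun v : measurableTypeR R => \int[m]_y (heat n v (eucl_dist x y))%:E).
Proof.
apply: measurable_funTS.
pose f (z : Euclid R n * measurableTypeR R) := (heat n z.2 (eucl_dist x z.1))%:E.
have f0 z : 0 <= f z by rewrite lee_fin heat_ge0.
have mf : measurable_fun setT f.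
  by apply/measurable_EFinP; apply: measurable_heat => //; exact: measurable_eucl_dist.
exact: (measurable_fun_fubini_tonelli_G (m1 := m) _ mf f0).
Qed.

(** The comparison at fixed time is integrated over 0 < v <= t. The truncation level [heat n v r0]
    is bounded uniformly for v <= 1, so the error is linear in [t], like the transport cost. *)
Lemma heat_time_ball_le m1 m2 (x : Euclid R n) (t r0 : R) :
  (0 < t <= 1)%R -> (0 < r0)%R ->
  (forall r, (r <= r0)%R -> 2%:E * m2 (eucl_ball x r) <= m1 (eucl_ball x r)) ->
  2%:E * \int[m2]_y heat_time n t (eucl_dist x y) <=
    \int[m1]_y heat_time n t (eucl_dist x y) +
    (2 * (2 * n.+1%:R / r0 ^+ 2) ^+ n.+1 * t)%:E * m2 setT.
Proof.
move=> /andP[t0 t1] r00 H; rewrite !integral_heat_time_swap.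
set K := (_ ^+ n.+1)%R; have K0 : (0 <= K)%R.
  by rewrite exprn_ge0// divr_ge0 ?sqr_ge0// mulr_ge0.
have Hm m v : 0 <= \int[m]_y (heat n v (eucl_dist x y))%:E.
  by apply: integral_ge0 => y _; rewrite lee_fin heat_ge0.
have c0 : 0 <= (2 * K)%:E * m2 setT by rewrite mule_ge0// lee_fin mulr_ge0.
rewrite -ge0_integralZl//; last exact: measurable_integral_heat.
apply: (@le_trans _ _ (\int[lebesgue_measure]_(v in `]0%R, t])
    (\int[m1]_y (heat n v (eucl_dist x y))%:E + (2 * K)%:E * m2 setT))).
  apply: ge0_le_integral => //.
  - by move=> v _; rewrite mule_ge0.
  - by apply: measurable_funeM; exact: measurable_integral_heat.
  - by apply: emeasurable_funD; first exact: measurable_integral_heat.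
  move=> v; rewrite /= in_itv/= => /andP[v0 vt].
  apply: le_trans (heat_integral_ball_le v0 r00 H) _; rewrite leeD2l//.
  rewrite muleA -EFinM lee_wpmul2r// lee_fin ler_wpM2l//.
  have v1 : (v <= 1)%R by exact: le_trans t1.
  rewrite (le_trans (heat_small_time n _ r00)) ?v0//.
  by rewrite ler_piMl.
rewrite ge0_integralD//; last exact: measurable_integral_heat.
rewrite leeD2l// integral_cst//= lebesgue_measure_itv/= lte_fin t0 oppr0 adde0.
by rewrite muleAC -EFinM.
Qed.

(** Keep only the times between r^2/2 and r^2: there v^(-n/2) >= r^(-n), and d <= r gives an
    exponential factor of at least exp(-1). *)
Lemma heat_time_ge (r d : R) : (0 < r)%R -> (0 <= d <= r)%R ->
  ((r^-1 ^+ n * expR (- 1)) * (r ^+ 2 / 2))%:E <= heat_time n (r ^+ 2) d.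
Proof.
move=> r0 /andP[d0 dr]; set c := (r^-1 ^+ n * _)%R.
have r20 : (0 < r ^+ 2)%R by rewrite exprn_gt0.
have hr : (r ^+ 2 / 2 < r ^+ 2)%R by rewrite ltr_pdivrMr// ltr_pMr// ltr1n.
have mh (D : set R) : measurable_fun D (fun v : measurableTypeR R => (heat n v d)%:E).
  by apply: measurable_funTS; apply/measurable_EFinP; exact: measurable_heat.
rewrite /heat_time; apply: (@le_trans _ _
    (\int[lebesgue_measure]_(v in `](r ^+ 2 / 2)%R, (r ^+ 2)%R]) (heat n v d)%:E)).
  apply: (@le_trans _ _
    (\int[lebesgue_measure]_(v in `](r ^+ 2 / 2)%R, (r ^+ 2)%R]) (cst c%:E v))).
    rewrite integral_cst//= lebesgue_measure_itv/= lte_fin hr -EFinB -EFinM lee_fin.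
    by rewrite [X in (_ <= _ * (X - _))%R]splitr addrK.
  apply: ge0_le_integral => //.
  - by move=> v _; rewrite lee_fin mulr_ge0 ?expR_ge0// exprn_ge0// invr_ge0 ltW.
  - exact: mh.
  move=> v; rewrite /= in_itv/= => /andP[rv vr]; rewrite lee_fin.
  have v0 : (0 < v)%R by apply: lt_trans rv; rewrite divr_gt0.
  rewrite ler_pM ?expR_ge0 ?exprn_ge0 ?invr_ge0 ?(ltW r0)//.
    rewrite lerXn2r ?nnegrE ?invr_ge0 ?sqrtr_ge0 ?(ltW r0)//.
    rewrite lef_pV2 ?posrE ?sqrtr_gt0//.
    by rewrite -[leRHS]gtr0_norm// -sqrtr_sqr ler_sqrt// sqr_ge0.
  rewrite ler_expR mulNr lerN2 ler_pdivrMr ?mulr_gt0// mul1r.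
  apply: (@le_trans _ _ (r ^+ 2)%R); first by rewrite lerXn2r// nnegrE// ltW.
  by rewrite mulrC -ler_pdivrMr// ltW.
apply: ge0_subset_integral => //.
- exact: mh.
- by move=> v _; rewrite lee_fin heat_ge0.
- move=> v; rewrite /= !in_itv/= => /andP[rv ->]; rewrite andbT.
  by apply: lt_trans rv; rewrite divr_gt0.
Qed.

Lemma integral_heat_time_ge m (x : Euclid R n) (r : R) : (0 < r)%R ->
  ((r^-1 ^+ n * expR (- 1)) * (r ^+ 2 / 2))%:E * m (eucl_ball x r) <=
  \int[m]_y heat_time n (r ^+ 2) (eucl_dist x y).
Proof.
move=> r0; set c := (_ * (r ^+ 2 / 2))%R.
have c0 : (0 <= c)%R.
  by rewrite mulr_ge0 ?divr_ge0 ?sqr_ge0// mulr_ge0 ?expR_ge0// exprn_ge0// invr_ge0 ltW.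
have h0 y : 0 <= heat_time n (r ^+ 2) (eucl_dist x y).
  by apply: integral_ge0 => v _; rewrite lee_fin heat_ge0.
have mh : measurable_fun setT (fun y => heat_time n (r ^+ 2) (eucl_dist x y)).
  by apply: measurable_heat_time; exact: measurable_eucl_dist.
have mB := measurable_eucl_ball x r.
rewrite -integral_cst//.
apply: (@le_trans _ _ (\int[m]_(y in eucl_ball x r) heat_time n (r ^+ 2) (eucl_dist x y))).
  apply: ge0_le_integral => //.
  - exact: measurable_funTS.
  - by move=> y yr; rewrite heat_time_ge// eucl_dist_ge0 ltW.
exact: ge0_subset_integral.
Qed.

(** An open ball is the increasing union of smaller concentric ones, so a slightly smaller rational
    radius loses little of [m2], while [m1] only decreases. *)
Lemma eucl_ball_le_real m1 m2 (x : Euclid R n) (r0 : R) :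
  (forall q : rat, (0 < (ratr q : R) < r0)%R ->
    2%:E * m2 (eucl_ball x (ratr q)) <= m1 (eucl_ball x (ratr q))) ->
  forall r, (r <= r0)%R -> 2%:E * m2 (eucl_ball x r) <= m1 (eucl_ball x r).
Proof.
move=> H r rr0; have [r_le0|r_gt0] := leP r 0%R.
  rewrite (_ : eucl_ball x r = set0) ?measure0 ?mule0//.
  apply/seteqP; split=> y //=; rewrite /eucl_ball/= => /lt_le_trans /(_ r_le0).
  by rewrite ltNge eucl_dist_ge0.
pose F k := eucl_ball x (r - r * k.+1%:R^-1)%R.
have FE : \bigcup_k F k = eucl_ball x r.
  apply/seteqP; split=> y /=.
    move=> [k _]; rewrite /F /eucl_ball/= => /lt_le_trans; apply.
    by rewrite gerBl mulr_ge0 ?(ltW r_gt0)// invr_ge0.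
  rewrite /eucl_ball/= => yr.
  have [|k yk] := @ltr_add_invr _ (eucl_dist x y / r)%R 1%R; first by rewrite ltr_pdivrMr// mul1r.
  exists k => //; rewrite /F /eucl_ball/= -{1}(mulr1 r) -mulrBr mulrC -ltr_pdivrMr//.
  by rewrite ltrBrDr.
have mF k : measurable (F k) by exact: measurable_eucl_ball.
have ndF : nondecreasing_seq F.
  move=> i j ij; apply/subsetPset => y; rewrite /F /eucl_ball/= => /lt_le_trans; apply.
  by rewrite lerD2l lerN2 ler_wpM2l ?(ltW r_gt0)// lef_pV2 ?posrE// ler_nat.
apply/lee_addgt0Pr => e e0.
have e20 : (0 < e / 2)%R by rewrite divr_gt0.
have [k hk] := ex_measure_bigcup_approx m2 mF ndF e20.
have [|q] := @rat_in_itvoo R (r - r * k.+1%:R^-1) r.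
  by rewrite gtrBl mulr_gt0// invr_gt0.
rewrite in_itv/= => /andP[q1 q2].
have q0 : (0 < ratr q :> R)%R.
  apply: le_lt_trans q1; rewrite subr_ge0 -{2}(mulr1 r) ler_wpM2l ?(ltW r_gt0)//.
  by rewrite invf_le1// ler1n.
have sub a b : (a <= b)%R -> eucl_ball x a `<=` eucl_ball x b.
  by move=> ab y; rewrite /eucl_ball/= => /lt_le_trans; apply.
have mB a := measurable_eucl_ball x a.
apply: (@le_trans _ _ (2%:E * ((e / 2)%:E + m2 (eucl_ball x (ratr q))))).
  apply: lee_wpmul2l; first by rewrite lee_fin.
  rewrite -{1}(setDUK (sub _ _ (ltW q2))) addeC.
  apply: le_trans (measureU2 _ _ _) _ => //; first exact: measurableD.
  rewrite leeD2l//; apply: le_trans hk; rewrite FE.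
  apply: le_measure; rewrite ?inE; [exact: measurableD|exact: measurableD|].
  by apply: setDS; rewrite /F; apply: sub; exact: ltW.
rewrite ge0_muleDr ?lee_fin ?(ltW e20)// -EFinM mulrCA divff// mulr1 addeC leeD2r//.
apply: le_trans (H q _) _; first by rewrite q0/= (lt_le_trans q2).
by apply: le_measure; rewrite ?inE//; exact: sub (ltW q2).
Qed.

End heat_time_comparison.

(** * Good points of the positive part *)

Lemma local_minkowski_dim_lt (R : realType) n (rho : set (Euclid R n) -> \bar R)
    (x : Euclid R n) (l : \bar R) (s : R) :
  (forall r, 0 <= rho (eucl_ball x r) <= 1) ->
  local_minkowski_dim rho x l -> l < s%:E ->
  exists2 r0 : R, (0 < r0)%R &
    forall r, (0 < r < r0)%R -> (r `^ s)%:E <= rho (eucl_ball x r).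
Proof.
move=> rho01 dl ls.
have /dl := open_ereal_lt' ls.
move=> -[e /= e0 H]; exists (Num.min e 1)%R; first by rewrite lt_min e0/=.
move=> r /andP[r0]; rewrite lt_min => /andP[re r1].
have {H} := H r; rewrite /= sub0r normrN gtr0_norm// => /(_ re r0).
have lr : (ln r < 0)%R by rewrite ln_lt0// r0.
have /andP[] := rho01 r.
case: (rho (eucl_ball x r)) => [m| |]//; rewrite !lee_fin => m0 _ H.
have [m_gt0|] := ltP 0%R m; last first.
  (* A ball of zero mass would give the quotient -oo divided by a negative real, that is [+oo],
     which is not below [s]. *)
  move=> m_le0; move: H; rewrite /= m_le0 inver lt_eqF// mulNyr/=.
  rewrite ltr0_sg ?invr_lt0//.
  by rewrite EFinN mulN1e.
rewrite /powR gt_eqF// -[leRHS]lnK ?posrE// ler_expR -ler_ndivrMr//.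
move: H; rewrite /= leNgt m_gt0 /= inver lt_eqF// -EFinM lte_fin.
exact: ltW.
Qed.

Section good_set.
Context (R : realType) (n : nat).
Variables (sp sn : {finite_measure set (Euclid R n) -> \bar R}).

(** Rational radii make this a countable intersection of measurable sets; [eucl_ball_le_real]
    recovers all radii. *)
Definition ratio_set (J : nat) : set (Euclid R n) := [set x | forall q : rat,
  (0 < (ratr q : R) < J.+1%:R^-1)%R ->
  2%:E * sn (eucl_ball x (ratr q)) <= sp (eucl_ball x (ratr q))].

(** Only the radii 1/(j+1) are kept: they make the set measurable, and the final contradiction is
    taken along them. *)
Definition growth_set (s : R) (J : nat) : set (Euclid R n) := [set x | forall j : nat,
  (J <= j)%N -> ((j.+1%:R^-1 : R) `^ s)%:E <= sp (eucl_ball x (j.+1%:R^-1)%R)].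

Lemma measurable_ratio_set J : measurable (ratio_set J).
Proof.
rewrite -[ratio_set J]setCK; apply: measurableC.
rewrite (_ : ~` _ = \bigcup_(q in [set q : rat | (0 < (ratr q : R) < J.+1%:R^-1)%R])
   [set x | sp (eucl_ball x (ratr q)) < 2%:E * sn (eucl_ball x (ratr q))]).
  rewrite bigcup_mkcond; apply: bigcupT_measurable_rat => q; case: ifP => // _.
  apply: measurable_set_bool; apply: measurable_fun_lte; first exact: measurable_fun_eucl_ball.
  by apply: measurable_funeM; exact: measurable_fun_eucl_ball.
apply/seteqP; split=> x /=.
  move=> /existsNP[q /not_implyP[qJ /negP]]; rewrite -ltNge => h.
  by exists q.
by move=> [q qJ /=]; rewrite ltNge => /negP h /(_ q qJ).
Qed.

Lemma measurable_growth_set s J : measurable (growth_set s J).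
Proof.
rewrite (_ : growth_set s J = \bigcap_(j in [set j | (J <= j)%N])
  [set x | ((j.+1%:R^-1 : R) `^ s)%:E <= sp (eucl_ball x (j.+1%:R^-1)%R)]).
  apply: bigcap_measurable; first by exists J => /=.
  move=> j _; apply: measurable_set_bool; apply: measurable_fun_lee => //.
  exact: measurable_fun_eucl_ball.
by apply/seteqP; split=> x /=.
Qed.

(** The points of [A] outside every [ratio_set] have arbitrarily small bad balls and form an
    [sp]-null set by singularity. The rest of [A] is covered by the good sets of index [J], so one
    of them has positive mass. *)
Lemma ex_good_set (A : set (Euclid R n)) (s : R) :
  measurable A -> sn A = 0 -> 0 < sp A ->
  (forall x, A x -> exists2 r0 : R, (0 < r0)%R &
    forall r, (0 < r < r0)%R -> (r `^ s)%:E <= sp (eucl_ball x r)) ->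
  exists J, 0 < sp (A `&` ratio_set J `&` growth_set s J).
Proof.
move=> mA snA spA dimA.
have mS J : measurable (A `&` ratio_set J `&` growth_set s J).
  by apply: measurableI; [apply: measurableI => //; exact: measurable_ratio_set|
    exact: measurable_growth_set].
have mU : measurable (\bigcup_J ratio_set J).
  by apply: bigcupT_measurable => J; exact: measurable_ratio_set.
pose D := A `\` \bigcup_J ratio_set J.
have mD : measurable D by exact: measurableD.
have spD : sp D = 0.
  apply: (@singular_ball_ratio R n sp sn) => //.
    apply/eqP; rewrite eq_le measure_ge0 andbT -snA.
    by apply: le_measure; rewrite ?inE// => x [].
  move=> x r [Ax xU] r0.
  have [J Jr] : exists J : nat, (J.+1%:R^-1 < r)%R.
    by have [k] := @ltr_add_invr _ 0%R r r0; rewrite add0r; exists k.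
  have : ~ ratio_set J x by move=> xJ; apply: xU; exists J.
  move=> /existsNP[q /not_implyP[/andP[q0 qJ] /negP]]; rewrite -ltNge => h.
  by exists q => //; rewrite q0 (lt_trans qJ).
apply: contrapT => /forallNP S0.
have {}S0 J : sp (A `&` ratio_set J `&` growth_set s J) = 0.
  by apply/eqP; rewrite eq_le measure_ge0 andbT leNgt; apply/negP; exact: S0.
have sub : A `<=` D `|` \bigcup_J (A `&` ratio_set J `&` growth_set s J).
  move=> x Ax; have [[J1 _ xJ1]|xU] := pselect ((\bigcup_J ratio_set J) x); last by left.
  right; have [r0 r00 xr] := dimA x Ax.
  have [J2 J2r] : exists J : nat, (J.+1%:R^-1 < r0)%R.
    by have [k] := @ltr_add_invr _ 0%R r0 r00; rewrite add0r; exists k.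
  have inv_le i j : (i <= j)%N -> (j.+1%:R^-1 <= i.+1%:R^-1 :> R)%R.
    by move=> ij; rewrite lef_pV2 ?posrE// ler_nat.
  exists (maxn J1 J2) => //; split; first split => //.
    move=> q /andP[q0 qJ]; apply: xJ1; rewrite q0/= (lt_le_trans qJ)// inv_le//.
    exact: leq_maxl.
  move=> j jJ; apply: xr; rewrite invr_gt0 ltr0n/= (le_lt_trans _ J2r)// inv_le//.
  exact: leq_trans (leq_maxr _ _) jJ.
have : sp A <= sp D + sp (\bigcup_J (A `&` ratio_set J `&` growth_set s J)).
  apply: le_trans (measureU2 _ _ _) => //; last exact: bigcupT_measurable.
  by apply: le_measure; rewrite ?inE//; apply: measurableU => //; exact: bigcupT_measurable.
have : sp (\bigcup_J (A `&` ratio_set J `&` growth_set s J)) = 0.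
  apply/eqP; rewrite eq_le measure_ge0 andbT.
  apply: (le_trans (generalized_Boole_inequality sp mS _)); first exact: bigcupT_measurable.
  by rewrite eseries0// => J _ _; exact: S0.
by move=> ->; rewrite spD adde0 leNgt spA.
Qed.

End good_set.

(** * Integrals of the removed kernel over the good set *)

Section heat_kernel_integrals.
Context (R : realType) (n : nat).
Variables (S : set (Euclid R n)) (mS : measurable S) (mu : probability (Euclid R n) R).
Implicit Types m : {finite_measure set (Euclid R n) -> \bar R}.

Lemma integral_heat_kernel m (t : R) :
  measurable_fun setT (fun x => \int[m]_y heat_kernel S t (x, y)) /\
  \int[mu \x m]_w heat_kernel S t w = \int[mu]_x \int[m]_y heat_kernel S t (x, y).
Proof.
have mh := measurable_heat_kernel mS t; have h0 := @heat_kernel_ge0 R n S t.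
split; first exact: (measurable_fun_fubini_tonelli_F _ mh h0).
by rewrite fubini_tonelli1.
Qed.

Lemma le_integral_heat_kernel m (r s : R) : (0 < r)%R ->
  (forall x, S x -> (r `^ s)%:E <= m (eucl_ball x r)) ->
  ((r^-1 ^+ n * expR (- 1)) * (r ^+ 2 / 2) * r `^ s)%:E * mu S <=
  \int[mu \x m]_w heat_kernel S (r ^+ 2) w.
Proof.
move=> r0 H; have [mh ->] := integral_heat_kernel m (r ^+ 2).
have c0 : (0 <= (r^-1 ^+ n * expR (- 1)) * (r ^+ 2 / 2))%R.
  by rewrite mulr_ge0 ?divr_ge0 ?sqr_ge0// mulr_ge0 ?expR_ge0// exprn_ge0// invr_ge0 ltW.
rewrite -integral_cst//.
have h0 x : 0 <= \int[m]_y heat_kernel S (r ^+ 2) (x, y).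
  by apply: integral_ge0 => y _; exact: heat_kernel_ge0.
apply: (@le_trans _ _ (\int[mu]_(x in S) \int[m]_y heat_kernel S (r ^+ 2) (x, y))).
  apply: ge0_le_integral => //.
  - by move=> x _; rewrite lee_fin mulr_ge0 ?powR_ge0.
  - exact: measurable_funTS.
  - move=> x xS; rewrite /heat_kernel/= mem_set//.
    apply: le_trans (integral_heat_time_ge m x r0); rewrite EFinM.
    by rewrite lee_wpmul2l ?lee_fin// H.
exact: ge0_subset_integral.
Qed.

Lemma heat_kernel_compare m1 m2 (t r0 : R) : (0 < t <= 1)%R -> (0 < r0)%R ->
  (forall x, S x -> forall r, (r <= r0)%R ->
    2%:E * m2 (eucl_ball x r) <= m1 (eucl_ball x r)) ->
  m2 setT <= 1 ->
  2%:E * \int[mu \x m2]_w heat_kernel S t w <= \int[mu \x m1]_w heat_kernel S t w +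
    (2 * (2 * n.+1%:R / r0 ^+ 2) ^+ n.+1 * t)%:E * mu S.
Proof.
move=> t01 r00 H m21; have /andP[t0 _] := t01.
have [mh1 ->] := integral_heat_kernel m1 t; have [mh2 ->] := integral_heat_kernel m2 t.
set K := (_ * t)%R; have K0 : (0 <= K)%R.
  by rewrite mulr_ge0 ?(ltW t0)// mulr_ge0// exprn_ge0// divr_ge0 ?sqr_ge0// mulr_ge0.
have h0 (m : {finite_measure set (Euclid R n) -> \bar R}) x :
    0 <= \int[m]_y heat_kernel S t (x, y).
  by apply: integral_ge0 => y _; exact: heat_kernel_ge0.
have mI : measurable_fun setT (fun x => (\1_S x)%:E : \bar R).
  by apply/measurable_EFinP; exact: measurable_indic.
have -> : mu S = \int[mu]_x (\1_S x)%:E by rewrite integral_indic ?setIT.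
rewrite -ge0_integralZl// -[X in _ <= _ + X]ge0_integralZl// -ge0_integralD//; last 2 first.
- by move=> x _; rewrite mule_ge0.
- exact: measurable_funeM.
apply: ge0_le_integral => //.
- by move=> x _; rewrite mule_ge0.
- exact: measurable_funeM.
- by apply: emeasurable_funD => //; exact: measurable_funeM.
move=> x _; rewrite /heat_kernel/= indicE; have [xS|xS] := boolP (x \in S); last first.
  by rewrite !integral0 mule0 mule0 adde0.
rewrite mule1; apply: le_trans (heat_time_ball_le t01 r00 (H x (set_mem xS))) _.
by rewrite leeD2l// -[leRHS]mule1 lee_wpmul2l.
Qed.

End heat_kernel_integrals.

(** * Conclusion *)

Lemma unbounded_powR (R : realType) (e b : R) : (0 < e)%R ->
  exists j0, forall j, (j0 <= j)%N -> (b < j.+1%:R `^ e)%R.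
Proof.
move=> e0; have [b0|b0] := leP b 0%R.
  by exists 0%N => j _; apply: le_lt_trans b0 _; rewrite powR_gt0.
exists (Num.truncn (b `^ e^-1)) => j jj.
have -> : b = ((b `^ e^-1) `^ e)%R by rewrite -powRrM mulVf ?gt_eqF// powRr1 ?ltW.
apply: gt0_ltr_powR => //; rewrite ?nnegrE ?powR_ge0//.
by rewrite (lt_le_trans (truncnS_gt _))// ler_nat.
Qed.

(** Doubling the first bound and inserting the second leaves one copy of [u] on the right to be
    absorbed. This is why balls are compared with the factor 2. *)
Lemma combine_heat_bounds (R : realDomainType) (u v c k m : R) :
  (u <= v + c * m -> 2 * v <= u + k * m -> u <= (k + 2 * c) * m)%R.
Proof. by lra. Qed.

(** With r = 1/(j+1), the powers r^(-n), r^2 and r^(n - e) against r^2 leave r^(-e); the constant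
    [2 * expR 1] undoes the factors 1/2 and exp(-1) of [heat_time_ge]. *)
Lemma heat_growth_power (R : realType) n (e b : R) j :
  (((j.+1%:R^-1)^-1 ^+ n * expR (- 1)) * (j.+1%:R^-1 ^+ 2 / 2) *
    j.+1%:R^-1 `^ (n%:R - e) <= b * j.+1%:R^-1 ^+ 2 ->
   j.+1%:R `^ e <= 2 * expR 1 * b)%R.
Proof.
set r : R := (j.+1%:R^-1)%R; have r0 : (0 < r)%R by rewrite invr_gt0.
rewrite powRB; last by apply/implyP => _; rewrite gt_eqF.
rewrite powR_mulrn ?(ltW r0)// => h.
have -> : (j.+1%:R `^ e = (r `^ e)^-1 :> R)%R.
  by rewrite /r -[X in (_ = X)%R]powRN -powR_inv1// -powRrM mulN1r opprK.
have -> : ((r `^ e)^-1 = 2 * expR 1 *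
    ((r^-1 ^+ n * expR (- 1)) * (r ^+ 2 / 2) * (r ^+ n / r `^ e) / r ^+ 2))%R.
  rewrite expRN exprVn; field.
  by rewrite !gt_eqF ?exprn_gt0 ?powR_gt0 ?expR_gt0.
by rewrite ler_wpM2l ?mulr_ge0 ?expR_ge0// ler_pdivrMr ?exprn_gt0.
Qed.

Theorem theorem4p11 (R : realType) (d : nat) (hd : (0 < d)%N)
    (mu nu : probability (Euclid R d) R)
    (hmu : finite_coulomb_energy mu) (hnu : finite_coulomb_energy nu)
    (P N : set (Euclid R d))
    (hPN : hahn_decomposition (charge_sub mu nu) P N)
    (delta : R) (hdelta : (0 < delta <= 1)%R)
    (A : set (Euclid R d)) (mA : measurable A)
    (hA : 0 < jordan_pos hPN A)
    (hdim : minkowski_dim_lt (mrestr (jordan_pos hPN) mA) A (d%:R - delta)%R) :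
  ~ wasserstein_critical_point (coulomb_discrepancy nu) mu.
Proof.
move=> [Fmu [tau0 tau00 crit]].
have imn := integrable_cross hd hmu hnu Fmu.
(* Criticality is used at the single time step [tau0], which stays fixed while the mixing fraction
   and then the noise tend to 0. *)
have {}crit rho := crit tau0 (introT andP (conj tau00 (lexx _))) rho.
have [k k0 kE] := heat_constE R hd.
have [[mP posP] [mN negN] PNT PN0] := hPN.
have [c [muE nuE cmu cnu]] := ex_common_part hPN.
have pmu := @jordan_pos_le _ _ _ _ _ _ _ hPN.
have nnu := @jordan_neg_le _ _ _ _ _ _ _ hPN.
(* Passing to the part of [A] in the positive set leaves its mass under mu_+ unchanged and makes it
   null for nu_-, as [ex_good_set] requires. *)
have mAP : measurable (A `&` P) by exact: measurableI.
have nAP : jordan_neg hPN (A `&` P) = 0.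
  by rewrite jordan_neg_charge_subE// -setIA PN0 setI0 !measure0 sube0.
have pAP : 0 < jordan_pos hPN (A `&` P).
  by move: hA; rewrite !jordan_pos_charge_subE// -setIA setIid.
have dimA x : (A `&` P) x -> exists2 r0 : R, (0 < r0)%R &
    forall r, (0 < r < r0)%R ->
      (r `^ (d%:R - delta))%:E <= jordan_pos hPN (eucl_ball x r).
  move=> [Ax _]; have [l dl ls] := hdim x Ax.
  have le_ball r : mrestr (jordan_pos hPN) mA (eucl_ball x r) <= jordan_pos hPN (eucl_ball x r).
    apply: le_measure; rewrite ?inE; [apply: measurableI => //| |exact: subIsetl];
    exact: measurable_eucl_ball.
  have [|r0 r00 H] := local_minkowski_dim_lt _ dl ls.
    move=> r; rewrite measure_ge0/=; apply: (le_trans (le_ball r)).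
    apply: le_trans (pmu _ (measurable_eucl_ball x r)) _; apply: probability_le1.
    exact: measurable_eucl_ball.
  by exists r0 => // r rr0; exact: le_trans (H r rr0) (le_ball r).
have [J] := ex_good_set mAP nAP pAP dimA.
set S := _ `&` _ `&` _ => pS.
have mS : measurable S.
  by apply: measurableI; [apply: measurableI => //; exact: measurable_ratio_set|
    exact: measurable_growth_set].
have muS : 0 < mu S by exact: lt_le_trans pS (pmu _ mS).
have [m mE] : exists m : R, mu S = m%:E.
  by exists (fine (mu S)); rewrite fineK// fin_num_measure.
have m0 : (0 < m)%R by rewrite -lte_fin -mE.
pose r0 : R := (J.+1%:R^-1)%R.
have r00 : (0 < r0)%R by rewrite invr_gt0.
have ratioS x : S x -> forall r, (r <= r0)%R ->
    2%:E * jordan_neg hPN (eucl_ball x r) <= jordan_pos hPN (eucl_ball x r).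
  by move=> [[_ xJ] _]; exact: eucl_ball_le_real xJ.
pose K := (2 * (2 * d.+1%:R / r0 ^+ 2) ^+ d.+1)%R.
pose D := (k * ((2 * tau0)^-1 * (8 * d%:R)))%R.
have Hj j : (J <= j)%N -> (j.+1%:R `^ delta <= 2 * expR 1 * (K + 2 * D))%R.
  move=> Jj; apply: (@heat_growth_power _ d).
  (* The variance of the noise is [r ^+ 2], so that the diffusion length matches the radius at which
     the growth of mu_+ is used. *)
  set r : R := (j.+1%:R^-1)%R.
  have rgt0 : (0 < r)%R by rewrite invr_gt0.
  have t01 : (0 < r ^+ 2 <= 1)%R.
    by rewrite exprn_gt0//= exprn_ile1 ?(ltW rgt0)// invf_le1// ler1n.
  have [ikm ikn Hcrit] := critical_heat_kernel_le hd hmu hnu imn tau00 crit kE k0 mS t01.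
  have Hlow : forall x, S x -> (r `^ (d%:R - delta))%:E <= jordan_pos hPN (eucl_ball x r).
    by move=> x [_ xJ]; exact: xJ.
  have := le_integral_heat_kernel mS mu rgt0 Hlow.
  have : jordan_neg hPN setT <= 1.
    by apply: le_trans (nnu _ measurableT) _; rewrite probability_setT.
  move=> /(heat_kernel_compare mS mu t01 r00 ratioS).
  have ikp := le_integrable_prod (fun X _ => lexx (mu X)) pmu ikm.
  have ikq := le_integrable_prod (fun X _ => lexx (mu X)) nnu ikn.
  have ikc := le_integrable_prod (fun X _ => lexx (mu X)) cmu ikm.
  have Lm : int_lincomb mu 1%R (jordan_pos hPN) 1%R c.
    by apply: int_lincombP => // X mX; rewrite !mul1e; exact: muE.
  have Ln : int_lincomb nu 1%R (jordan_neg hPN) 1%R c.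
    by apply: int_lincombP => // X mX; rewrite !mul1e; exact: nuE.
  have [_ e1] := int_lincomb_integral (int_lincomb_prodr mu Lm) ikp ikc.
  have [_ e2] := int_lincomb_integral (int_lincomb_prodr mu Ln) ikq ikc.
  have fin (m' : {measure set (Euclid R d * Euclid R d) -> \bar R}) f :
      m'.-integrable setT f -> exists a : R, \int[m']_z f z = a%:E.
    move=> ig; exists (fine (\int[m']_z f z)).
    by apply/esym/fineK; exact: integrable_fin_num.
  have [u uE] := fin _ _ ikp; have [v vE] := fin _ _ ikq; have [w wE] := fin _ _ ikc.
  (* The common part [c] contributes the same finite integral [w] to both sides of the criticality
     inequality and cancels, which leaves the Jordan parts alone. *)
  move: Hcrit; rewrite e1 e2 !mul1e uE vE wE mE -!EFinM -!EFinD !lee_fin.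
  move=> h1 h2 h3.
  have {}h1 : (u <= v + D * r ^+ 2 * m)%R.
    by move: h1; rewrite /D -!mulrA addrAC lerD2r.
  have := le_trans h3 (combine_heat_bounds h1 h2); rewrite ler_pM2r//.
  by rewrite [X in (_ <= X -> _)%R](_ : _ = (K + 2 * D) * r ^+ 2)%R//; rewrite /K; ring.
have /andP[delta0 _] := hdelta.
(* The bound in [Hj] does not depend on [j], whereas a positive power of [j.+1] is unbounded. *)
have [j0 jb] := unbounded_powR (2 * expR 1 * (K + 2 * D)) delta0.
have := Hj (maxn J j0) (leq_maxl _ _).
by rewrite leNgt jb// leq_maxr.
Qed.
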